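(* Consider the bilevel problem in expectation form, $f(x,y)=\mathbb E_\xi[F(x,y;\xi)]$, $g(x,y)=\mathbb E_\zeta[G(x,y;\zeta)]$. Assume: (i) $\nabla f$ is $L^f$-Lipschitz in $(x,y)$ and $\|\nabla_2 f(x,y^*(x))\|\le C^f$ for all $x$; (ii) $\nabla g$ and $\nabla^2 g$ are $L_1^g$- and $L_2^g$-Lipschitz in $(x,y)$, and $g(x,\cdot)$ is $\mu$-strongly convex for every $x$; (iii) there are positive constants $\sigma_f,\sigma_{g,1},\sigma_{g,2}$ with $\mathbb E\|\nabla F(x,y;\xi)-\nabla f(x,y)\|^2\le\sigma_f^2$, $\mathbb E\|\nabla G(x,y;\zeta)-\nabla g(x,y)\|^2\le\sigma_{g,1}^2$, $\mathbb E\|\nabla^2G(x,y;\zeta)-\nabla^2g(x,y)\|^2\le\sigma_{g,2}^2$ for all $(x,y)$; (iv) $\nabla F(\cdot;\xi)$, $\nabla G(\cdot;\zeta)$, $\nabla^2G(\cdot;\zeta)$ are $L^f$-, $L_1^g$-, $L_2^g$-Lipschitz in $(x,y)$, respectively; (v) $H$ is bounded below. Then there exist positive constants $\eta,c_\beta,c_\gamma,c_x,c_y,c_z$ such that if, for all $k$, $$\alpha_k=\frac1{(\eta+k)^{1/3}},\quad\beta_k=c_\beta\alpha_k,\quad\gamma_k=c_\gamma\alpha_k,\quad\rho_k^x=c_x\alpha_k^2,\quad\rho_k^y=c_y\alpha_k^2,\quad\rho_k^z=c_z\alpha_k^2,$$ then the iterates of SRMBA run for $K>1$ iterations satisfy $$\frac1K\sum_{k=0}^{K-1}\mathbb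 E\left[\|\nabla H(x_k)\|^2\right]=\mathcal O\left(\frac{\log(K-1)}{K^{2/3}}\right)\qquad(K\to\infty).$$
   Context: Bilevel problem: minimize $H(x)=f(x,y^*(x))$ over $x\in\mathbb{R}^{d_x}$, where $y^*(x)=\arg\min_{y\in\mathbb{R}^{d_y}}g(x,y)$ and $f,g$ are smooth real-valued functions on $\mathbb{R}^{d_x}\times\mathbb{R}^{d_y}$. $\nabla_1,\nabla_2$ are the partial gradients in $x$ and $y$; $\nabla_{12}^2 g$ ($d_x\times d_y$) and $\nabla_{22}^2g$ ($d_y\times d_y$) are blocks of the Hessian. The stochastic derivatives $\nabla F,\nabla G,\nabla^2G$ are unbiased for $\nabla f,\nabla g,\nabla^2g$. Put $z^*(x)=[\nabla_{22}^2g(x,y^*(x))]^{-1}\nabla_2f(x,y^*(x))$. Let $R=C^f/\mu$ and let $\mathrm{Proj}_{\mathbb B(R)}$ be the Euclidean projection onto the closed ball of radius $R$ centered at $0$ in $\mathbb R^{d_y}$. SRMBA. For $u=(x,y,z)$ let $$D_x(u;\xi,\zeta)=\nabla_1F(x,y;\xi)-\nabla_{12}^2G(x,y;\zeta)z,\quad D_y(u;\zeta)=\nabla_2G(x,y;\zeta),\quad D_z(u;\xi,\zeta)=\nabla_{22}^2G(x,y;\zeta)z-\nabla_2F(x,y;\xi).$$ At iteration $k$, draw fresh independent samples $\xi_k,\zeta_k$ (independent of the past). For $\bullet\in\{x,y,z\}$ let $D_k^\bullet$ and $D_{k-1}^\bullet$ denote the values of $D_\bullet$ at $u_k=(x_k,y_k,z_k)$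 and $u_{k-1}=(x_{k-1},y_{k-1},z_{k-1})$, both evaluated with the current samples $(\xi_k,\zeta_k)$, and set $$v_k^\bullet=\rho_k^\bullet D_k^\bullet+(1-\rho_k^\bullet)\left(D_k^\bullet-D_{k-1}^\bullet+v_{k-1}^\bullet\right).$$ Updates: $x_{k+1}=x_k-\alpha_kv_k^x$, $y_{k+1}=y_k-\beta_kv_k^y$, $z_{k+1}=\mathrm{Proj}_{\mathbb B(R)}(z_k-\gamma_kv_k^z)$, with given initial points $u_{-1},u_0$ (with $z_{-1},z_0\in\mathbb B(R)$) and initial directions $v_{-1}^\bullet$. Convention: the constants $\eta,c_\beta,c_\gamma,c_x,c_y,c_z$ depend only on $L^f,C^f,L_1^g,L_2^g,\mu,\sigma_f,\sigma_{g,1},\sigma_{g,2}$; the constant hidden in $\mathcal O$ depends only on these and on the initial data, not on $K$. *)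

(* Defs.v *)
From HB Require Import structures.
From mathcomp Require Import all_boot all_order all_algebra.
From mathcomp Require Import all_classical all_reals all_analysis.

Set Implicit Arguments.
Unset Strict Implicit.
Unset Printing Implicit Defensive.

Import Order.TTheory GRing.Theory Num.Theory.
Import numFieldNormedType.Exports.

Local Open Scope classical_set_scope.
Local Open Scope ring_scope.

Section Euclidean.
Context {R : realType}.

(* The library norm on matrices is the maximum norm, hence these two. *)
Definition enorm n (v : 'cV[R]_n) : R := Num.sqrt (\sum_(i < n) v i 0 ^+ 2).

Definition opnorm m n (A : 'M[R]_(m, n)) : R :=
  sup [set enorm (A *m z) | z in [set z : 'cV[R]_n | enorm z <= 1]].

Definition eball n (r : R) : set 'cV[R]_n := [set z | enorm z <= r].

Definition eproj n (S : set 'cV[R]_n) (z : 'cV[R]_n) : 'cV[R]_n :=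
  xget 0 [set p | S p /\ forall q, S q -> enorm (z - p) <= enorm (z - q)].

Definition grad n (h : 'cV[R]_n -> R) (w : 'cV[R]_n) : 'cV[R]_n :=
  \col_i 'D_(delta_mx i 0) h w.

Definition hess n (h : 'cV[R]_n -> R) (w : 'cV[R]_n) : 'M[R]_n :=
  \matrix_(i, j) 'D_(delta_mx j 0) (fun w' => grad h w' i 0) w.

Definition grad_lipschitz n (L : R) (h : 'cV[R]_n -> R) :=
  forall w w', enorm (grad h w - grad h w') <= L * enorm (w - w').

Definition hess_lipschitz n (L : R) (h : 'cV[R]_n -> R) :=
  forall w w', opnorm (hess h w - hess h w') <= L * enorm (w - w').

Definition strongly_convex n (mu : R) (h : 'cV[R]_n -> R) :=
  forall (y y' : 'cV[R]_n) (t : R), 0 <= t <= 1 ->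
    h (t *: y + (1 - t) *: y') <=
    t * h y + (1 - t) * h y' - mu / 2 * (t * (1 - t)) * enorm (y - y') ^+ 2.

(* Differentiability is Frechet differentiability, which does not depend on
   the norm; differentiability of the gradient gives the Hessian a meaning. *)
Definition smooth1 n (h : 'cV[R]_n -> R) := forall w, differentiable h w.

Definition smooth2 n (h : 'cV[R]_n -> R) :=
  smooth1 h /\ forall w, differentiable (grad h) w.

End Euclidean.

Section Sampling.
Context {R : realType}.

Definition has_mean d (T : measurableType d) (P : probability T R)
    (X : T -> R) (m : R) :=
  P.-integrable setT (EFin \o X) /\ ('E_P[X] = m%:E)%E.

Definition has_mean_mx d (T : measurableType d) (P : probability T R)
    m n (X : T -> 'M[R]_(m, n)) (A : 'M[R]_(m, n)) :=
  forall i j, has_mean P (fun t => X t i j) (A i j).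

(* Mutual independence of the whole family
   xi 0, zeta 0, xi 1, zeta 1, ...; taking some of the A k, B k to be the whole
   space gives the product rule over every finite subfamily. *)
Definition independent_samples d d1 d2 (Omega : measurableType d)
    (T1 : measurableType d1) (T2 : measurableType d2) (P : probability Omega R)
    (xi : nat -> Omega -> T1) (zeta : nat -> Omega -> T2) :=
  forall (n : nat) (A : nat -> set T1) (B : nat -> set T2),
    (forall k, measurable (A k)) -> (forall k, measurable (B k)) ->
    P (\bigcap_(k in `I_n) ((xi k @^-1` A k) `&` (zeta k @^-1` B k))) =
    (\prod_(k < n) (P (xi k @^-1` A k) * P (zeta k @^-1` B k)))%E.

End Sampling.

Section Bilevel.
Context {R : realType} {dx dy : nat}.
(* A function of (x, y) is a function of the stacked vector col_mx x y, so that
   the partial gradients and Hessian blocks are usubmx, dsubmx, ursubmx and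
   drsubmx of the full gradient and Hessian. *)
Implicit Types f g : 'cV[R]_(dx + dy) -> R.

Definition ystar g (x : 'cV[R]_dx) : 'cV[R]_dy :=
  xget 0 [set y | forall y', g (col_mx x y) <= g (col_mx x y')].

Definition hyper f g (x : 'cV[R]_dx) : R := f (col_mx x (ystar g x)).

Definition zstar f g (x : 'cV[R]_dx) : 'cV[R]_dy :=
  let w := col_mx x (ystar g x) in
  invmx (drsubmx (hess g w)) *m dsubmx (grad f w).

(* Used both for the points u = (x, y, z) and the directions v. *)
Record triple := Triple {
  tx : 'cV[R]_dx;
  ty : 'cV[R]_dy;
  tz : 'cV[R]_dy
}.

(* With f := F xi and g := G zeta these are D_x, D_y, D_z at the samples. *)
Definition direction f g (u : triple) : triple :=
  let w := col_mx (tx u) (ty u) in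
  Triple (usubmx (grad f w) - ursubmx (hess g w) *m tz u)
         (dsubmx (grad g w))
         (drsubmx (hess g w) *m tz u - dsubmx (grad f w)).

Definition momentum n (rho : R) (d dprev vprev : 'cV[R]_n) : 'cV[R]_n :=
  rho *: d + (1 - rho) *: (d - dprev + vprev).

(* srmba k = (u_(k-1), u_k, v_(k-1)) for the sample sequences s and t. *)
Fixpoint srmba (T1 T2 : Type) (F : T1 -> 'cV[R]_(dx + dy) -> R)
    (G : T2 -> 'cV[R]_(dx + dy) -> R) (r : R)
    (alpha beta gamma rhox rhoy rhoz : nat -> R) (uprev0 u0 vprev0 : triple)
    (s : nat -> T1) (t : nat -> T2) (k : nat) : triple * triple * triple :=
  match k with
  | 0 => (uprev0, u0, vprev0)
  | k'.+1 =>
    let: (uprev, u, vprev) :=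
      srmba F G r alpha beta gamma rhox rhoy rhoz uprev0 u0 vprev0 s t k' in
    let D := direction (F (s k')) (G (t k')) u in
    let Dprev := direction (F (s k')) (G (t k')) uprev in
    let v := Triple (momentum (rhox k') (tx D) (tx Dprev) (tx vprev))
                    (momentum (rhoy k') (ty D) (ty Dprev) (ty vprev))
                    (momentum (rhoz k') (tz D) (tz Dprev) (tz vprev)) in
    (u, Triple (tx u - alpha k' *: tx v)
               (ty u - beta k' *: ty v)
               (eproj (eball r) (tz u - gamma k' *: tz v)), v)
  end.

Definition srmba_x (T1 T2 : Type) (F : T1 -> 'cV[R]_(dx + dy) -> R)
    (G : T2 -> 'cV[R]_(dx + dy) -> R) (r : R)
    (alpha beta gamma rhox rhoy rhoz : nat -> R) (uprev0 u0 vprev0 : triple)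
    (s : nat -> T1) (t : nat -> T2) (k : nat) : 'cV[R]_dx :=
  tx (srmba F G r alpha beta gamma rhox rhoy rhoz uprev0 u0 vprev0 s t k).1.2.

(* Size of the initial data: initial optimality gap, distances to the lower
   level and linear system solutions, initial displacement, and error of the
   initial directions with respect to the mean directions at u_(-1). *)
Definition init_size f g (uprev0 u0 vprev0 : triple) : R :=
  let D := direction f g uprev0 in
  hyper f g (tx u0) - inf (range (hyper f g))
  + enorm (ty u0 - ystar g (tx u0)) + enorm (tz u0 - zstar f g (tx u0))
  + enorm (tx u0 - tx uprev0) + enorm (ty u0 - ty uprev0)
  + enorm (tz u0 - tz uprev0)
  + enorm (tx vprev0 - tx D) + enorm (ty vprev0 - ty D)
  + enorm (tz vprev0 - tz D).

End Bilevel.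
Arguments triple R dx dy : clear implicits.

(* Main.v *)
Require Import Defs.
From HB Require Import structures.
From mathcomp Require Import all_boot all_order all_algebra.
From mathcomp Require Import all_classical all_reals all_analysis.
From mathcomp Require Import measurable_realfun.
From mathcomp Require Import ring lra zify.
Import Order.TTheory GRing.Theory Num.Theory.
Import numFieldNormedType.Exports.
Local Open Scope classical_set_scope.
Local Open Scope ring_scope.

Set Implicit Arguments.
Unset Strict Implicit.
Unset Printing Implicit Defensive.

(** The method is a single-loop scheme with recursive momentum, and the proof
    is a Lyapunov argument whose potential couples four quantities: the
    optimality gap [H(x) - inf H], the two squared tracking errors
    [|y - ystar x|^2] and [|z - zstar x|^2], and the squared error of the search
    direction with the weight [lam / alpha_k].

    _Deterministic part._ The hypergradient is the [x]-direction evaluated at the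
    exact data [(x, ystar x, zstar x)].  The mean value theorem for [grad g],
    tested against the adjoint vector [(0, zstar x)], gives the one consequence
    of the implicit derivative of [ystar] that the chain rule uses, and the
    result is a Taylor estimate for [H] with quadratic remainder
    ([hyper_taylor]).  In [y] and in [z] the exact direction is strongly
    monotone, so each update contracts towards a solution that moves by at most a
    multiple of the step in [x] ([tracking_step]).  The projection in [z] is harmless, since [zstar x] lies in the ball; it keeps
    [z] bounded, which makes the directions Lipschitz in the iterates.  The
    constants are chosen so that each negative drift absorbs the errors that
    feed it ([admissible_exists]), and one step of the potential follows
    ([potential_step]).

    _Stochastic part._ The error of the new direction is [(1 - rho)] times the
    old error plus a centred perturbation whose second moment is at most a
    multiple of [rho^2 sigma^2 + |u_k - u_(k-1)|^2] ([noise_step]).  The centring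
    is conditional on the past.  It is expressed by Tonelli's theorem for the
    product of the law of the past and the law of the fresh sample
    ([fresh_le]), which needs the stochastic derivatives to be jointly
    measurable in sample and point: they are measurable in the sample and
    Lipschitz in the point ([measurable_caratheodory]).

    _Rate._ With [alpha_k = (eta + k)^(-1/3)] and [rho_k = c alpha_k^2] the weight
    [1 / alpha_k] grows by less than the damping removes ([step_weights]), and
    the noise contributes [rho_k^2 / alpha_k], a multiple of
    [alpha_k^3 <= 1 / (k + 1)].  The noise therefore sums to [O(log K)]; dividing
    by [K alpha_K], which is of order [K^(2/3)], yields the claim. *)

(** * Euclidean norm and operator norm *)

Section InnerProduct.
Context {R : realType}.

Definition dotv n (u v : 'cV[R]_n) : R := (u^T *m v) 0 0.

Lemma dotvE n (u v : 'cV[R]_n) : dotv u v = \sum_i u i 0 * v i 0.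
Proof. by rewrite /dotv mxE; apply: eq_bigr => i _; rewrite mxE. Qed.

Lemma dotvC n (u v : 'cV[R]_n) : dotv u v = dotv v u.
Proof. by rewrite !dotvE; apply: eq_bigr => i _; rewrite mulrC. Qed.

Lemma dotvDr n (u v w : 'cV[R]_n) : dotv u (v + w) = dotv u v + dotv u w.
Proof. by rewrite /dotv mulmxDr mxE. Qed.

Lemma dotvDl n (u v w : 'cV[R]_n) : dotv (v + w) u = dotv v u + dotv w u.
Proof. by rewrite dotvC dotvDr !(dotvC u). Qed.

Lemma dotvZr n a (u v : 'cV[R]_n) : dotv u (a *: v) = a * dotv u v.
Proof. by rewrite /dotv -scalemxAr mxE. Qed.

Lemma dotvZl n a (u v : 'cV[R]_n) : dotv (a *: u) v = a * dotv u v.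
Proof. by rewrite dotvC dotvZr dotvC. Qed.

Lemma dotvNr n (u v : 'cV[R]_n) : dotv u (- v) = - dotv u v.
Proof. by rewrite -scaleN1r dotvZr mulN1r. Qed.

Lemma dotvNl n (u v : 'cV[R]_n) : dotv (- u) v = - dotv u v.
Proof. by rewrite dotvC dotvNr dotvC. Qed.

Definition dotvL := (dotvDr, dotvDl, dotvNr, dotvNl, dotvZr, dotvZl).

Lemma dotv0l n (u : 'cV[R]_n) : dotv 0 u = 0.
Proof. by rewrite -(scale0r u) dotvZl mul0r. Qed.

Lemma dotv0r n (u : 'cV[R]_n) : dotv u 0 = 0.
Proof. by rewrite dotvC dotv0l. Qed.

Lemma dotv_mul m n (p : 'cV[R]_m) (A : 'M[R]_(m, n)) v :
  dotv p (A *m v) = dotv (A^T *m p) v.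
Proof. by rewrite /dotv trmx_mul trmxK mulmxA. Qed.

Lemma dotv_ge0 n (u : 'cV[R]_n) : 0 <= dotv u u.
Proof. by rewrite dotvE; apply: sumr_ge0 => i _; rewrite -expr2 sqr_ge0. Qed.

Lemma enorm_sqr n (u : 'cV[R]_n) : enorm u ^+ 2 = dotv u u.
Proof.
have -> : enorm u = Num.sqrt (dotv u u) by rewrite /enorm dotvE; congr Num.sqrt.
by rewrite sqr_sqrtr // dotv_ge0.
Qed.

Lemma enorm_ge0 n (u : 'cV[R]_n) : 0 <= enorm u.
Proof. exact: sqrtr_ge0. Qed.
Hint Resolve enorm_ge0 : core.

Lemma enorm_eq0 n (u : 'cV[R]_n) : (enorm u == 0) = (u == 0).
Proof.
rewrite -sqrf_eq0 enorm_sqr dotvE psumr_eq0; last first.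
  by move=> i _; rewrite -expr2 sqr_ge0.
apply/allP/eqP => [h|-> i _]; last by rewrite mxE mul0r eqxx.
apply/colP => i; rewrite mxE; apply/eqP.
by have := h i (mem_index_enum _); rewrite /= mulf_eq0 orbb.
Qed.

Lemma enorm0 n : enorm (0 : 'cV[R]_n) = 0.
Proof. by apply/eqP; rewrite enorm_eq0. Qed.

Lemma enorm_gt0 n (u : 'cV[R]_n) : (0 < enorm u) = (u != 0).
Proof. by rewrite lt_neqAle eq_sym enorm_eq0 enorm_ge0 andbT. Qed.

Lemma enormZ n a (u : 'cV[R]_n) : enorm (a *: u) = `|a| * enorm u.
Proof.
apply/eqP; rewrite -(@eqrXn2 _ 2) ?mulr_ge0 //.
by rewrite exprMn !enorm_sqr !dotvL real_normK ?num_real // expr2 mulrA.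
Qed.

Lemma enormN n (u : 'cV[R]_n) : enorm (- u) = enorm u.
Proof. by rewrite -scaleN1r enormZ normrN1 mul1r. Qed.

Lemma enormBC n (u v : 'cV[R]_n) : enorm (u - v) = enorm (v - u).
Proof. by rewrite -opprB enormN. Qed.

(** The discriminant argument, with the extremal multiple inserted. *)
Lemma cauchy_schwarz n (u v : 'cV[R]_n) : dotv u v <= enorm u * enorm v.
Proof.
have [->|v0] := eqVneq v 0; first by rewrite dotv0r enorm0 mulr0.
have [->|u0] := eqVneq u 0; first by rewrite dotv0l enorm0 mul0r.
have up : 0 < enorm u by rewrite enorm_gt0.
have vp : 0 < enorm v by rewrite enorm_gt0.
have := dotv_ge0 (enorm v *: u - enorm u *: v).
rewrite !dotvL -!enorm_sqr (dotvC v u).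
set a := enorm u in up *; set b := enorm v in vp *; set c := dotv u v => h.
have {}h : 0 <= (a * b) * (2 * (a * b - c)).
  by move: h; congr (_ <= _); ring.
have ab : 0 < a * b by rewrite mulr_gt0.
by move: h; rewrite pmulr_rge0 // pmulr_rge0 // subr_ge0.
Qed.

Lemma cauchy_schwarzN n (u v : 'cV[R]_n) : - dotv u v <= enorm u * enorm v.
Proof. by rewrite -dotvNl -(enormN u) cauchy_schwarz. Qed.

Lemma dotv_norm n (u v : 'cV[R]_n) : `|dotv u v| <= enorm u * enorm v.
Proof. by rewrite ler_norml cauchy_schwarz lerNl cauchy_schwarzN. Qed.

Lemma enormD_sqr n (u v : 'cV[R]_n) :
  enorm (u + v) ^+ 2 = enorm u ^+ 2 + 2 * dotv u v + enorm v ^+ 2.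
Proof. rewrite !enorm_sqr !dotvL (dotvC v u); ring. Qed.

Lemma enormB_sqr n (u v : 'cV[R]_n) :
  enorm (u - v) ^+ 2 = enorm u ^+ 2 - 2 * dotv u v + enorm v ^+ 2.
Proof. rewrite enormD_sqr enormN dotvL; ring. Qed.

Lemma enormD n (u v : 'cV[R]_n) : enorm (u + v) <= enorm u + enorm v.
Proof.
rewrite -(@ler_pXn2r _ 2) ?nnegrE ?addr_ge0 // enormD_sqr.
have := cauchy_schwarz u v; nra.
Qed.

Lemma enormB n (u v : 'cV[R]_n) : enorm (u - v) <= enorm u + enorm v.
Proof. by rewrite -(enormN v) enormD. Qed.

Lemma enorm_le_of_dotv n (u : 'cV[R]_n) a :
  0 <= a -> (forall p, dotv p u <= a * enorm p) -> enorm u <= a.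
Proof.
move=> a0 h; have [->|u0] := eqVneq u 0; first by rewrite enorm0.
have := h u; rewrite -enorm_sqr expr2 ler_pM2r // enorm_gt0 //.
Qed.

Lemma enorm_coord n (u : 'cV[R]_n) i : `|u i 0| <= enorm u.
Proof.
rewrite -(@ler_pXn2r _ 2) ?nnegrE // real_normK ?num_real //.
rewrite enorm_sqr dotvE (bigD1 i) //= -expr2 lerDl.
by apply: sumr_ge0 => j _; rewrite -expr2 sqr_ge0.
Qed.

Lemma enorm_le_sum n (u : 'cV[R]_n) : enorm u <= \sum_i `|u i 0|.
Proof.
rewrite -(@ler_pXn2r _ 2) ?nnegrE //; last exact: sumr_ge0.
rewrite enorm_sqr dotvE expr2 mulr_suml; apply: ler_sum => i _.
rewrite (bigD1 i) //= mulrDr; apply: ler_wpDr.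
  by rewrite mulr_ge0 // sumr_ge0.
by rewrite -normrM ler_norm.
Qed.

Lemma dotv_col_mx m n (a c : 'cV[R]_m) (b d : 'cV[R]_n) :
  dotv (col_mx a b) (col_mx c d) = dotv a c + dotv b d.
Proof. by rewrite /dotv tr_col_mx mul_row_col mxE. Qed.

Lemma enorm_col_mx m n (a : 'cV[R]_m) (b : 'cV[R]_n) :
  enorm (col_mx a b) ^+ 2 = enorm a ^+ 2 + enorm b ^+ 2.
Proof. by rewrite !enorm_sqr dotv_col_mx. Qed.

Lemma enorm_col0 m n (b : 'cV[R]_n) : enorm (col_mx (0 : 'cV[R]_m) b) = enorm b.
Proof.
apply/eqP; rewrite -(@eqrXn2 _ 2) // enorm_col_mx enorm0 expr0n /= add0r //.
Qed.

Lemma enorm_colr0 m n (a : 'cV[R]_m) : enorm (col_mx a (0 : 'cV[R]_n)) = enorm a.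
Proof.
apply/eqP; rewrite -(@eqrXn2 _ 2) // enorm_col_mx enorm0 expr0n /= addr0 //.
Qed.

Lemma enorm_col_le m n (a : 'cV[R]_m) (b : 'cV[R]_n) :
  enorm (col_mx a b) <= enorm a + enorm b.
Proof.
have -> : col_mx a b = col_mx a 0 + col_mx 0 b by rewrite add_col_mx addr0 add0r.
by rewrite (le_trans (enormD _ _)) // enorm_col0 enorm_colr0.
Qed.

Lemma enorm_usubmx m n (w : 'cV[R]_(m + n)) : enorm (usubmx w) <= enorm w.
Proof.
rewrite -(@ler_pXn2r _ 2) ?nnegrE // -{2}(vsubmxK w) enorm_col_mx.
by rewrite lerDl sqr_ge0.
Qed.

Lemma enorm_dsubmx m n (w : 'cV[R]_(m + n)) : enorm (dsubmx w) <= enorm w.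
Proof.
rewrite -(@ler_pXn2r _ 2) ?nnegrE // -{2}(vsubmxK w) enorm_col_mx.
by rewrite lerDr sqr_ge0.
Qed.

(** Boundedness of the set whose supremum defines the operator norm; without
    it the supremum would carry no information. *)
Lemma opnorm_has_ubound m n (A : 'M[R]_(m, n)) :
  has_ubound [set enorm (A *m z) | z in [set z : 'cV[R]_n | enorm z <= 1]].
Proof.
exists (\sum_i enorm ((row i A)^T)) => _ [z /= z1 <-].
apply: (le_trans (enorm_le_sum _)); apply: ler_sum => i _.
have -> : (A *m z) i 0 = dotv (row i A)^T z.
  by rewrite dotvE mxE; apply: eq_bigr => j _; rewrite !mxE.
by apply: (le_trans (dotv_norm _ _)); rewrite ler_piMr.
Qed.

Lemma opnorm_mul m n (A : 'M[R]_(m, n)) v : enorm (A *m v) <= opnorm A * enorm v.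
Proof.
have [->|v0] := eqVneq v 0; first by rewrite mulmx0 !enorm0 mulr0.
have vp : 0 < enorm v by rewrite enorm_gt0.
rewrite -ler_pdivrMr //.
have -> : enorm (A *m v) / enorm v = enorm (A *m ((enorm v)^-1 *: v)).
  by rewrite -scalemxAr enormZ ger0_norm ?invr_ge0 // mulrC.
apply: ub_le_sup; first exact: opnorm_has_ubound.
exists ((enorm v)^-1 *: v) => //=.
by rewrite enormZ ger0_norm ?invr_ge0 // mulVf // gt_eqF.
Qed.

Lemma opnorm_ge0 m n (A : 'M[R]_(m, n)) : 0 <= opnorm A.
Proof.
apply: le_trans (enorm_ge0 (A *m 0)) _.
apply: ub_le_sup; first exact: opnorm_has_ubound.
by exists 0 => //=; rewrite enorm0.
Qed.

Lemma enorm_delta n (i : 'I_n) : enorm (delta_mx i 0 : 'cV[R]_n) = 1.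
Proof.
apply/eqP; rewrite -(@eqrXn2 _ 2) // enorm_sqr dotvE (bigD1 i) //= big1.
  by rewrite mxE !eqxx mulr1 addr0 expr1n.
by move=> j ji; rewrite mxE (negbTE ji) mul0r.
Qed.

Lemma mulmx_delta m n (A : 'M[R]_(m, n)) (j : 'I_n) :
  A *m delta_mx j 0 = col j A :> 'cV[R]_m.
Proof.
apply/colP => i; rewrite !mxE (bigD1 j) //= big1.
  by rewrite mxE !eqxx mulr1 addr0.
by move=> k kj; rewrite mxE (negbTE kj) mulr0.
Qed.

Lemma opnorm_entry m n (A : 'M[R]_(m, n)) i j : `|A i j| <= opnorm A.
Proof.
have := enorm_coord (A *m delta_mx j 0) i.
rewrite mulmx_delta mxE => /le_trans; apply.
by have := opnorm_mul A (delta_mx j 0); rewrite mulmx_delta enorm_delta mulr1.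
Qed.

Lemma entry_diff_le m n (A B : 'M[R]_(m, n)) i j : `|A i j - B i j| <= opnorm (A - B).
Proof. by have := opnorm_entry (A - B) i j; rewrite !mxE. Qed.

Lemma dotv_drsubmx m n (A : 'M[R]_(m + n)) p v :
  dotv p (drsubmx A *m v) = dotv (col_mx 0 p) (A *m col_mx 0 v).
Proof.
rewrite -{2}(submxK A) mul_block_col !mulmx0 !add0r dotv_col_mx dotv0l add0r //.
Qed.

Lemma ursubmx_mul m n (A : 'M[R]_(m + n)) (v : 'cV[R]_n) :
  ursubmx A *m v = usubmx (A *m col_mx 0 v).
Proof. by rewrite -{2}(submxK A) mul_block_col !mulmx0 !add0r col_mxKu. Qed.

Lemma drsubmx_mul m n (A : 'M[R]_(m + n)) (v : 'cV[R]_n) :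
  drsubmx A *m v = dsubmx (A *m col_mx 0 v).
Proof. by rewrite -{2}(submxK A) mul_block_col !mulmx0 !add0r col_mxKd. Qed.

End InnerProduct.
#[global] Hint Resolve enorm_ge0 : core.

(** * Projection onto a ball *)

Section Projection.
Context {R : realType} {n : nat}.
Implicit Types z p q : 'cV[R]_n.

(** The radial rescaling of [z] is a nearest point, hence the choice that defines
    [eproj] is made in a nonempty set. *)
Lemma eprojP (r : R) z : 0 <= r ->
  eball r (eproj (eball r) z) /\
  forall q, eball r q -> enorm (z - eproj (eball r) z) <= enorm (z - q).
Proof.
move=> r0; pose Q := [set p | eball r p /\ forall q, eball r q -> enorm (z - p) <= enorm (z - q)].
suff : exists p, Q p by exact: xgetPex.
have [zr|zr] := leP (enorm z) r.
  by exists z; split => [//|q _]; rewrite subrr enorm0 enorm_ge0.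
have zp : 0 < enorm z by rewrite (le_lt_trans r0).
exists ((r / enorm z) *: z); split.
  rewrite /eball /= enormZ ger0_norm ?divr_ge0 ?enorm_ge0 // -mulrA mulVf ?gt_eqF //.
  by rewrite mulr1.
move=> q qr; have -> : z - (r / enorm z) *: z = (1 - r / enorm z) *: z.
  by rewrite scalerBl scale1r.
rewrite enormZ ger0_norm ?subr_ge0 ?ler_pdivrMr ?mul1r //; last exact: ltW.
rewrite mulrBl mul1r -mulrA mulVf ?gt_eqF // mulr1.
rewrite lerBlDr (le_trans _ (lerD (lexx _) qr)) //.
by rewrite -{1}(subrK q z) enormD.
Qed.

Lemma eproj_in (r : R) z : 0 <= r -> eball r (eproj (eball r) z).
Proof. by move=> /(eprojP z)[]. Qed.

(** An affine lower bound that holds for every small slope passes to the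
    limit; stated so that no limit is taken. *)
Lemma le_of_small (a b c : R) :
  (forall t : R, 0 < t -> t <= 1 -> a <= b + t * c) -> a <= b.
Proof.
move=> h; have [//|ba] := leP a b; exfalso.
have [c0|c0] := leP c 0.
  have := h 1 ltr01 (lexx _); nra.
pose t := Num.min 1 ((a - b) / (2 * c)).
have c2 : 0 < 2 * c by rewrite mulr_gt0.
have t0 : 0 < t by rewrite /t lt_min ltr01 divr_gt0 // subr_gt0.
have t1 : t <= 1 by rewrite /t ge_min lexx.
have tc : t * (2 * c) <= a - b by rewrite -ler_pdivlMr // /t ge_min lexx orbT.
have := h t t0 t1; lra.
Qed.

(** The variational inequality of the projection: compare the nearest point
    [p] with the points [p + t (q - p)] of the ball as [t] tends to 0. *)
Lemma eproj_variational (r : R) z q : 0 <= r -> eball r q ->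
  dotv (z - eproj (eball r) z) (q - eproj (eball r) z) <= 0.
Proof.
move=> r0 qr; have [] := eprojP z r0; set p := eproj _ z => pr pmin.
apply: (@le_of_small _ _ (enorm (q - p) ^+ 2 / 2)) => t t0 t1.
have mr : eball r (p + t *: (q - p)).
  have -> : p + t *: (q - p) = (1 - t) *: p + t *: q.
    by rewrite scalerBr scalerBl scale1r addrA addrAC.
  rewrite /eball /= (le_trans (enormD _ _)) // !enormZ.
  rewrite !ger0_norm ?subr_ge0 //; last exact: ltW.
  move: pr qr; rewrite /eball /= => pr qr; nra.
have := pmin _ mr; rewrite -(@ler_pXn2r _ 2) ?nnegrE ?enorm_ge0 //.
have -> : z - (p + t *: (q - p)) = (z - p) - t *: (q - p) by rewrite opprD addrA.
rewrite (enormB_sqr (z - p)) dotvZr enormZ exprMn (ger0_norm (ltW t0)) => h.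
rewrite add0r; rewrite -(ler_pM2l t0); nra.
Qed.

Lemma eproj_nonexpansive (r : R) z z' : 0 <= r ->
  enorm (eproj (eball r) z - eproj (eball r) z') <= enorm (z - z').
Proof.
move=> r0; have h1 := eproj_variational z r0 (eproj_in z' r0).
have h2 := eproj_variational z' r0 (eproj_in z r0).
move: h1 h2; set p := eproj _ z; set p' := eproj _ z' => h1 h2.
have [->|pp] := eqVneq p p'; first by rewrite subrr enorm0 enorm_ge0.
have pp0 : 0 < enorm (p - p') by rewrite enorm_gt0 subr_eq0.
rewrite -(ler_pM2r pp0) -expr2 enorm_sqr.
apply: le_trans (cauchy_schwarz _ _).
move: h1 h2; rewrite !dotvL (dotvC p' p); lra.
Qed.

Lemma eproj_id (r : R) z : 0 <= r -> eball r z -> eproj (eball r) z = z.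
Proof.
move=> r0 zr; have [_ /(_ _ zr)] := eprojP z r0.
rewrite subrr enorm0 => h; apply/esym/eqP; rewrite -subr_eq0 -enorm_eq0.
by rewrite eq_le h enorm_ge0.
Qed.

Lemma eproj_close (r : R) z q : 0 <= r -> eball r q ->
  enorm (eproj (eball r) z - q) <= enorm (z - q).
Proof. by move=> r0 qr; rewrite -{1}(eproj_id r0 qr) eproj_nonexpansive. Qed.

End Projection.

(** * Mean value and Taylor estimates *)

Section Calculus.
Context {R : realType}.

Lemma cV_sum_delta n (v : 'cV[R]_n) : v = \sum_i v i 0 *: delta_mx i 0.
Proof.
apply/colP => j; rewrite summxE (bigD1 j) //= big1 ?addr0.
  by rewrite !mxE !eqxx mulr1.
by move=> i ij; rewrite !mxE eq_sym (negbTE ij) mulr0.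
Qed.

Lemma derive_grad n (h : 'cV[R]_n -> R) w v :
  differentiable h w -> 'D_v h w = dotv (grad h w) v.
Proof.
move=> dh; rewrite deriveE // {1}(cV_sum_delta v) linear_sum dotvE.
by apply: eq_bigr => i _; rewrite linearZ /= mxE deriveE // mulrC.
Qed.

Lemma is_derive_line n (h : 'cV[R]_n -> R) w v (t : R) :
  differentiable h (w + t *: v) ->
  is_derive t (1 : R) (fun s : R => h (w + s *: v)) (dotv (grad h (w + t *: v)) v).
Proof.
move=> dh; have E : (fun s : R => s^-1 *:
    (((fun s : R => h (w + s *: v)) \o shift t) (s *: 1) - h (w + t *: v)))
  = (fun s : R => s^-1 *: ((h \o shift (w + t *: v)) (s *: v) - h (w + t *: v))).
  apply/funext => s /=; congr (_ *: (h _ - _)).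
  by rewrite [X in _ + X = _]scalerDl addrCA -scalerA scale1r.
apply: DeriveDef; rewrite /derivable /derive E.
  exact: (@diff_derivable _ _ _ _ _ v dh).
by rewrite -derive_grad.
Qed.

Lemma mvt_line n (h : 'cV[R]_n -> R) (w v : 'cV[R]_n) : smooth1 h ->
  exists2 t : R, 0 < t < 1 & h (w + v) - h w = dotv (grad h (w + t *: v)) v.
Proof.
move=> sh; pose phi s := h (w + s *: v).
have dphi (s : R) : is_derive s (1 : R) phi (dotv (grad h (w + s *: v)) v).
  exact: is_derive_line.
have cphi : {within `[0, 1], continuous phi}.
  by apply: derivable_within_continuous => s _; have [] := dphi s.
have [t t01 E] := MVT ltr01 (fun s _ => dphi s) cphi.
exists t; first by move: t01; rewrite in_itv.
by move: E; rewrite /phi scale1r scale0r addr0 subr0 mulr1.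
Qed.

(** The mean value theorem for the scalar function [dotv p \o grad h]; choosing
    the test vector [p] afterwards replaces a vector-valued Taylor formula. *)
Lemma mvt_grad n (h : 'cV[R]_n -> R) (w v p : 'cV[R]_n) : smooth2 h ->
  exists2 t : R, 0 < t < 1 &
    dotv p (grad h (w + v) - grad h w) = dotv p (hess h (w + t *: v) *m v).
Proof.
move=> [sh sh2]; pose k w := dotv p (grad h w).
have dcoord i u : differentiable (fun w => grad h w i 0) u.
  have -> : (fun w => grad h w i 0) = (fun M : 'cV[R]_n => M i 0) \o grad h by [].
  by apply: differentiable_comp => //; apply: differentiable_coord.
have kE : k = \sum_i (p i 0 *: (fun w => grad h w i 0) : 'cV[R]_n -> R).
  by apply/funext => u; rewrite fct_sumE /k dotvE.
have sk : smooth1 k.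
  by move=> u; rewrite kE; apply: differentiable_sum => i; apply: differentiableZ.
have [t t01 E] := mvt_line w v sk; exists t => //.
rewrite dotvDr dotvNr E dotv_mul; congr dotv.
apply/colP => j; rewrite !mxE kE derive_sum; last first.
  by move=> i; apply: derivableZ; apply: diff_derivable.
apply: eq_bigr => i _; rewrite deriveZ; last exact: diff_derivable.
by rewrite !mxE mulrC.
Qed.

Lemma norm_combine (D t E1 E2 X Y Z : R) :
  - X <= D - t * E1 -> D - t * E1 <= X -> t * (E1 - E2) <= Y ->
  - (t * (E1 - E2)) <= Y -> Y + X <= Z -> `|D - t * E2| <= Z.
Proof. move=> *; rewrite ler_norml; apply/andP; split; lra. Qed.

Lemma norm_scale (t X Y : R) :
  0 < t -> `|X| <= t ^+ 2 * Y -> `|t * X| <= t ^+ 3 * Y.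
Proof. by move=> t0 XY; rewrite normrM gtr0_norm // exprS -mulrA ler_pM2l. Qed.

Lemma sym_combine (t P Q X Y h1 h2 h3 h4 : R) : 0 < t ->
  `|h1 - h3 - h2 + h4 - t ^+ 2 * Y| <= t ^+ 3 * P ->
  `|h1 - h2 - h3 + h4 - t ^+ 2 * X| <= t ^+ 3 * Q -> X <= Y + t * (Q + P).
Proof.
move=> t0; rewrite !ler_norml => /andP[c1 c2] /andP[c3 c4].
have t2 : 0 < t ^+ 2 by rewrite exprn_gt0.
rewrite -(ler_pM2l t2).
have -> : t ^+ 2 * (Y + t * (Q + P)) = t ^+ 2 * Y + t ^+ 3 * Q + t ^+ 3 * P by ring.
lra.
Qed.

Lemma dotv_mul_scale m n (A : 'M[R]_(m, n)) v t u :
  dotv v (A *m (t *: u)) = t * dotv v (A *m u).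
Proof. by rewrite -scalemxAr dotvZr. Qed.

Lemma dotv_mulB_scale m n (A B : 'M[R]_(m, n)) v t u :
  dotv v ((A - B) *m (t *: u)) = t * (dotv v (A *m u) - dotv v (B *m u)).
Proof. by rewrite dotv_mul_scale mulmxBl dotvDr dotvNr. Qed.

Section FirstOrder.
Context {n : nat} (L : R) (h : 'cV[R]_n -> R).
Hypotheses (L0 : 0 <= L) (sh : smooth1 h) (gl : grad_lipschitz L h).

(** The mean value theorem costs a factor 2 against the integral form of the
    remainder, which only affects constants. *)
Lemma taylor1 w v :
  `|h (w + v) - h w - dotv (grad h w) v| <= L * enorm v ^+ 2.
Proof.
have [t /andP[t0 t1] ->] := mvt_line w v sh.
rewrite -dotvNl -dotvDl (le_trans (dotv_norm _ _)) //.
rewrite expr2 mulrA ler_wpM2r ?enorm_ge0 // (le_trans (gl _ _)) //.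
rewrite ler_wpM2l // addrC addKr enormZ gtr0_norm //.
by rewrite ler_piMl ?enorm_ge0 // ltW.
Qed.

Lemma grad_min0 w d :
  (forall t : R, h w <= h (w + t *: d)) -> 0 <= dotv (grad h w) d.
Proof.
move=> hm; apply: (@le_of_small _ _ _ (L * enorm d ^+ 2)) => t t0 t1.
have := taylor1 w (t *: d); rewrite ler_norml => /andP[_].
rewrite dotvZr enormZ exprMn (gtr0_norm t0) => h1; have h2 := hm t.
rewrite -(ler_pM2l t0); nra.
Qed.

End FirstOrder.

Section SecondOrder.
Context {n : nat} (L1 L2 : R) (h : 'cV[R]_n -> R).
Hypotheses (L20 : 0 <= L2) (sh : smooth2 h).
Hypotheses (gl : grad_lipschitz L1 h) (hl : hess_lipschitz L2 h).

Lemma hess_lip_mul w w' v :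
  enorm ((hess h w - hess h w') *m v) <= L2 * enorm (w - w') * enorm v.
Proof.
by apply: le_trans (opnorm_mul _ _) _; rewrite ler_wpM2r ?enorm_ge0 ?hl.
Qed.

Lemma taylor2 p w v :
  `|dotv p (grad h (w + v) - grad h w) - dotv p (hess h w *m v)|
  <= L2 * enorm v ^+ 2 * enorm p.
Proof.
have [t /andP[t0 t1] ->] := mvt_grad w v p sh.
rewrite -dotvNr -dotvDr -mulmxBl (le_trans (dotv_norm _ _)) //.
rewrite mulrC ler_wpM2r ?enorm_ge0 // (le_trans (hess_lip_mul _ _ _)) //.
rewrite expr2 mulrA ler_wpM2r ?enorm_ge0 // ler_wpM2l //.
rewrite addrC addKr enormZ gtr0_norm //.
by rewrite ler_piMl ?enorm_ge0 // ltW.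
Qed.

(** The difference quotients of the gradient bound its derivative. *)
Lemma hess_bound w v : 0 <= L1 -> enorm (hess h w *m v) <= L1 * enorm v.
Proof.
move=> L10; apply: enorm_le_of_dotv => [|p]; first by rewrite mulr_ge0 ?enorm_ge0.
apply: (@le_of_small _ _ _ (L2 * enorm v ^+ 2 * enorm p)) => t t0 t1.
have := taylor2 p w (t *: v); rewrite ler_norml => /andP[+ _].
rewrite enormZ exprMn (gtr0_norm t0) -scalemxAr dotvZr => h1.
have h2 := cauchy_schwarz p (grad h (w + t *: v) - grad h w).
have := gl (w + t *: v) w.
have -> : w + t *: v - w = t *: v by rewrite addrC addKr.
rewrite enormZ gtr0_norm // => h3.
have h4 : dotv p (grad h (w + t *: v) - grad h w) <= enorm p * (L1 * (t * enorm v)).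
  by rewrite (le_trans h2) // ler_wpM2l ?enorm_ge0.
rewrite -(ler_pM2l t0); move: h1 h4.
set A := dotv p _; set B := dotv p _; nra.
Qed.

(** Schwarz's theorem: both orders of the second difference
    [h (w + a + b) - h (w + a) - h (w + b) + h w] are compared with the
    Hessian by the mean value theorem, then [a] and [b] are scaled to 0. *)
Lemma hess_sym_dotv w a b :
  dotv (hess h w *m a) b = dotv (hess h w *m b) a.
Proof.
move: a b; suff H a b : dotv (hess h w *m a) b <= dotv (hess h w *m b) a.
  by move=> a b; apply/eqP; rewrite eq_le !H.
have bound (u v : 'cV[R]_n) (t : R) : 0 < t -> t <= 1 ->
   `|h (w + t *: u + t *: v) - h (w + t *: u) - h (w + t *: v) + h w
     - t ^+ 2 * dotv (hess h w *m u) v|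
   <= t ^+ 3 * (2 * L2 * (enorm u + enorm v) ^+ 2 * enorm v).
  move=> t0 t1.
  pose k z := h (z + t *: u) - h z.
  have dsh z : differentiable (fun z => h (z + t *: u)) z.
    have -> : (fun z => h (z + t *: u)) = h \o (fun z => z + t *: u) by [].
    by apply: differentiable_comp => //; apply: sh.1.
  have kE : k = (fun z => h (z + t *: u)) - h by [].
  have sk : smooth1 k.
    by move=> z; rewrite kE; apply: differentiableB; [exact: dsh|exact: sh.1].
  have gk z : grad k z = grad h (z + t *: u) - grad h z.
    apply/colP => i; rewrite !mxE.
    rewrite kE deriveB; [|exact: (@diff_derivable _ _ _ _ _ _ (dsh _))|exact: (@diff_derivable _ _ _ _ _ _ (sh.1 _))].
    have E : (fun s : R => s^-1 *: (((fun z => h (z + t *: u)) \o shift z)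
          (s *: delta_mx i 0) - h (z + t *: u)))
      = (fun s => s^-1 *: ((h \o shift (z + t *: u)) (s *: delta_mx i 0)
          - h (z + t *: u))).
      by apply/funext => s /=; rewrite addrA.
    by rewrite /derive E.
  have [s /andP[s0 s1]] := mvt_line w (t *: v) sk.
  rewrite gk /k => E.
  have -> : h (w + t *: u + t *: v) - h (w + t *: u) - h (w + t *: v) + h w =
    h (w + t *: v + t *: u) - h (w + t *: v) - (h (w + t *: u) - h w).
    rewrite -!addrA [t *: u + _]addrC; ring.
  rewrite E dotvC dotvZl.
  set z := w + s *: (t *: v).
  have b1 := taylor2 v z (t *: u).
  have b2 := cauchy_schwarz v ((hess h z - hess h w) *m (t *: u)).
  have b2' := cauchy_schwarzN v ((hess h z - hess h w) *m (t *: u)).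
  have b3 := hess_lip_mul z w (t *: u).
  have zw : enorm (z - w) <= t * enorm v.
    rewrite /z addrC addKr !enormZ !gtr0_norm // ler_piMl ?mulr_ge0 ?enorm_ge0 //.
    exact: ltW. exact: ltW.
  have v0 := enorm_ge0 v; have u0 := enorm_ge0 u.
  have b4 : enorm v * enorm ((hess h z - hess h w) *m (t *: u))
     <= enorm v * (L2 * (t * enorm v) * (t * enorm u)).
    rewrite ler_wpM2l // (le_trans b3) // enormZ gtr0_norm //.
    by rewrite ler_wpM2r ?mulr_ge0 // ?ler_wpM2l // ltW.
  have e1 : dotv v ((hess h z - hess h w) *m (t *: u)) =
      t * (dotv v (hess h z *m u) - dotv v (hess h w *m u)).
    exact: dotv_mulB_scale.
  have e2 : dotv v (hess h z *m (t *: u)) = t * dotv v (hess h z *m u).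
    exact: dotv_mul_scale.
  move: b1 b2 b2' b4; rewrite e1 e2 enormZ exprMn (gtr0_norm t0).
  rewrite [dotv (hess h w *m u) v]dotvC.
  generalize (dotv v (grad h (z + t *: u) - grad h z)).
  generalize (dotv v (hess h z *m u)) (dotv v (hess h w *m u)).
  move=> E1 E2 D; rewrite !ler_norml => /andP[c1 c2] c3 c4 c5.
  have K : enorm v * (L2 * (t * enorm v) * (t * enorm u)) +
     L2 * (t ^+ 2 * enorm u ^+ 2) * enorm v <=
     t ^+ 2 * (2 * L2 * (enorm u + enorm v) ^+ 2 * enorm v).
    move: v0 u0 L20 (ltW t0); clear; move=> v0 u0 L20 t0.
    rewrite -subr_ge0; set U := enorm u in u0 *; set V := enorm v in v0 *.
    have -> : t ^+ 2 * (2 * L2 * (U + V) ^+ 2 * V) -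
      (V * (L2 * (t * V) * (t * U)) + L2 * (t ^+ 2 * U ^+ 2) * V)
      = t ^+ 2 * (L2 * V * (U ^+ 2 + 3 * (U * V) + 2 * V ^+ 2)) by ring.
    by rewrite mulr_ge0 ?sqr_ge0 // mulr_ge0 ?mulr_ge0 // !addr_ge0 ?mulr_ge0 ?sqr_ge0.
  have F : `|D - t * E2| <= t ^+ 2 * (2 * L2 * (enorm u + enorm v) ^+ 2 * enorm v).
    exact: (norm_combine c1 c2 (le_trans c3 c5) (le_trans c4 c5) K).
  have -> : t * D - t ^+ 2 * E2 = t * (D - t * E2) by ring.
  rewrite -ler_norml; exact: norm_scale.
pose C := 2 * L2 * (enorm a + enorm b) ^+ 2 * enorm b
        + 2 * L2 * (enorm b + enorm a) ^+ 2 * enorm a.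
apply: (@le_of_small _ _ _ C) => t t0 t1.
have c1 := bound a b t t0 t1; have := bound b a t t0 t1.
rewrite [w + t *: b + _]addrAC => c2.
exact: (sym_combine t0 c2 c1).
Qed.

Lemma hess_sym w : (hess h w)^T = hess h w.
Proof.
apply/matrixP => i j; rewrite mxE.
have := hess_sym_dotv w (delta_mx i 0) (delta_mx j 0).
have E k l : dotv (hess h w *m delta_mx k 0) (delta_mx l 0) = hess h w l k.
  rewrite mulmx_delta dotvE (bigD1 l) //= big1 ?addr0.
    by rewrite !mxE !eqxx mulr1.
  by move=> m ml; rewrite !mxE (negbTE ml) mulr0.
by rewrite !E.
Qed.

End SecondOrder.
End Calculus.

(** * The lower-level problem *)

Section Auxiliary.
Context {R : realType}.

Lemma cauchy_real_cvg (u : nat -> R) :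
  (forall e : R, 0 < e -> exists N, forall n k, (N <= n)%N -> (N <= k)%N ->
     `|u n - u k| <= e) ->
  exists l, forall e : R, 0 < e -> exists N, forall n, (N <= n)%N -> `|u n - l| <= e.
Proof.
move=> hu.
have : cauchy (u @ \oo).
  apply/cauchy_exP => e e0.
  have [N hN] := hu (e / 2) (divr_gt0 e0 (ltr0n _ 2)).
  exists (u N); exists N => // n /= Nn.
  rewrite -ball_normE /ball_ /=; apply: (@le_lt_trans _ _ (e / 2)).
    exact: hN.
  by rewrite ltr_pdivrMr // ltr_pMr // ltr1n.
move=> /cauchy_cvgP /cvg_ex [l /cvgrPdist_le ul]; exists l => e e0.
have [N _ hN] := ul e e0; exists N => n Nn.
by rewrite distrC; exact: hN.
Qed.

Lemma inv_natS_small (e : R) : 0 < e -> exists N, forall n, (N <= n)%N -> n.+1%:R^-1 <= e.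
Proof.
move=> e0; have [N] := ltr_add_invr e0; rewrite add0r => hN.
exists N => n Nn; apply: le_trans (ltW hN).
by rewrite lef_pV2 ?posrE ?ltr0n // ler_nat.
Qed.

Lemma unitmx_of_ker n (A : 'M[R]_n) :
  (forall v : 'cV[R]_n, A *m v = 0 -> v = 0) -> A \in unitmx.
Proof.
move=> h; rewrite -unitmx_tr -row_free_unit; apply: inj_row_free => v vA.
have /h vT : A *m v^T = 0 by rewrite -[A]trmxK -trmx_mul vA trmx0.
by rewrite -(trmxK v) vT trmx0.
Qed.

(** The gradient collects derivatives along the coordinate directions, where the
    remainder divided by the step tends to 0. *)
Lemma grad_of_quadratic n (h : 'cV[R]_n -> R) w p C :
  (forall d, `|h (w + d) - h w - dotv p d| <= C * enorm d ^+ 2) -> grad h w = p.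
Proof.
move=> hC; apply/colP => i; rewrite mxE.
have C0 : 0 <= C.
  have := hC (delta_mx i 0); rewrite enorm_delta expr1n mulr1.
  exact: le_trans.
have pE : p i 0 = dotv p (delta_mx i 0).
  rewrite dotvE (bigD1 i) //= big1 ?addr0 ?mxE ?eqxx ?mulr1 //.
  by move=> j ji; rewrite mxE (negbTE ji) mulr0.
apply: cvg_lim => //; apply/cvgrPdist_le => e e0.
near=> s => /=.
have s0 : s != 0 by near: s; exact: nbhs_dnbhs_neq.
have -> : p i 0 - s^-1 *: (h (s *: delta_mx i 0 + w) - h w) =
   - (s^-1 * (h (w + s *: delta_mx i 0) - h w - dotv p (s *: delta_mx i 0))).
  change (p i 0 - s^-1 * (h (s *: delta_mx i 0 + w) - h w) =
   - (s^-1 * (h (w + s *: delta_mx i 0) - h w - dotv p (s *: delta_mx i 0)))).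
  rewrite dotvZr -pE [_ + w]addrC; move: (h _) (h _) (p i 0) => a b c.
  by field.
rewrite normrN normrM normfV ler_pdivrMl ?normr_gt0 //.
apply: le_trans (hC _) _; rewrite enormZ enorm_delta mulr1 expr2 mulrCA.
rewrite ler_wpM2l //.
have : `|s| <= e / (C + 1).
  by near: s; apply: dnbhs0_le; rewrite divr_gt0 // ltr_wpDl.
rewrite ler_pdivlMr ?ltr_wpDl // => h1.
by apply: le_trans h1; rewrite mulrC ler_wpM2l ?lerDl.
Unshelve. all: by end_near. Qed.

Lemma le_div_sqr (m c a : R) : 0 < m -> 0 <= a -> 0 <= c ->
  m * a ^+ 2 <= a * c -> a <= c / m.
Proof.
move=> m0 a0 c0 h; rewrite ler_pdivlMr //.
have [->|a1] := eqVneq a 0; first by rewrite mul0r.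
have ap : 0 < a by rewrite lt_neqAle eq_sym a1.
by rewrite -(ler_pM2l ap); move: h; rewrite expr2 mulrCA [m * a]mulrC.
Qed.

End Auxiliary.

Section LowerLevel.
Context {R : realType} {dx dy : nat}.
Variables (L mu : R) (g : 'cV[R]_(dx + dy) -> R).
Hypotheses (L0 : 0 <= L) (mu0 : 0 < mu) (sg : smooth2 g).
Hypotheses (glg : grad_lipschitz L g) (hlg : hess_lipschitz L g).
Hypothesis sc : forall x, strongly_convex mu (fun y => g (col_mx x y)).
Implicit Types (x : 'cV[R]_dx) (y d z : 'cV[R]_dy).

Lemma col_mx_addr x y d : col_mx x (y + d) = col_mx x y + col_mx 0 d.
Proof. by rewrite add_col_mx addr0. Qed.

Lemma scale_col0 (t : R) d : t *: col_mx (0 : 'cV[R]_dx) d = col_mx 0 (t *: d).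
Proof. by rewrite scale_col_mx scaler0. Qed.

(** Strong convexity between [y] and [y + d], divided by the position [t] of the
    intermediate point, as [t] tends to 0. *)
Lemma strong_convex_lower x y d :
  g (col_mx x y) + dotv (grad g (col_mx x y)) (col_mx 0 d)
    + mu / 2 * enorm d ^+ 2 <= g (col_mx x (y + d)).
Proof.
apply: (@le_of_small _ _ _ (L * enorm d ^+ 2 + mu / 2 * enorm d ^+ 2)) => t t0 t1.
have := sc x (y + d) y (t := t); rewrite (ltW t0) t1 => /(_ isT).
have -> : t *: (y + d) + (1 - t) *: y = y + t *: d.
  by rewrite scalerDr scalerBl scale1r addrAC [t *: y + _]addrC subrK.
rewrite [y + d - y]addrC addKr.
have := taylor1 L0 sg.1 glg (col_mx x y) (t *: col_mx 0 d).
rewrite ler_norml => /andP[+ _].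
rewrite enormZ enorm_col0 exprMn gtr0_norm // dotvZr scale_col0 -col_mx_addr.
move: (g _) (g _) (g _) (dotv _ _) (enorm d) => a b c e f h1 h2.
rewrite -(ler_pM2l t0); nra.
Qed.

Lemma strong_mono x y d :
  mu * enorm d ^+ 2 <=
  dotv (col_mx 0 d) (grad g (col_mx x (y + d)) - grad g (col_mx x y)).
Proof.
have h1 := strong_convex_lower x y d.
have := strong_convex_lower x (y + d) (- d).
rewrite addrK enormN => h2.
have h3 : dotv (grad g (col_mx x (y + d))) (col_mx 0 (- d)) =
   - dotv (col_mx 0 d) (grad g (col_mx x (y + d))).
  by rewrite -scaleN1r -scale_col0 dotvZr mulN1r dotvC.
rewrite h3 in h2; rewrite dotvDr dotvNr.
move: h1 h2; rewrite [dotv _ (col_mx 0 d)]dotvC => h1 h2; lra.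
Qed.

Lemma strong_mid x y y' : g (col_mx x (2^-1 *: (y + y'))) <=
  (g (col_mx x y) + g (col_mx x y')) / 2 - mu / 8 * enorm (y - y') ^+ 2.
Proof.
have := sc x y y' (t := 2^-1).
have -> : 0 <= (2^-1 : R) <= 1 by lra.
move=> /(_ isT).
have -> : 1 - 2^-1 = 2^-1 :> R by lra.
rewrite -scalerDr; move: (g _) (g _) (g _) (enorm _) => a b c e h; lra.
Qed.

(** A minimizing sequence is Cauchy by the midpoint inequality; continuity of
    [g] makes its limit a minimizer. *)
Lemma exists_minimizer x : exists y, forall y', g (col_mx x y) <= g (col_mx x y').
Proof.
pose q y := g (col_mx x y); pose S := range q.
have lbS : has_lbound S.
  pose G := grad g (col_mx x 0).
  exists (q 0 - enorm G ^+ 2 / (2 * mu)) => _ [y _ <-].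
  have := strong_convex_lower x 0 y; rewrite add0r -/(q y) -/(q 0) -/G.
  have := cauchy_schwarzN G (col_mx 0 y); rewrite enorm_col0.
  move: (dotv _ _) (enorm G) (enorm y) (q _) (q _) => a b c e f h1 h2.
  have : 0 <= (b - mu * c) ^+ 2 / (2 * mu) by rewrite divr_ge0 ?sqr_ge0 // mulr_ge0 // ltW.
  have -> : (b - mu * c) ^+ 2 / (2 * mu) = b ^+ 2 / (2 * mu) - b * c + mu / 2 * c ^+ 2.
    by field; rewrite lt0r_neq0.
  lra.
have hS : has_inf S by split => //; exists (q 0); exists 0.
pose m := inf S.
have mq y : m <= q y by apply: ge_inf => //; exists y.
have exY n : exists y, q y < m + n.+1%:R^-1.
  have n0 : 0 < n.+1%:R^-1 :> R by rewrite invr_gt0 ltr0n.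
  by have [_ [y _ <-] hy] := inf_adherent n0 hS; exists y.
have [Y hY] := choice exY.
have dY n k : enorm (Y n - Y k) ^+ 2 <= 4 / mu * (n.+1%:R^-1 + k.+1%:R^-1).
  have := strong_mid x (Y n) (Y k); have := mq (2^-1 *: (Y n + Y k)).
  have := hY n; have := hY k; rewrite /q.
  move: (g _) (g _) (g _) (enorm _) (n.+1%:R^-1) (k.+1%:R^-1) => a b c e u v h1 h2 h3 h4.
  rewrite mulrAC ler_pdivlMr //; lra.
have Ycauchy e : 0 < e -> exists N, forall n k, (N <= n)%N -> (N <= k)%N ->
    enorm (Y n - Y k) <= e.
  move=> e0; have e1 : 0 < mu * e ^+ 2 / 8 by rewrite divr_gt0 // mulr_gt0 // exprn_gt0.
  have [N hN] := inv_natS_small e1; exists N => n k Nn Nk.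
  rewrite -(@ler_pXn2r _ 2) ?nnegrE ?enorm_ge0 //; last exact: ltW.
  apply: le_trans (dY _ _) _; have := hN n Nn; have := hN k Nk.
  move: (n.+1%:R^-1) (k.+1%:R^-1) => u v h1 h2.
  rewrite mulrAC ler_pdivrMr //; lra.
have hl i : exists l, forall e : R, 0 < e -> exists N, forall n, (N <= n)%N ->
    `|Y n i 0 - l| <= e.
  apply: cauchy_real_cvg => e e0; have [N hN] := Ycauchy e e0.
  exists N => n k Nn Nk; apply: le_trans (hN n k Nn Nk).
  by have := enorm_coord (Y n - Y k) i; rewrite !mxE.
have [l {}hl] := choice hl.
pose y := \col_i l i; exists y => y'; apply: le_trans (mq y').
have close e : 0 < e -> exists N, forall n, (N <= n)%N -> enorm (Y n - y) <= e.
  move=> e0; pose e' := e / dy.+1%:R.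
  have e'0 : 0 < e' by rewrite divr_gt0.
  have [N hN] := choice (fun i => hl i e' e'0).
  exists (\max_i N i)%N => n Nn; apply: le_trans (enorm_le_sum _) _.
  apply: (@le_trans _ _ (\sum_(i < dy) e')).
    apply: ler_sum => i _; rewrite !mxE; apply: hN.
    by apply: leq_trans Nn; exact: leq_bigmax.
  rewrite sumr_const card_ord -(mulr_natr e') /e' mulrAC ler_pdivrMr //.
  by rewrite ler_pM2l // ler_nat.
pose G := grad g (col_mx x y).
apply: (@le_of_small _ _ _ (enorm G + L + 1)) => t t0 t1.
have [N1 hN1] := close t t0; have [N2 hN2] := inv_natS_small t0.
pose n := maxn N1 N2.
have {hN1} := hN1 n (leq_maxl _ _); have {hN2} := hN2 n (leq_maxr _ _).
have := hY n; rewrite /q; pose d := Y n - y.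
have -> : Y n = y + d by rewrite /d addrC subrK.
rewrite [y + d - y]addrC addKr.
have := taylor1 L0 sg.1 glg (col_mx x y) (col_mx 0 d).
rewrite -col_mx_addr enorm_col0 -/G ler_norml => /andP[+ _].
have := cauchy_schwarzN G (col_mx 0 d); rewrite enorm_col0.
have := enorm_ge0 d; have := enorm_ge0 G.
move: (dotv _ _) (enorm d) (enorm G) (g _) (g _) (n.+1%:R^-1).
move=> a b c e f u c0 b0 h1 h2 h3 h4 h5.
have b1 : L * b ^+ 2 <= L * t.
  by rewrite ler_wpM2l // expr2 (le_trans _ h5) // ler_piMr // (le_trans h5).
have b2 : c * b <= c * t by rewrite ler_wpM2l.
lra.
Qed.

Lemma ystarP x y' : g (col_mx x (ystar g x)) <= g (col_mx x y').
Proof.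
move: y'; rewrite /ystar.
suff : exists y, [set y | forall y', g (col_mx x y) <= g (col_mx x y')] y.
  by move=> /xgetPex; exact.
exact: exists_minimizer.
Qed.

Lemma grad_ystar x d : dotv (col_mx 0 d) (grad g (col_mx x (ystar g x))) = 0.
Proof.
have H d' : 0 <= dotv (grad g (col_mx x (ystar g x))) (col_mx 0 d').
  apply: (grad_min0 L0 sg.1 glg) => t.
  by rewrite scale_col0 -col_mx_addr ystarP.
apply/eqP; rewrite eq_le dotvC H andbT.
have := H (- d); have -> : col_mx (0 : 'cV[R]_dx) (- d) = - col_mx 0 d.
  by rewrite opp_col_mx oppr0.
by rewrite dotvNr oppr_ge0.
Qed.

Lemma enorm_col_diff x x' y : enorm (col_mx x y - col_mx x' y) = enorm (x - x').
Proof. by rewrite opp_col_mx add_col_mx subrr enorm_colr0. Qed.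

Lemma enorm_col_diffr x y y' : enorm (col_mx x y - col_mx x y') = enorm (y - y').
Proof. by rewrite opp_col_mx add_col_mx subrr enorm_col0. Qed.

(** Strong monotonicity of [grad g] in [y] bounds the motion of the minimizer by
    the change of the gradient at a fixed [y]. *)
Lemma ystar_lip x x' : enorm (ystar g x' - ystar g x) <= L / mu * enorm (x' - x).
Proof.
set d := ystar g x' - ystar g x.
rewrite mulrAC; apply: le_div_sqr; rewrite ?mulr_ge0 ?enorm_ge0 //.
apply: le_trans (strong_mono x' (ystar g x) d) _.
have -> : ystar g x + d = ystar g x' by rewrite addrC subrK.
rewrite dotvDr grad_ystar add0r dotvNr -[X in X <= _]add0r -(grad_ystar x d).
rewrite -dotvNr -dotvDr; apply: le_trans (cauchy_schwarz _ _) _.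
rewrite enorm_col0 ler_wpM2l ?enorm_ge0 // (le_trans (glg _ _)) //.
by rewrite enorm_col_diff enormBC.
Qed.

(** The infinitesimal form of [strong_mono]. *)
Lemma hess22_lower x y d :
  mu * enorm d ^+ 2 <= dotv (col_mx 0 d) (hess g (col_mx x y) *m col_mx 0 d).
Proof.
apply: (@le_of_small _ _ _ (L * enorm d ^+ 3)) => t t0 t1.
have := strong_mono x y (t *: d).
have := taylor2 L0 sg hlg (col_mx 0 d) (col_mx x y) (t *: col_mx 0 d).
rewrite dotv_mul_scale -scale_col0 dotvZl col_mx_addr -scale_col0.
rewrite !enormZ enorm_col0 !exprMn (gtr0_norm t0) ler_norml => /andP[_].
move: (dotv _ (grad _ _ - _)) => a; move: (dotv _ _) (enorm d) => b c h1 h2.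
have t2 : 0 < t ^+ 2 by rewrite exprn_gt0.
rewrite -(ler_pM2l t2).
have : t * a <= t * (t * b + L * (t ^+ 2 * c ^+ 2) * c) by rewrite ler_pM2l // -lerBlDl.
have -> : t * (t * b + L * (t ^+ 2 * c ^+ 2) * c) = t ^+ 2 * (b + t * (L * c ^+ 3)) by ring.
lra.
Qed.

Lemma drsub_lower x y d :
  mu * enorm d ^+ 2 <= dotv d (drsubmx (hess g (col_mx x y)) *m d).
Proof. by rewrite dotv_drsubmx hess22_lower. Qed.

Lemma drsub_unit x y : drsubmx (hess g (col_mx x y)) \in unitmx.
Proof.
apply: unitmx_of_ker => v v0; have := drsub_lower x y v.
rewrite v0 dotv0r => h; apply/eqP; rewrite -enorm_eq0 -sqrf_eq0 eq_le sqr_ge0 andbT.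
by move: h; rewrite pmulr_rle0.
Qed.

End LowerLevel.

#[local] Opaque grad hess ystar.

(** * The hypergradient *)

Lemma lip_combine {R : realType} (L a r c : R) :
  0 <= L -> 0 <= a -> c <= r -> L * a + L * a * c <= L * (1 + r) * a.
Proof.
move=> L0 a0 cr; have := ler_wpM2l (mulr_ge0 L0 a0) cr; lra.
Qed.

Lemma taylor_combine {R : realType} (a b k l m M r : R) :
  `|b - a - (k + l)| <= M -> `|0 - 0 - (m + l)| <= M * r ->
  `|b - a - (k - m)| <= M * (1 + r).
Proof.
rewrite !ler_norml => /andP[c1 c2] /andP[c3 c4].
apply/andP; split; lra.
Qed.

Lemma descent_combine {R : realType} (B H a D C p q e : R) :
  B - H - - (a * D) <= C * (a ^+ 2 * q ^+ 2) -> e ^+ 2 = q ^+ 2 - 2 * D + p ^+ 2 ->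
  B <= H - a / 2 * p ^+ 2 - a / 2 * q ^+ 2 + a / 2 * e ^+ 2 + C * a ^+ 2 * q ^+ 2.
Proof. move=> h ->; lra. Qed.

Lemma dsubmxB {R : realType} m n (a b : 'cV[R]_(m + n)) :
  dsubmx (a - b) = dsubmx a - dsubmx b.
Proof. exact: linearB. Qed.

Lemma usubmxB {R : realType} m n (a b : 'cV[R]_(m + n)) :
  usubmx (a - b) = usubmx a - usubmx b.
Proof. exact: linearB. Qed.

Lemma subrBB (V : zmodType) (p q s t : V) : p - q - (s - t) = p - s - (q - t).
Proof. by rewrite !opprB addrACA [RHS]addrACA [- q - s]addrC. Qed.

Lemma usub_direction_diff {R : realType} m n (a b : 'cV[R]_(m + n))
    (A B : 'M[R]_(m + n)) (z z' : 'cV[R]_n) :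
  (usubmx a - ursubmx A *m z) - (usubmx b - ursubmx B *m z') =
  usubmx (a - b) - usubmx (A *m col_mx 0 z - B *m col_mx 0 z').
Proof.
rewrite (ursubmx_mul A) (ursubmx_mul B) 2!usubmxB.
exact: subrBB.
Qed.

Lemma dsub_direction_diff {R : realType} m n (a b : 'cV[R]_(m + n))
    (A B : 'M[R]_(m + n)) (z z' : 'cV[R]_n) :
  (drsubmx A *m z - dsubmx a) - (drsubmx B *m z' - dsubmx b) =
  dsubmx (A *m col_mx 0 z - B *m col_mx 0 z') - dsubmx (a - b).
Proof.
rewrite (drsubmx_mul A) (drsubmx_mul B) 2!dsubmxB.
exact: subrBB.
Qed.

Lemma drsub_solution_diff {R : realType} m n (A B : 'M[R]_(m + n)) (z z' b b' : 'cV[R]_n) :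
  drsubmx A *m z' = b' -> drsubmx B *m z = b ->
  drsubmx A *m (z' - z) = (b' - b) - dsubmx ((A - B) *m col_mx 0 z).
Proof.
by move=> <- <-; rewrite mulmxBr mulmxBl dsubmxB -2!drsubmx_mul opprB addrA subrK.
Qed.

Lemma mulmx_diff {R : realType} m n (A B : 'M[R]_(m, n)) (u v w : 'cV[R]_n) : w = u - v ->
  A *m u - B *m v = A *m w + (A - B) *m v.
Proof. by move=> ->; rewrite mulmxBr mulmxBl addrA subrK. Qed.

Section HyperGradient.
Context {R : realType} {dx dy : nat}.
Variables (L mu r : R) (f g : 'cV[R]_(dx + dy) -> R).
Hypotheses (L0 : 0 <= L) (mu0 : 0 < mu) (r0 : 0 <= r).
Hypotheses (sf : smooth1 f) (sg : smooth2 g).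
Hypotheses (glf : grad_lipschitz L f) (glg : grad_lipschitz L g).
Hypothesis hlg : hess_lipschitz L g.
Hypothesis sc : forall x, strongly_convex mu (fun y => g (col_mx x y)).
Hypothesis fb : forall x, enorm (dsubmx (grad f (col_mx x (ystar g x)))) <= mu * r.
Implicit Types (x d : 'cV[R]_dx) (y e z p : 'cV[R]_dy).

Let wstar x := col_mx x (ystar g x).

Lemma zstarE x : drsubmx (hess g (wstar x)) *m zstar f g x = dsubmx (grad f (wstar x)).
Proof. by rewrite /zstar mulKVmx // (drsub_unit L0 mu0 sg glg hlg sc). Qed.

#[local] Opaque zstar.

(** The ball of the projection contains every [zstar x], hence projecting never
    increases the distance to the target. *)
Lemma zstar_ball x : enorm (zstar f g x) <= r.
Proof.
have -> : r = (mu * r) / mu by rewrite mulrAC mulfV ?mul1r // lt0r_neq0.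
apply: le_div_sqr; rewrite ?enorm_ge0 ?mulr_ge0 //; first exact: ltW.
apply: le_trans (drsub_lower L0 sg glg hlg sc x (ystar g x) _) _.
rewrite zstarE; apply: le_trans (cauchy_schwarz _ _) _.
by rewrite ler_wpM2l ?enorm_ge0 ?fb.
Qed.

Lemma wstar_lip x x' : enorm (wstar x' - wstar x) <= (1 + L / mu) * enorm (x' - x).
Proof.
have -> : wstar x' - wstar x = col_mx (x' - x) (ystar g x' - ystar g x).
  by rewrite opp_col_mx add_col_mx.
apply: le_trans (enorm_col_le _ _) _.
by rewrite mulrDl mul1r lerD2l (ystar_lip L0 mu0 sg glg sc).
Qed.

Definition zlip := L * (1 + r) * (1 + L / mu) / mu.

(** Subtract the linear systems solved at [x'] and [x], and use coercivity of
    the matrix at [x']. *)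
Lemma zstar_lip x x' : enorm (zstar f g x' - zstar f g x) <= zlip * enorm (x' - x).
Proof.
set z := zstar f g x; set z' := zstar f g x'.
have D0 : 0 <= 1 + L / mu by rewrite addr_ge0 // divr_ge0 // ltW.
rewrite /zlip mulrAC; apply: le_div_sqr; rewrite ?mulr_ge0 ?addr_ge0 ?divr_ge0 ?enorm_ge0 ?(ltW mu0) //.
apply: le_trans (drsub_lower L0 sg glg hlg sc x' (ystar g x') _) _.
have E := drsub_solution_diff (zstarE x') (zstarE x).
rewrite -/z -/z' in E.
rewrite E.
rewrite -dsubmxB.
apply: le_trans (cauchy_schwarz _ _) _; rewrite ler_wpM2l ?enorm_ge0 //.
apply: le_trans (enormB _ _) _.
have h1 := le_trans (enorm_dsubmx _) (glf (wstar x') (wstar x)).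
have h2 := le_trans (enorm_dsubmx _) (hess_lip_mul hlg (wstar x') (wstar x) (col_mx 0 z)).
apply: le_trans (lerD h1 h2) _.
rewrite enorm_col0.
have h3 := wstar_lip x x'; have h4 := zstar_ball x; rewrite -/z in h4.
set a := enorm (wstar x' - wstar x) in h3 *.
have a0 : 0 <= a by exact: enorm_ge0.
apply: (@le_trans _ _ (L * (1 + r) * a)).
  exact: lip_combine.
by rewrite -[leRHS]mulrA ler_wpM2l // mulr_ge0 // addr_ge0.
Qed.

(** The hypergradient: the formula that the chain rule gives for the gradient of
    [hyper f g], which [grad_hyper] confirms. *)
Definition hgrad x := tx (direction f g (Triple x (ystar g x) (zstar f g x))).

Definition hconst := L * (1 + r) * (1 + L / mu) ^+ 2.

(** Pairing the two stationarity conditions with the adjoint vector [zstar] gives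
    the one consequence of the implicit derivative of [ystar] that enters the
    chain rule, with a quadratic remainder. *)
Lemma hyper_taylor x d :
  `|hyper f g (x + d) - hyper f g x - dotv (hgrad x) d| <= hconst * enorm d ^+ 2.
Proof.
pose e := ystar g (x + d) - ystar g x; pose v := col_mx d e; set z := zstar f g x.
have dE : x + d - x = d by rewrite addrC addKr.
have vE : v = wstar (x + d) - wstar x.
  by rewrite opp_col_mx add_col_mx dE.
have wE : wstar (x + d) = wstar x + v by rewrite vE [RHS]addrC subrK.
have vn : enorm v <= (1 + L / mu) * enorm d.
  by have := wstar_lip x (x + d); rewrite -vE dE.
have vn2 : enorm v ^+ 2 <= (1 + L / mu) ^+ 2 * enorm d ^+ 2.
  rewrite -exprMn ler_pXn2r ?nnegrE ?enorm_ge0 // mulr_ge0 ?enorm_ge0 //.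
  by rewrite addr_ge0 // divr_ge0 // ltW.
have t1 := taylor1 L0 sf glf (wstar x) v.
have t2 := taylor2 L0 sg hlg (col_mx 0 z) (wstar x) v.
have key : dotv (col_mx 0 z) (hess g (wstar x) *m v) =
   dotv (ursubmx (hess g (wstar x)) *m z) d + dotv (dsubmx (grad f (wstar x))) e.
  rewrite dotv_mul (hess_sym L0 sg hlg).
  rewrite -[hess g (wstar x) *m _]vsubmxK dotv_col_mx -ursubmx_mul -drsubmx_mul.
  by rewrite zstarE.
have fE : dotv (grad f (wstar x)) v =
   dotv (usubmx (grad f (wstar x))) d + dotv (dsubmx (grad f (wstar x))) e.
  by rewrite -{1}[grad f _]vsubmxK dotv_col_mx.
move: t2; rewrite key -wE dotvDr dotvNr !(grad_ystar L0 mu0 sg glg sc).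
move: t1; rewrite fE -wE.
have -> : dotv (hgrad x) d = dotv (usubmx (grad f (wstar x))) d -
    dotv (ursubmx (hess g (wstar x)) *m z) d by rewrite dotvDl dotvNl.
rewrite /hyper -/(wstar x) -/(wstar (x + d)) enorm_col0 /hconst => t1 t2.
have zr : L * enorm v ^+ 2 * enorm z <= L * enorm v ^+ 2 * r.
  by rewrite ler_wpM2l ?zstar_ball // mulr_ge0 // sqr_ge0.
apply: le_trans (taylor_combine t1 (le_trans t2 zr)) _.
by rewrite [L * _ * (1 + r)]mulrAC -[leRHS]mulrA ler_wpM2l // mulr_ge0 // addr_ge0.
Qed.

Lemma grad_hyper x : grad (hyper f g) x = hgrad x.
Proof. exact: grad_of_quadratic (hyper_taylor x). Qed.

Lemma hyper_descent x v (a : R) :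
  hyper f g (x - a *: v) <= hyper f g x - a / 2 * enorm (hgrad x) ^+ 2
     - a / 2 * enorm v ^+ 2 + a / 2 * enorm (v - hgrad x) ^+ 2
     + hconst * a ^+ 2 * enorm v ^+ 2.
Proof.
have := hyper_taylor x (- (a *: v)); rewrite ler_norml => /andP[_].
rewrite enormN enormZ exprMn real_normK ?num_real // dotvNr dotvZr.
have := enormB_sqr v (hgrad x); rewrite (dotvC v).
by move=> E T; exact: descent_combine T E.
Qed.

End HyperGradient.

(** * Search directions *)

Section Directions.
Context {R : realType} {dx dy : nat}.
Variables (L r : R).
Hypotheses (L0 : 0 <= L) (r0 : 0 <= r).
Implicit Types u : triple R dx dy.

Definition tdist2 u u' :=
  enorm (tx u - tx u') ^+ 2 + enorm (ty u - ty u') ^+ 2 + enorm (tz u - tz u') ^+ 2.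

Lemma tdist2_ge0 u u' : 0 <= tdist2 u u'.
Proof. by rewrite /tdist2 !addr_ge0 // sqr_ge0. Qed.

Section OnePair.
Variables (f g : 'cV[R]_(dx + dy) -> R).
Hypotheses (sf : smooth1 f) (sg : smooth2 g).
Hypotheses (glf : grad_lipschitz L f) (glg : grad_lipschitz L g).
Hypothesis hlg : hess_lipschitz L g.

Let W u := col_mx (tx u) (ty u).

Lemma stacked_dist u u' :
  enorm (W u - W u') ^+ 2 = enorm (tx u - tx u') ^+ 2 + enorm (ty u - ty u') ^+ 2.
Proof. by rewrite opp_col_mx add_col_mx enorm_col_mx. Qed.

Lemma hess_col_diff (w w' : 'cV[R]_(dx + dy)) (z z' : 'cV[R]_dy) : enorm z' <= r ->
  enorm (hess g w *m col_mx 0 z - hess g w' *m col_mx 0 z') <=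
  L * enorm (z - z') + L * r * enorm (w - w').
Proof.
move=> zr.
have -> : hess g w *m col_mx 0 z - hess g w' *m col_mx 0 z' =
   hess g w *m col_mx 0 (z - z') + (hess g w - hess g w') *m col_mx 0 z'.
  apply: mulmx_diff; by rewrite opp_col_mx add_col_mx subrr.
apply: le_trans (enormD _ _) _; apply: lerD.
  have := hess_bound L0 sg glg hlg w (col_mx 0 (z - z')) L0.
  by rewrite enorm_col0.
apply: le_trans (hess_lip_mul hlg _ _ _) _.
by rewrite enorm_col0 [leRHS]mulrAC ler_wpM2l ?mulr_ge0 ?enorm_ge0.
Qed.

Lemma direction_x_diff u u' : enorm (tz u') <= r ->
  enorm (tx (direction f g u) - tx (direction f g u')) <=
  L * (1 + r) * enorm (W u - W u') + L * enorm (tz u - tz u').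
Proof.
move=> zr; rewrite [tx _]/= [X in _ - X]/= usub_direction_diff.
apply: le_trans (enormB _ _) _.
have h1 := le_trans (enorm_usubmx _) (glf (W u) (W u')).
have h2 := le_trans (enorm_usubmx _) (hess_col_diff (W u) (W u') (tz u) zr).
by have := lerD h1 h2; rewrite mulrDr mulr1 mulrDl -addrA [L * _ + L * r * _]addrC.
Qed.

Lemma direction_z_diff u u' : enorm (tz u') <= r ->
  enorm (tz (direction f g u) - tz (direction f g u')) <=
  L * (1 + r) * enorm (W u - W u') + L * enorm (tz u - tz u').
Proof.
move=> zr; rewrite [tz _]/= [X in _ - X]/= dsub_direction_diff.
apply: le_trans (enormB _ _) _.
have h1 := le_trans (enorm_dsubmx _) (glf (W u) (W u')).
have h2 := le_trans (enorm_dsubmx _) (hess_col_diff (W u) (W u') (tz u) zr).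
by have := lerD h2 h1; rewrite mulrDr mulr1 mulrDl [L * enorm (W _ - _) + _]addrC [L * enorm (tz _ - _) + _]addrC -!addrA [L * enorm (tz _ - _) + _]addrC.
Qed.

Lemma direction_y_diff u u' :
  enorm (ty (direction f g u) - ty (direction f g u')) <= L * enorm (W u - W u').
Proof.
rewrite /= -dsubmxB; exact: le_trans (enorm_dsubmx _) (glg (W u) (W u')).
Qed.

Lemma sqr_sum_bound (M a b N D : R) : 0 <= N -> 0 <= a -> 0 <= b -> L <= M ->
  N <= M * a + L * b -> a ^+ 2 + b ^+ 2 = D -> N ^+ 2 <= 2 * M ^+ 2 * D.
Proof.
move=> N0 a0 b0 LM h <-.
have M0 : 0 <= M := le_trans L0 LM.
have {}h : N <= M * (a + b).
  by apply: le_trans h _; rewrite mulrDr lerD2l ler_wpM2r.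
have : N ^+ 2 <= (M * (a + b)) ^+ 2.
  by rewrite ler_pXn2r ?nnegrE // mulr_ge0 // addr_ge0.
move/le_trans; apply; rewrite exprMn.
have ab : (a + b) ^+ 2 <= 2 * (a ^+ 2 + b ^+ 2) by have := sqr_ge0 (a - b); lra.
have := ler_wpM2l (sqr_ge0 M) ab; move: (_ ^+ 2) ((a + b) ^+ 2) => *; lra.
Qed.

(** The products Hessian times [z] are Lipschitz only where [z] is bounded; it is
    enough to bound it at one of the two points. *)
Lemma direction_lipschitz u u' : enorm (tz u') <= r ->
  let D := direction f g u in let D' := direction f g u' in
  [/\ enorm (tx D - tx D') ^+ 2 <= 2 * (L * (1 + r)) ^+ 2 * tdist2 u u',
      enorm (ty D - ty D') ^+ 2 <= 2 * (L * (1 + r)) ^+ 2 * tdist2 u u' &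
      enorm (tz D - tz D') ^+ 2 <= 2 * (L * (1 + r)) ^+ 2 * tdist2 u u'].
Proof.
move=> zr D D'.
have LM : L <= L * (1 + r) by rewrite ler_peMr // lerDl.
have E : enorm (W u - W u') ^+ 2 + enorm (tz u - tz u') ^+ 2 = tdist2 u u'.
  by rewrite stacked_dist.
split.
- by apply: (sqr_sum_bound _ _ _ LM (direction_x_diff u zr) E); exact: enorm_ge0.
- apply: (sqr_sum_bound _ _ _ LM _ E); try exact: enorm_ge0.
  apply: le_trans (direction_y_diff _ _) _.
  apply: ler_wpDr; first by rewrite mulr_ge0 ?enorm_ge0.
  by rewrite ler_wpM2r ?enorm_ge0.
- by apply: (sqr_sum_bound _ _ _ LM (direction_z_diff u zr) E); exact: enorm_ge0.
Qed.

End OnePair.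
End Directions.

(** * Inexact tracking of a moving target *)

Section Tracking.
Context {R : realType}.

Lemma young_sqr n (a b : 'cV[R]_n) (t : R) : 0 < t ->
  enorm (a + b) ^+ 2 <= (1 + t) * enorm a ^+ 2 + (1 + t^-1) * enorm b ^+ 2.
Proof.
move=> t0; rewrite enormD_sqr.
have := cauchy_schwarz a b; move: (dotv a b) (enorm a) (enorm b) => c x y h.
have : 0 <= (t * x - y) ^+ 2 / t by rewrite divr_ge0 ?sqr_ge0 // ltW.
have -> : (t * x - y) ^+ 2 / t = t * x ^+ 2 - 2 * (x * y) + t^-1 * y ^+ 2.
  by field; rewrite gt_eqF.
lra.
Qed.

Lemma enormD_sqr_le n (a b : 'cV[R]_n) :
  enorm (a + b) ^+ 2 <= 2 * enorm a ^+ 2 + 2 * enorm b ^+ 2.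
Proof. by have := young_sqr a b ltr01; rewrite invr1. Qed.

Lemma enormB_sqr_le n (a b : 'cV[R]_n) :
  enorm (a - b) ^+ 2 <= 2 * enorm a ^+ 2 + 2 * enorm b ^+ 2.
Proof. by rewrite -(enormN b) enormD_sqr_le. Qed.

(** Expanding the square, the quadratic term is absorbed by half of the linear
    drift because [b L^2 <= mu]. *)
Lemma contraction_step n (d G : 'cV[R]_n) (mu L b : R) :
  0 <= b -> b * L ^+ 2 <= mu -> 0 <= L ->
  mu * enorm d ^+ 2 <= dotv d G -> enorm G <= L * enorm d ->
  enorm (d - b *: G) ^+ 2 <= (1 - b * mu) * enorm d ^+ 2.
Proof.
move=> b0 bL L0 h1 h2; rewrite enormB_sqr dotvZr enormZ exprMn real_normK ?num_real //.
have {h2} : enorm G ^+ 2 <= (L * enorm d) ^+ 2.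
  by rewrite ler_pXn2r ?nnegrE ?mulr_ge0 ?enorm_ge0.
rewrite exprMn; move: h1.
have := sqr_ge0 (enorm d); move: (enorm d ^+ 2) (enorm G ^+ 2) (dotv d G) => D g p D0 h1 h2.
have k1 : b * (mu * D) <= b * p by rewrite ler_wpM2l.
have k2 : b ^+ 2 * g <= b ^+ 2 * (L ^+ 2 * D) by rewrite ler_wpM2l ?sqr_ge0.
have k3 : b * (b * L ^+ 2) * D <= b * mu * D by rewrite ler_wpM2r // ler_wpM2l.
lra.
Qed.

Lemma tracking_combine (m A B C : R) (E S : R) :
  0 < m -> m <= 1 -> 0 <= A -> 0 <= E -> 0 <= S ->
  B <= (1 - m) * A ->
  C <= (1 + m / 4) * ((1 + m / 2) * B + (1 + 2 / m) * E) + (1 + 4 / m) * S ->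
  C <= (1 - m / 4) * A + 4 / m * E + 5 / m * S.
Proof.
move=> m0 m1 A0 E0 S0 h1 h2; apply: le_trans h2 _.
have k1 : (1 + m / 4) * ((1 + m / 2) * B) <= (1 - m / 4) * A.
  have c0 : 0 <= (1 + m / 4) * (1 + m / 2) by rewrite mulr_ge0 // addr_ge0 // divr_ge0 // ltW.
  have := ler_wpM2l c0 h1; rewrite mulrA => /le_trans; apply.
  rewrite mulrA ler_wpM2r //; nra.
have k2 : (1 + m / 4) * ((1 + 2 / m) * E) <= 4 / m * E.
  rewrite mulrA ler_wpM2r //.
  have -> : (1 + m / 4) * (1 + 2 / m) = (m ^+ 2 / 4 + 3 * m / 2 + 2) / m.
    by field; rewrite gt_eqF.
  by rewrite ler_pM2r ?invr_gt0 //; nra.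
have k3 : (1 + 4 / m) * S <= 5 / m * S.
  rewrite ler_wpM2r //.
  have -> : 1 + 4 / m = (m + 4) / m by field; rewrite gt_eqF.
  by rewrite ler_pM2r ?invr_gt0 //; lra.
rewrite mulrDr; lra.
Qed.

(** One step of an inexact strongly monotone iteration towards a moving
    target: [d] is the current error, [e] the error in the direction and [s]
    the motion of the target. Young's inequality is used with weights that
    leave a quarter of the contraction. *)
Lemma tracking_step n (d G e s : 'cV[R]_n) (mu L b : R) :
  0 < mu -> 0 < b -> b * mu <= 1 -> b * L ^+ 2 <= mu -> 0 <= L ->
  mu * enorm d ^+ 2 <= dotv d G -> enorm G <= L * enorm d ->
  enorm (d - b *: (G + e) - s) ^+ 2 <=
  (1 - b * mu / 4) * enorm d ^+ 2 + 4 * b / mu * enorm e ^+ 2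
    + 5 / (b * mu) * enorm s ^+ 2.
Proof.
move=> mu0 b0 bm bL L0 h1 h2; have m0 : 0 < b * mu by rewrite mulr_gt0.
have c := contraction_step (ltW b0) bL L0 h1 h2.
have y1 := young_sqr (d - b *: G) (- (b *: e)) (divr_gt0 m0 (ltr0n R 2)).
have y2 := young_sqr (d - b *: G - b *: e) (- s) (divr_gt0 m0 (ltr0n R 4)).
rewrite scalerDr opprD addrA.
have -> : 4 * b / mu * enorm e ^+ 2 = 4 / (b * mu) * enorm (b *: e) ^+ 2.
  by rewrite enormZ exprMn real_normK ?num_real //; field; rewrite !gt_eqF.
apply: tracking_combine m0 bm _ _ _ c _; rewrite ?sqr_ge0 //.
move: y1 y2; rewrite !enormN !invf_div.
move=> y1 y2; apply: le_trans y2 _; rewrite lerD2r; apply: ler_wpM2l y1.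
exact: addr_ge0 ler01 (divr_ge0 (ltW (mulr_gt0 b0 mu0)) (ler0n _ 4)).
Qed.

End Tracking.

(** * Scalar bookkeeping of the potential *)

Section Scalars.
Context {R : realType}.

(** The admissible choices of constants: [cg] first, then [cb], [lam] and [c];
    each condition makes one negative drift dominate the errors feeding it. *)
Record admissible (M mu Ky Kz cb cg lam c : R) := Admissible {
  adm_cg_gt0 : 0 < cg;
  adm_cb_gt0 : 0 < cb;
  adm_lam_gt0 : 0 < lam;
  adm_c_gt1 : 1 < c;
  adm_cg_z : 4 * (2 * M ^+ 2 + 1) <= cg * mu;
  adm_cg_x : 80 * Kz <= cg * mu;
  adm_cb_y : 4 * (2 * M ^+ 2 + 8 * cg / mu * M ^+ 2 + 1) <= cb * mu;
  adm_cb_x : 80 * Ky <= cb * mu;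
  adm_lam : 96 * lam * M ^+ 2 * (1 + 2 * cb ^+ 2 + 2 * cb ^+ 2 * M ^+ 2
               + 2 * cg ^+ 2 + 4 * cg ^+ 2 * M ^+ 2) <= 8^-1;
  adm_c : 2 + 4 * cb / mu + 8 * cg / mu <= lam * ((c - 1) / 2)
}.

Lemma admissible_exists (M mu Ky Kz : R) : 0 < M -> 0 < mu -> 0 <= Ky -> 0 <= Kz ->
  exists cb cg lam c, admissible M mu Ky Kz cb cg lam c.
Proof.
move=> M0 mu0 Ky0 Kz0.
pose cg := (4 * (2 * M ^+ 2 + 1) + 80 * Kz) / mu.
have M2 : 0 < M ^+ 2 by rewrite exprn_gt0.
have cgE : cg * mu = 4 * (2 * M ^+ 2 + 1) + 80 * Kz by rewrite mulfVK ?gt_eqF.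
have cg0 : 0 < cg by rewrite divr_gt0 //; lra.
pose cb := (4 * (2 * M ^+ 2 + 8 * cg / mu * M ^+ 2 + 1) + 80 * Ky) / mu.
have cbE : cb * mu = 4 * (2 * M ^+ 2 + 8 * cg / mu * M ^+ 2 + 1) + 80 * Ky.
  by rewrite mulfVK ?gt_eqF.
have gm : 0 < 8 * cg / mu * M ^+ 2 by rewrite mulr_gt0 // divr_gt0 // mulr_gt0.
have cb0 : 0 < cb by rewrite divr_gt0 //; lra.
pose T := 1 + 2 * cb ^+ 2 + 2 * cb ^+ 2 * M ^+ 2 + 2 * cg ^+ 2 + 4 * cg ^+ 2 * M ^+ 2.
have T0 : 0 < T.
  have h1 : 0 < cb ^+ 2 by rewrite exprn_gt0.
  have h2 : 0 < cg ^+ 2 by rewrite exprn_gt0.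
  have h3 : 0 < cb ^+ 2 * M ^+ 2 by rewrite mulr_gt0.
  have h4 : 0 < cg ^+ 2 * M ^+ 2 by rewrite mulr_gt0.
  rewrite /T; lra.
pose lam := (8 * 96 * M ^+ 2 * T)^-1.
have lam0 : 0 < lam by rewrite invr_gt0 !mulr_gt0.
pose X := 2 + 4 * cb / mu + 8 * cg / mu.
have X0 : 0 < X by rewrite !addr_gt0 // divr_gt0 // mulr_gt0.
pose c := 1 + 2 * X / lam.
exists cb, cg, lam, c; split => //.
- by rewrite /c ltrDl divr_gt0 // mulr_gt0.
- rewrite cgE; lra.
- rewrite cgE; have := M2; lra.
- rewrite cbE; lra.
- rewrite cbE; lra.
- rewrite -/T /lam.
  have -> : 96 * (8 * 96 * M ^+ 2 * T)^-1 * M ^+ 2 * T = 8^-1 :> R.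
    by field; rewrite !gt_eqF.
  by [].
- rewrite -/X /c; have -> : lam * ((1 + 2 * X / lam - 1) / 2) = X.
    by field; rewrite gt_eqF.
  by [].
Qed.

(** The inequality behind [potential_step] with all norms abstracted: [H], [a] and
    [b] are the optimality gap and the squared tracking errors of [y] and [z],
    primes mark the values after the step, [ex], [ey], [ez] are the squared
    direction errors, [V] the squared length of the [x]-direction, [h] that of the
    hypergradient and [D] the squared displacement.  Every error term is a
    multiple of [al], so that one comparison of coefficients remains ([key]). *)
Lemma lyapunov_scalar (M mu Ky Kz cb cg lam c al q k : R)
  (H H' a a' b b' ex ey ez V h D : R) :
  0 < mu -> admissible M mu Ky Kz cb cg lam c -> 0 < al ->
  0 <= a -> 0 <= b -> 0 <= ex -> 0 <= ey -> 0 <= ez -> 0 <= V -> 0 <= D ->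
  q <= 2 * lam / al -> q * k <= lam / al - lam * ((c - 1) / 2) * al ->
  H' <= H - al / 2 * h - al / 4 * V + al * ex + 2 * al * M ^+ 2 * (a + b) ->
  a' <= (1 - cb * al * mu / 4) * a + 4 * (cb * al) / mu * ey
     + 5 / (cb * al * mu) * (Ky * al ^+ 2 * V) ->
  b' <= (1 - cg * al * mu / 4) * b + 4 * (cg * al) / mu * (2 * ez + 2 * M ^+ 2 * a)
     + 5 / (cg * al * mu) * (Kz * al ^+ 2 * V) ->
  D <= al ^+ 2 * V + (cb * al) ^+ 2 * (2 * ey + 2 * M ^+ 2 * a)
     + (cg * al) ^+ 2 * (2 * ez + 4 * M ^+ 2 * (a + b)) ->
  H' + a' + b' + q * (k * (ex + ey + ez) + 48 * M ^+ 2 * D) + al / 2 * h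
    <= H + a + b + lam / al * (ex + ey + ez).
Proof.
move=> mu0 adm al0 a0 b0 ex0 ey0 ez0 V0 D0 q2 qk hH ha hb hD.
case: adm => cg0 cb0 lam0 c1 k1 k2 k3 k4 k5 k6.
have M2 : 0 <= M ^+ 2 by exact: sqr_ge0.
have moving cc K : 0 < cc -> 80 * K <= cc * mu ->
    5 / (cc * al * mu) * (K * al ^+ 2 * V) <= al * V / 16.
  move=> cc0 hK.
  have -> : 5 / (cc * al * mu) * (K * al ^+ 2 * V) = (80 * K) * (al * V / 16) / (cc * mu).
    by field; rewrite !gt_eqF.
  rewrite ler_pdivrMr ?mulr_gt0 // mulrC ler_wpM2l // divr_ge0 // mulr_ge0 //; exact: ltW.
have ma := moving cb Ky cb0 k4; have mb := moving cg Kz cg0 k2.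
pose W := V + cb ^+ 2 * (2 * ey + 2 * M ^+ 2 * a) + cg ^+ 2 * (2 * ez + 4 * M ^+ 2 * (a + b)).
have {}hD : D <= al ^+ 2 * W by move: hD; rewrite /W; lra.
pose kap := 96 * lam * M ^+ 2.
have M48 : 0 <= 48 * M ^+ 2 by rewrite mulr_ge0.
have lal : 0 <= 2 * lam / al by rewrite divr_ge0 ?mulr_ge0 // ltW.
have kap0 : 0 <= kap by rewrite /kap mulr_ge0 // mulr_ge0 // ltW.
have qD : q * (48 * M ^+ 2 * D) <= al * (kap * W).
  have h1 : q * (48 * M ^+ 2 * D) <= 2 * lam / al * (48 * M ^+ 2 * D).
    by rewrite ler_wpM2r // mulr_ge0.
  have h2 : 2 * lam / al * (48 * M ^+ 2 * D) <= 2 * lam / al * (48 * M ^+ 2 * (al ^+ 2 * W)).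
    by apply: ler_wpM2l => //; apply: ler_wpM2l.
  apply: (le_trans h1); apply: (le_trans h2); rewrite le_eqVlt; apply/orP; left; apply/eqP.
  by rewrite /kap; field; rewrite gt_eqF.
have cb2 : 0 <= cb ^+ 2 by exact: sqr_ge0.
have cg2 : 0 <= cg ^+ 2 by exact: sqr_ge0.
have cbM : 0 <= cb ^+ 2 * M ^+ 2 by exact: mulr_ge0.
have cgM : 0 <= cg ^+ 2 * M ^+ 2 by exact: mulr_ge0.
have kW : kap * W <= 8^-1 * (V + ey + a + ez + b).
  have part t s : 0 <= s -> t <= 1 + 2 * cb ^+ 2 + 2 * cb ^+ 2 * M ^+ 2
       + 2 * cg ^+ 2 + 4 * cg ^+ 2 * M ^+ 2 -> kap * t * s <= 8^-1 * s.
    move=> s0 ht; rewrite ler_wpM2r // (le_trans _ k5) // ler_wpM2l //.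
  have p1 := part 1 V V0; have p2 := part (2 * cb ^+ 2) ey ey0.
  have p3 := part (2 * cb ^+ 2 * M ^+ 2 + 4 * cg ^+ 2 * M ^+ 2) a a0.
  have p4 := part (2 * cg ^+ 2) ez ez0; have p5 := part (4 * cg ^+ 2 * M ^+ 2) b b0.
  have {}p1 := p1 ltac:(move: cb2 cg2 cbM cgM; clear; lra).
  have {}p2 := p2 ltac:(move: cb2 cg2 cbM cgM; clear; lra).
  have {}p3 := p3 ltac:(move: cb2 cg2 cbM cgM; clear; lra).
  have {}p4 := p4 ltac:(move: cb2 cg2 cbM cgM; clear; lra).
  have {}p5 := p5 ltac:(move: cb2 cg2 cbM cgM; clear; lra).
  rewrite /W; lra.
pose S := ex + ey + ez.
have S0 : 0 <= S by rewrite !addr_ge0.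
pose c' := (c - 1) / 2.
have qS : q * (k * S) <= lam / al * S - al * (lam * c' * S).
  have := ler_wpM2r S0 qk; rewrite /c'; lra.
have cS : (2 + 4 * cb / mu + 8 * cg / mu) * S <= lam * c' * S by rewrite ler_wpM2r.
have cbm : 0 <= 4 * cb / mu by rewrite divr_ge0 ?mulr_ge0 // ltW.
have cgm : 0 <= 8 * cg / mu by rewrite divr_ge0 ?mulr_ge0 // ltW.
pose Bm := 4 * cb / mu; pose Gm := 8 * cg / mu.
have a3 : 4 * (2 * M ^+ 2 + Gm * M ^+ 2 + 1) * a <= cb * mu * a by rewrite ler_wpM2r.
have b3 : 4 * (2 * M ^+ 2 + 1) * b <= cg * mu * b by rewrite ler_wpM2r.
have ha' : a' <= a + al * (- (cb * mu * a) / 4 + Bm * ey + V / 16) by rewrite /Bm; lra.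
have hb' : b' <= b + al * (- (cg * mu * b) / 4 + Gm * ez + Gm * M ^+ 2 * a + V / 16).
  rewrite /Gm; lra.
have key : al * (- (V / 4) + ex + 2 * M ^+ 2 * (a + b) + (- (cb * mu * a) / 4 + Bm * ey + V / 16)
   + (- (cg * mu * b) / 4 + Gm * ez + Gm * M ^+ 2 * a + V / 16) + kap * W - lam * c' * S) <= 0.
  rewrite pmulr_rle0 //.
  have BS : Bm * ey <= Bm * S by rewrite ler_wpM2l // /S addrAC lerDr addr_ge0.
  have GS : Gm * ez <= Gm * S by rewrite ler_wpM2l // /S lerDr addr_ge0.
  have eS : ex + ey + ez = S by [].
  move: cS a3 b3 kW BS GS eS ex0 ey0 ez0 a0 b0 V0; rewrite -/Bm -/Gm.
  move: (lam * c' * S) (kap * W) => lS kW'; clear; move=> *; lra.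
rewrite -/S; move: key ha' hb' qD qS hH; clear; move: (lam * c' * S) (kap * W) (Bm * ey) (Gm * ez) (Gm * M ^+ 2 * a) (lam / al * S).
move=> lS kW x1 x2 x3 x4 *; lra.
Qed.

End Scalars.

#[local] Opaque enorm.

(** * One step of the potential *)

Lemma dotv_col0 {R : realType} m n (p : 'cV[R]_n) (w : 'cV[R]_(m + n)) :
  dotv (col_mx 0 p) w = dotv p (dsubmx w).
Proof. by rewrite -{1}(vsubmxK w) dotv_col_mx dotv0l add0r. Qed.

Lemma enorm_subZ {R : realType} n (x v : 'cV[R]_n) (a : R) :
  enorm (x - a *: v - x) ^+ 2 = a ^+ 2 * enorm v ^+ 2.
Proof.
have -> : x - a *: v - x = - (a *: v) by rewrite addrC addKr.
by rewrite enormN enormZ exprMn real_normK // num_real.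
Qed.

Lemma subr_shift (V : zmodType) (a b c e : V) : a - b - e = a - c - b - (e - c).
Proof. by rewrite opprB addrA [a - c - b]addrAC subrK. Qed.

Lemma descent_scalar {R : realType} (al C H' H Hinf V e1 e2 e3 h ab M2 : R) :
  0 <= V -> 0 < al -> al * C <= 4^-1 ->
  H' <= H - al / 2 * h - al / 2 * V + al / 2 * e1 + C * al ^+ 2 * V ->
  e1 <= 2 * e2 + 2 * e3 -> e3 <= 2 * M2 * ab ->
  H' - Hinf <= H - Hinf - al / 2 * h - al / 4 * V + al * e2 + 2 * al * M2 * ab.
Proof.
move=> V0 al0 hal h1 h2 h3.
have k1 : al / 2 * e1 <= al / 2 * (2 * e2 + 2 * (2 * M2 * ab)).
  rewrite ler_wpM2l ?divr_ge0 //; first exact: ltW.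
  by apply: le_trans h2 _; rewrite lerD2l ler_wpM2l.
have k2 : al * (al * C) * V <= al * 4^-1 * V.
  by rewrite ler_wpM2r // ler_wpM2l // ltW.
clear -h1 k1 k2; lra.
Qed.

Section OneStep.
Context {R : realType} {dx dy : nat}.
Variables (L mu r Hinf : R) (f g : 'cV[R]_(dx + dy) -> R).
Hypotheses (L0 : 0 <= L) (mu0 : 0 < mu) (r0 : 0 <= r).
Hypotheses (sf : smooth1 f) (sg : smooth2 g).
Hypotheses (glf : grad_lipschitz L f) (glg : grad_lipschitz L g).
Hypothesis hlg : hess_lipschitz L g.
Hypothesis sc : forall x, strongly_convex mu (fun y => g (col_mx x y)).
Hypothesis fb : forall x, enorm (dsubmx (grad f (col_mx x (ystar g x)))) <= mu * r.
Implicit Types u v : triple R dx dy.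

Let M := L * (1 + r).

Definition solution u := Triple (tx u) (ystar g (tx u)) (zstar f g (tx u)).

Definition gap u := (hyper f g (tx u) - Hinf) + enorm (ty u - ystar g (tx u)) ^+ 2
  + enorm (tz u - zstar f g (tx u)) ^+ 2.

Definition update (al be ga : R) u v :=
  Triple (tx u - al *: tx v) (ty u - be *: ty v)
         (eproj (eball r) (tz u - ga *: tz v)).

Let LM : L <= M.
Proof. by rewrite /M ler_peMr // lerDl. Qed.

Lemma solution_dist_x u : enorm (tx (direction f g u) - hgrad f g (tx u)) ^+ 2 <=
  2 * M ^+ 2 * (enorm (ty u - ystar g (tx u)) ^+ 2 + enorm (tz u - zstar f g (tx u)) ^+ 2).
Proof.
have zr : enorm (tz (solution u)) <= r by apply: (zstar_ball L0 mu0 r0 sg glg hlg sc fb).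
have h := direction_x_diff L0 sg glf glg hlg u zr.
apply: (sqr_sum_bound L0 _ _ _ LM _ (erefl _)); try exact: enorm_ge0.
by apply: le_trans h _; rewrite enorm_col_diffr.
Qed.

Lemma tz_direction_solution u : tz (direction f g (solution u)) = 0.
Proof. by rewrite /= (zstarE f L0 mu0 sg glg hlg sc) subrr. Qed.

Lemma ty_direction_solution u : ty (direction f g (solution u)) = 0.
Proof.
rewrite /=; apply/eqP; rewrite -enorm_eq0 -sqrf_eq0 enorm_sqr.
set w := col_mx _ _; set p := dsubmx _.
have -> : dotv p p = dotv (col_mx 0 p) (grad g w).
  by rewrite dotv_col0.
by rewrite (grad_ystar L0 mu0 sg glg sc).
Qed.

Lemma solution_dist_z u : enorm (tz (direction f g u)) ^+ 2 <=
  2 * M ^+ 2 * (enorm (ty u - ystar g (tx u)) ^+ 2 + enorm (tz u - zstar f g (tx u)) ^+ 2).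
Proof.
have zr : enorm (tz (solution u)) <= r by apply: (zstar_ball L0 mu0 r0 sg glg hlg sc fb).
have := direction_z_diff L0 sg glf glg hlg u zr.
rewrite tz_direction_solution subr0 => h.
apply: (sqr_sum_bound L0 _ _ _ LM _ (erefl _)); try exact: enorm_ge0.
by apply: le_trans h _; rewrite enorm_col_diffr.
Qed.

Lemma solution_dist_y u : enorm (ty (direction f g u)) <= L * enorm (ty u - ystar g (tx u)).
Proof.
have := direction_y_diff f glg u (solution u).
by rewrite ty_direction_solution subr0 => /le_trans; apply; rewrite enorm_col_diffr.
Qed.

Lemma ty_direction_mono u :
  mu * enorm (ty u - ystar g (tx u)) ^+ 2 <=
  dotv (ty u - ystar g (tx u)) (ty (direction f g u)).
Proof.
have := strong_mono L0 sg glg sc (tx u) (ystar g (tx u)) (ty u - ystar g (tx u)).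
have -> : ystar g (tx u) + (ty u - ystar g (tx u)) = ty u by rewrite addrC subrK.
rewrite dotvDr dotvNr (grad_ystar L0 mu0 sg glg sc) subr0 => /le_trans; apply.
set w := col_mx (tx u) (ty u).
have -> : ty (direction f g u) = dsubmx (grad g w) by [].
by rewrite dotv_col0 lexx.
Qed.

Lemma sqr_le2 (a b : R) : 0 <= a -> a <= b -> a ^+ 2 <= b ^+ 2.
Proof. by move=> a0 ab; rewrite ler_pXn2r ?nnegrE // (le_trans a0). Qed.

Lemma ystar_move (x : 'cV[R]_dx) (al : R) (v : 'cV[R]_dx) :
  enorm (ystar g (x - al *: v) - ystar g x) ^+ 2 <= (L / mu) ^+ 2 * al ^+ 2 * enorm v ^+ 2.
Proof.
have h := sqr_le2 (enorm_ge0 _) (ystar_lip L0 mu0 sg glg sc x (x - al *: v)).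
by apply: le_trans h _; rewrite exprMn enorm_subZ mulrA.
Qed.

Lemma zstar_move (x : 'cV[R]_dx) (al : R) (v : 'cV[R]_dx) :
  enorm (zstar f g (x - al *: v) - zstar f g x) ^+ 2
    <= (zlip L mu r) ^+ 2 * al ^+ 2 * enorm v ^+ 2.
Proof.
have h := sqr_le2 (enorm_ge0 _) (zstar_lip L0 mu0 r0 sg glf glg hlg sc fb x (x - al *: v)).
by apply: le_trans h _; rewrite exprMn enorm_subZ mulrA.
Qed.

Lemma update_y_tracks (al be ga : R) u v : 0 < be -> be * mu <= 1 -> be * L ^+ 2 <= mu ->
  enorm (ty (update al be ga u v) - ystar g (tx (update al be ga u v))) ^+ 2 <=
  (1 - be * mu / 4) * enorm (ty u - ystar g (tx u)) ^+ 2
  + 4 * be / mu * enorm (ty v - ty (direction f g u)) ^+ 2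
  + 5 / (be * mu) * ((L / mu) ^+ 2 * al ^+ 2 * enorm (tx v) ^+ 2).
Proof.
move=> be0 bm bL; set u' := update al be ga u v.
have h := @tracking_step _ _ (ty u - ystar g (tx u)) (ty (direction f g u))
  (ty v - ty (direction f g u)) (ystar g (tx u') - ystar g (tx u)) mu L be
  mu0 be0 bm bL L0 (ty_direction_mono u) (solution_dist_y u).
have -> : ty u' - ystar g (tx u') = ty u - ystar g (tx u) -
   be *: (ty (direction f g u) + (ty v - ty (direction f g u)))
   - (ystar g (tx u') - ystar g (tx u)).
  rewrite [ty (direction f g u) + _]addrC subrK.
  have -> : ty u' = ty u - be *: ty v by [].
  exact: subr_shift.
apply: le_trans h _; rewrite lerD2l; apply: ler_wpM2l.
  by rewrite divr_ge0 // mulr_ge0 // ltW.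
exact: ystar_move.
Qed.

(** The [z]-direction is affine in [z]: its linear part is the coercive block of
    the Hessian at [(x, y)], and its value at [zstar x] is an additional error
    controlled by the [y]-error. *)
Lemma update_z_tracks (al be ga : R) u v : 0 < ga -> ga * mu <= 1 -> ga * L ^+ 2 <= mu ->
  enorm (tz (update al be ga u v) - zstar f g (tx (update al be ga u v))) ^+ 2 <=
  (1 - ga * mu / 4) * enorm (tz u - zstar f g (tx u)) ^+ 2
  + 4 * ga / mu * (2 * enorm (tz v - tz (direction f g u)) ^+ 2
       + 2 * M ^+ 2 * enorm (ty u - ystar g (tx u)) ^+ 2)
  + 5 / (ga * mu) * ((zlip L mu r) ^+ 2 * al ^+ 2 * enorm (tx v) ^+ 2).
Proof.
move=> ga0 bm bL; set u' := update al be ga u v.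
pose B := drsubmx (hess g (col_mx (tx u) (ty u))).
pose d := tz u - zstar f g (tx u).
pose ur := Triple (tx u) (ty u) (zstar f g (tx u)).
pose e := (tz v - tz (direction f g u)) + tz (direction f g ur).
have De : tz (direction f g u) = B *m d + tz (direction f g ur).
  rewrite /= -/B mulmxBr addrA subrK //.
have m1 : mu * enorm d ^+ 2 <= dotv d (B *m d).
  exact: (drsub_lower L0 sg glg hlg sc).
have m2 : enorm (B *m d) <= L * enorm d.
  rewrite /B drsubmx_mul (le_trans (enorm_dsubmx _)) //.
  by have := hess_bound L0 sg glg hlg (col_mx (tx u) (ty u)) (col_mx 0 d) L0; rewrite enorm_col0.
have h := @tracking_step _ _ d (B *m d) e (zstar f g (tx u') - zstar f g (tx u)) mu L ga
  mu0 ga0 bm bL L0 m1 m2.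
have zb : eball r (zstar f g (tx u')) by exact: (zstar_ball L0 mu0 r0 sg glg hlg sc fb).
have cl := sqr_le2 (enorm_ge0 _) (eproj_close (tz u - ga *: tz v) r0 zb).
apply: (le_trans cl).
have -> : tz u - ga *: tz v - zstar f g (tx u') = d -
   ga *: (B *m d + e) - (zstar f g (tx u') - zstar f g (tx u)).
  have -> : B *m d + e = tz v by rewrite /e addrCA -De subrK.
  exact: subr_shift.
apply: le_trans h _; apply: lerD; last first.
  apply: ler_wpM2l (zstar_move _ _ _).
  by rewrite divr_ge0 // mulr_ge0 // ltW.
rewrite lerD2l; apply: ler_wpM2l.
  by rewrite divr_ge0 ?mulr_ge0 // ltW.
apply: le_trans (enormD_sqr_le _ _) _; rewrite lerD2l -mulrA ler_wpM2l //.
have zr : enorm (tz (solution u)) <= r by apply: (zstar_ball L0 mu0 r0 sg glg hlg sc fb).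
have := direction_z_diff L0 sg glf glg hlg ur zr.
rewrite tz_direction_solution subr0 enorm_col_diffr subrr enorm0 mulr0 addr0 => k.
by rewrite -exprMn; apply: sqr_le2 => //; exact: enorm_ge0.
Qed.

(** The displacement is small once the directions are accurate and the tracking
    errors are small, since the exact [y]- and [z]-directions vanish at the
    solution. *)
Lemma update_dist (al be ga : R) u v : enorm (tz u) <= r -> 0 <= ga ->
  tdist2 (update al be ga u v) u <= al ^+ 2 * enorm (tx v) ^+ 2
   + be ^+ 2 * (2 * enorm (ty v - ty (direction f g u)) ^+ 2
       + 2 * M ^+ 2 * enorm (ty u - ystar g (tx u)) ^+ 2)
   + ga ^+ 2 * (2 * enorm (tz v - tz (direction f g u)) ^+ 2
       + 4 * M ^+ 2 * (enorm (ty u - ystar g (tx u)) ^+ 2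
           + enorm (tz u - zstar f g (tx u)) ^+ 2)).
Proof.
move=> zr ga0; have split n (a b : 'cV[R]_n) : enorm a ^+ 2 <= 2 * enorm (a - b) ^+ 2 + 2 * enorm b ^+ 2.
  by rewrite -{1}(subrK b a) enormD_sqr_le.
rewrite /tdist2; apply: lerD; first apply: lerD.
- by rewrite [tx (update _ _ _ _ _)]/= enorm_subZ.
- rewrite [ty (update _ _ _ _ _)]/= enorm_subZ.
  rewrite ler_wpM2l ?sqr_ge0 // (le_trans (split _ _ (ty (direction f g u)))) //.
  rewrite lerD2l -mulrA ler_wpM2l // (le_trans (sqr_le2 (enorm_ge0 _) (solution_dist_y u))) //.
  by rewrite exprMn ler_wpM2r ?sqr_ge0 // sqr_le2.
- have cl := sqr_le2 (enorm_ge0 _) (eproj_close (tz u - ga *: tz v) r0 zr).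
  apply: (le_trans cl); rewrite enorm_subZ.
  rewrite ler_wpM2l ?sqr_ge0 // (le_trans (split _ _ (tz (direction f g u)))) //.
  rewrite lerD2l; apply: le_trans (ler_wpM2l (ler0n _ 2) (solution_dist_z u)) _.
  by rewrite !mulrA -natrM lexx.
Qed.

(** The potential [gap + (lam / alpha) * (squared direction error)] decreases
    along an update: on the left, [q] and [k] are the next weight and the damping
    of the old direction error, and the displacement term is what the momentum
    correction pays for comparing two points. *)
Lemma potential_step (cb cg lam c al q k : R) u v :
  admissible M mu ((L / mu) ^+ 2) ((zlip L mu r) ^+ 2) cb cg lam c ->
  0 < al -> al * hconst L mu r <= 4^-1 ->
  cb * al * mu <= 1 -> cb * al * L ^+ 2 <= mu ->
  cg * al * mu <= 1 -> cg * al * L ^+ 2 <= mu ->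
  q <= 2 * lam / al -> q * k <= lam / al - lam * ((c - 1) / 2) * al ->
  enorm (tz u) <= r ->
  gap (update al (cb * al) (cg * al) u v)
    + q * (k * tdist2 v (direction f g u)
           + 48 * M ^+ 2 * tdist2 (update al (cb * al) (cg * al) u v) u)
    + al / 2 * enorm (hgrad f g (tx u)) ^+ 2
  <= gap u + lam / al * tdist2 v (direction f g u).
Proof.
move=> adm al0 hal b1 b2 g1 g2 q2 qk zr.
set D := direction f g u; set u' := update al (cb * al) (cg * al) u v.
have cb0 := adm_cb_gt0 adm; have cg0 := adm_cg_gt0 adm.
have cba : 0 < cb * al by rewrite mulr_gt0.
have cga : 0 < cg * al by rewrite mulr_gt0.
apply: (lyapunov_scalar mu0 adm al0 _ _ _ _ _ _ _ q2 qk _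
  (update_y_tracks al (cg * al) u v cba b1 b2)
  (update_z_tracks al (cb * al) u v cga g1 g2)
  (update_dist al (cb * al) v zr (ltW cga))); rewrite ?sqr_ge0 ?tdist2_ge0 //.
have h1 := hyper_descent L0 mu0 r0 sf sg glf glg hlg sc fb (tx u) (tx v) al.
have h2 : enorm (tx v - hgrad f g (tx u)) ^+ 2 <=
    2 * enorm (tx v - tx D) ^+ 2 + 2 * enorm (tx D - hgrad f g (tx u)) ^+ 2.
  by have := enormD_sqr_le (tx v - tx D) (tx D - hgrad f g (tx u)); rewrite addrA subrK.
have h3 := solution_dist_x u.
rewrite -/D in h3.
have V0 := sqr_ge0 (enorm (tx v)).
exact: (descent_scalar Hinf V0 al0 hal h1 h2 h3).
Qed.

End OneStep.

(** * Step sizes and logarithmic sums *)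

Section StepSizes.
Context {R : realType}.

Definition cbrt (x : R) := x `^ (3^-1).

Lemma cbrt_cube x : 0 <= x -> cbrt x ^+ 3 = x.
Proof.
move=> x0; rewrite /cbrt -powR_mulrn ?powR_ge0 // -powRrM.
by rewrite mulVf // powRr1.
Qed.

Lemma cbrt_ge0 x : 0 <= cbrt x. Proof. exact: powR_ge0. Qed.

Lemma cbrt_ge (e x : R) : 0 <= e -> e ^+ 3 <= x -> e <= cbrt x.
Proof.
move=> e0 ex; have x0 : 0 <= x by apply: le_trans ex; rewrite exprn_ge0.
by rewrite -(@ler_pXn2r _ 3) ?nnegrE ?cbrt_ge0 // cbrt_cube.
Qed.

Lemma cbrt_le (e x : R) : 0 <= e -> 0 <= x -> x <= e ^+ 3 -> cbrt x <= e.
Proof.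
by move=> e0 x0 ex; rewrite -(@ler_pXn2r _ 3) ?nnegrE ?cbrt_ge0 // cbrt_cube.
Qed.

(** With [rho = c alpha^2] and [1 / alpha] the cube root of an arithmetic
    progression, [1 / alpha] grows by at most [alpha] per step; this is what
    lets the damping [rho / alpha = c alpha] beat the growth of the weight. *)
Lemma step_weights (lam c a b : R) : 1 <= a -> 1 <= b -> b ^+ 3 = a ^+ 3 + 1 ->
  0 < lam -> 1 < c -> c * (b^-1) ^+ 2 <= 1 ->
  lam / b^-1 <= 2 * lam / a^-1 /\
  lam / b^-1 * (1 - c * (b^-1) ^+ 2) ^+ 2 <= lam / a^-1 - lam * ((c - 1) / 2) * a^-1.
Proof.
move=> a1 b1 ab lam0 c1 cb1; rewrite !invrK.
have a0 : 0 < a by rewrite (lt_le_trans ltr01).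
have b0 : 0 < b by rewrite (lt_le_trans ltr01).
have b2a : b <= 2 * a.
  rewrite -(@ler_pXn2r _ 3) ?nnegrE ?mulr_ge0 // ?ltW // ab exprMn.
  have : 1 <= a ^+ 3 by rewrite exprn_ege1.
  have -> : (2 : R) ^+ 3 = 8 by rewrite -natrX.
  by lra.
have q0 : 0 < b ^+ 2 + a * b + a ^+ 2.
  by rewrite !addr_gt0 ?exprn_gt0 ?mulr_gt0.
have bab : (b - a) * (b ^+ 2 + a * b + a ^+ 2) = 1.
  have -> : (b - a) * (b ^+ 2 + a * b + a ^+ 2) = b ^+ 3 - a ^+ 3 by ring.
  by rewrite ab addrAC subrr add0r.
have bma : b - a <= b^-1.
  have -> : b - a = (b ^+ 2 + a * b + a ^+ 2)^-1.
    by apply: (mulIf (lt0r_neq0 q0)); rewrite bab mulVf // lt0r_neq0.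
  rewrite lef_pV2 ?posrE //.
  have : b <= b ^+ 2 by rewrite expr2 ler_peMr // ltW.
  have : 0 <= a * b + a ^+ 2 by rewrite addr_ge0 // ?mulr_ge0 ?sqr_ge0 // ltW.
  lra.
split; first by rewrite [2 * lam]mulrC -mulrA ler_pM2l.
set rho := c * (b^-1) ^+ 2 in cb1 *.
have rho0 : 0 <= rho by rewrite mulr_ge0 ?sqr_ge0 // (le_trans ler01) // ltW.
apply: (@le_trans _ _ (lam * b * (1 - rho))).
  have r1 : (1 - rho) ^+ 2 <= 1 - rho.
    by rewrite expr2 ler_piMr ?subr_ge0 // lerBlDr lerDl.
  by apply: ler_wpM2l => //; rewrite mulr_ge0 // ltW.
have -> : lam * b * (1 - rho) = lam * (b - c * b^-1).
  by rewrite /rho; field; rewrite lt0r_neq0.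
rewrite -mulrA -mulrBr ler_pM2l //.
have ia : (2 * a)^-1 <= b^-1 by rewrite lef_pV2 ?posrE // mulr_gt0.
have -> : (c - 1) / 2 * a^-1 = (c - 1) * (2 * a)^-1 by rewrite invfM; ring.
have := ler_wpM2l (_ : 0 <= c - 1) ia; rewrite subr_ge0 => /(_ (ltW c1)).
lra.
Qed.

(** By induction from [ln (1 + x) <= x] at [x = - 1 / (n + 2)]. *)
Lemma harmonic_le_ln n : \sum_(0 <= k < n.+1) (k.+1%:R^-1 : R) <= 1 + ln n.+1%:R.
Proof.
elim: n => [|n IH]; first by rewrite big_nat1 invr1 ln1 addr0.
rewrite big_nat_recr //=; apply: le_trans (lerD IH (lexx _)) _.
rewrite -addrA lerD2l.
have n1 : 0 < n.+1%:R :> R by rewrite ltr0n.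
have n2 : 0 < n.+2%:R :> R by rewrite ltr0n.
have E : n.+1%:R / n.+2%:R = 1 + - n.+2%:R^-1 :> R.
  by rewrite -[in LHS](addrK 1 n.+1%:R) natr1 mulrBl mulfV ?gt_eqF // mul1r.
have h : ln (n.+1%:R / n.+2%:R) <= - n.+2%:R^-1 :> R.
  rewrite E; apply: le_ln1Dx; rewrite ltrN2 invf_lt1 // ltr1n //.
by rewrite -lerBrDl -lerN2 opprB -ln_div ?posrE.
Qed.

(** From [K = 3] on, [ln (K - 1) >= ln 2], so that constants and [ln K] are
    absorbed by a multiple of [ln (K - 1)]. *)
Lemma log_absorb (X Y : R) (K : nat) : (3 <= K)%N -> 0 <= X -> 0 <= Y ->
  X + Y * (1 + ln K%:R) <= (X / ln 2 + Y * ((ln 2)^-1 + 2)) * ln (K.-1)%:R.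
Proof.
case: K => // [[//|K]] K3 X0 Y0 /=.
have l2 : 0 < ln 2 :> R by rewrite ln_gt0 // ltr1n.
have K0 : 0 < K.+1%:R :> R by rewrite ltr0n.
have h1 : ln 2 <= ln K.+1%:R :> R by rewrite ler_ln ?posrE // ler_nat.
have h2 : ln K.+2%:R <= 2 * ln K.+1%:R :> R.
  apply: (@le_trans _ _ (ln (2 * K.+1%:R))).
    by rewrite ler_ln ?posrE ?mulr_gt0 // -natrM ler_nat; lia.
  by rewrite lnM ?posrE // [2 * _]mulrDl mul1r lerD2r.
have h3 : 1 <= (ln 2)^-1 * ln K.+1%:R :> R by rewrite ler_pdivlMl // mulr1.
rewrite mulrDl; apply: lerD.
  by rewrite -mulrA -[leLHS]mulr1 ler_wpM2l.
rewrite -mulrA ler_wpM2l // mulrDl; apply: lerD => //.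
Qed.

(** Because [eta + K <= (1 + eta)^3 K]. *)
Lemma rate_bound (eta : R) (K : nat) : 0 <= eta -> (0 < K)%N ->
  K%:R^-1 * cbrt (eta + K%:R) <= (1 + eta) / K%:R `^ (2 / 3).
Proof.
move=> eta0 K0; have K1 : 1 <= K%:R :> R by rewrite ler1n.
pose t := cbrt K%:R; have t3 : t ^+ 3 = K%:R by rewrite cbrt_cube.
have t1 : 1 <= t by apply: cbrt_ge => //; rewrite expr1n.
have t0 : 0 < t by rewrite (lt_le_trans ltr01).
have -> : K%:R `^ (2 / 3) = t ^+ 2 :> R.
  by rewrite /t /cbrt -powR_mulrn ?powR_ge0 // -powRrM mulrC.
have h : cbrt (eta + K%:R) <= (1 + eta) * t.
  have e1 : 1 <= 1 + eta by rewrite lerDl.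
  apply: cbrt_le; rewrite ?addr_ge0 ?mulr_ge0 ?addr_ge0 // ?(ltW t0) //.
  rewrite exprMn t3; apply: (@le_trans _ _ ((1 + eta) * K%:R)).
    by rewrite mulrDl mul1r addrC lerD2l ler_peMr.
  by rewrite ler_wpM2r // ler_eXnr.
apply: le_trans (ler_wpM2l _ h) _; first by rewrite invr_ge0.
rewrite -t3 le_eqVlt; apply/orP; left; apply/eqP; field.
by rewrite lt0r_neq0.
Qed.

End StepSizes.

(** * Joint measurability *)

Section MatrixMeasurability.
Context {R : realType}.

Definition mmx d (S : measurableType d) m n (U : S -> 'M[R]_(m, n)) :=
  forall i j, measurable_fun setT (fun s => U s i j).

Section Closure.
Context d (S : measurableType d).

Lemma mmx_cst m n (A : 'M[R]_(m, n)) : mmx (fun _ : S => A).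
Proof. by move=> i j; exact: measurable_cst. Qed.

Lemma mmx_comp d' (S' : measurableType d') (phi : S' -> S) m n (U : S -> 'M[R]_(m, n)) :
  measurable_fun setT phi -> mmx U -> mmx (fun s => U (phi s)).
Proof. by move=> mphi mU i j; exact: (measurableT_comp (mU i j) mphi). Qed.

Lemma mmxD m n (U V : S -> 'M[R]_(m, n)) : mmx U -> mmx V -> mmx (fun s => U s + V s).
Proof.
move=> mU mV i j; under eq_fun do rewrite mxE.
exact: (measurable_funD (mU i j) (mV i j)).
Qed.

Lemma mmxZ m n (a : R) (U : S -> 'M[R]_(m, n)) : mmx U -> mmx (fun s => a *: U s).
Proof.
move=> mU i j; under eq_fun do rewrite mxE.
exact: (measurable_funM (@measurable_cst _ _ _ _ setT a) (mU i j)).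
Qed.

Lemma mmxB m n (U V : S -> 'M[R]_(m, n)) : mmx U -> mmx V -> mmx (fun s => U s - V s).
Proof.
move=> mU mV; apply: mmxD => // i j; under eq_fun do rewrite mxE.
exact: (measurable_funN (mV i j)).
Qed.

Lemma mmxM m n p (U : S -> 'M[R]_(m, n)) (V : S -> 'M[R]_(n, p)) :
  mmx U -> mmx V -> mmx (fun s => U s *m V s).
Proof.
move=> mU mV i j; under eq_fun do rewrite mxE.
apply: measurable_sum => k; exact: (measurable_funM (mU i k) (mV k j)).
Qed.

Lemma mmx_tr m n (U : S -> 'M[R]_(m, n)) : mmx U -> mmx (fun s => (U s)^T).
Proof. by move=> mU i j; under eq_fun do rewrite mxE; exact: mU. Qed.

Lemma mmx_col m1 m2 n (U : S -> 'M[R]_(m1, n)) (V : S -> 'M[R]_(m2, n)) :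
  mmx U -> mmx V -> mmx (fun s => col_mx (U s) (V s)).
Proof.
move=> mU mV i j; case: (split_ordP i) => k ->.
  by under eq_fun do rewrite col_mxEu; exact: mU.
by under eq_fun do rewrite col_mxEd; exact: mV.
Qed.

Lemma mmx_usubmx m1 m2 n (U : S -> 'M[R]_(m1 + m2, n)) : mmx U -> mmx (fun s => usubmx (U s)).
Proof. by move=> mU i j; under eq_fun do rewrite mxE; exact: mU. Qed.

Lemma mmx_dsubmx m1 m2 n (U : S -> 'M[R]_(m1 + m2, n)) : mmx U -> mmx (fun s => dsubmx (U s)).
Proof. by move=> mU i j; under eq_fun do rewrite mxE; exact: mU. Qed.

Lemma mmx_ursubmx m1 m2 n1 n2 (U : S -> 'M[R]_(m1 + m2, n1 + n2)) :
  mmx U -> mmx (fun s => ursubmx (U s)).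
Proof. by move=> mU i j; under eq_fun do rewrite 2!mxE; exact: mU. Qed.

Lemma mmx_drsubmx m1 m2 n1 n2 (U : S -> 'M[R]_(m1 + m2, n1 + n2)) :
  mmx U -> mmx (fun s => drsubmx (U s)).
Proof. by move=> mU i j; under eq_fun do rewrite 2!mxE; exact: mU. Qed.

Lemma measurable_dotv n (U V : S -> 'cV[R]_n) : mmx U -> mmx V ->
  measurable_fun setT (fun s => dotv (U s) (V s)).
Proof. by move=> mU mV; exact: (mmxM (mmx_tr mU) mV 0 0). Qed.

Lemma measurable_enorm2 n (U : S -> 'cV[R]_n) : mmx U ->
  measurable_fun setT (fun s => enorm (U s) ^+ 2).
Proof. by move=> mU; under eq_fun do rewrite enorm_sqr; exact: measurable_dotv. Qed.

End Closure.

Definition loc_lip n (h : 'cV[R]_n -> R) :=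
  forall w, exists C : R, forall w', enorm (w' - w) <= 1 ->
    `|h w' - h w| <= C * enorm (w' - w).

Definition quant (m : nat) n (w : 'cV[R]_n) : 'cV[R]_n :=
  \col_i ((Num.floor (m.+1%:R * w i 0))%:~R / m.+1%:R).

Lemma quant_close m n (w : 'cV[R]_n) : enorm (quant m w - w) <= n%:R / m.+1%:R.
Proof.
apply: le_trans (enorm_le_sum _) _.
have -> : n%:R / m.+1%:R = \sum_(i < n) m.+1%:R^-1 :> R.
  by rewrite sumr_const card_ord -[RHS]mulr_natl.
apply: ler_sum => i _; rewrite !mxE.
have m0 : 0 < m.+1%:R :> R by rewrite ltr0n.
have /andP[h1 h2] := Num.Theory.floor_itv (m.+1%:R * w i 0).
move: h1 h2; rewrite intrD; move: (Num.floor _) => z h1 h2.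
have -> : z%:~R / m.+1%:R - w i 0 = (z%:~R - m.+1%:R * w i 0) / m.+1%:R :> R.
  by field; rewrite gt_eqF.
rewrite normrM [X in _ * X]gtr0_norm ?invr_gt0 // -[leRHS]mul1r ler_pM2r ?invr_gt0 //.
rewrite ler_norml; apply/andP; split; lra.
Qed.

(** Joint measurability of a function that is measurable in one argument and
    locally Lipschitz in the other: round the second argument to a grid, so
    that only countably many sections occur, and refine the grid. *)
Lemma measurable_caratheodory d d' (S : measurableType d) (T : measurableType d') n
    (h : T -> 'cV[R]_n -> R) (a : S -> T) (U : S -> 'cV[R]_n) :
  (forall w, measurable_fun setT (fun t => h t w)) -> (forall t, loc_lip (h t)) ->
  measurable_fun setT a -> mmx U -> measurable_fun setT (fun s => h (a s) (U s)).
Proof.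
move=> mh lh ma mU.
apply: (@measurable_fun_cvg _ _ _ _
  (fun m s => h (a s) (quant m (U s)))); last first.
  move=> s _; apply/cvgrPdist_le => e e0.
  have [C hC] := lh (a s) (U s).
  have C1 : 0 < `|C| + 1 by rewrite ltr_wpDl.
  pose e1 := Num.min 1 (e / (`|C| + 1)).
  have e10 : 0 < e1 by rewrite lt_min ltr01 divr_gt0.
  have n0 : 0 < n%:R + 1 :> R by rewrite ltr_wpDl.
  have [N hN] := inv_natS_small (divr_gt0 e10 n0).
  exists N => // m /= Nm.
  have close : enorm (quant m (U s) - U s) <= e1.
    apply: le_trans (quant_close _ _) _.
    have := hN m Nm; rewrite ler_pdivlMr // => h1.
    apply: le_trans h1; rewrite mulrC ler_wpM2l ?invr_ge0 //.
    by rewrite lerDl.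
  rewrite distrC; apply: le_trans (hC _ _) _.
    by apply: le_trans close _; rewrite ge_min lexx.
  apply: le_trans (ler_wpM2r (enorm_ge0 _) (ler_norm C)) _.
  have : enorm (quant m (U s) - U s) <= e / (`|C| + 1).
    by apply: le_trans close _; rewrite ge_min lexx orbT.
  rewrite ler_pdivlMr // => h2; apply: le_trans h2.
  by rewrite mulrC ler_wpM2l ?enorm_ge0 // lerDl.
move=> m _ Y mY; rewrite setTI.
pose pt (z : {ffun 'I_n -> int}) : 'cV[R]_n := \col_i ((z i)%:~R / m.+1%:R).
pose cell (z : {ffun 'I_n -> int}) : set S :=
  \bigcap_(i in [set: 'I_n]) ((fun s => m.+1%:R * U s i 0) @^-1` `[(z i)%:~R, (z i + 1)%:~R[%classic).
have -> : (fun s => h (a s) (quant m (U s))) @^-1` Y =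
    \bigcup_(z in [set: {ffun 'I_n -> int}]) (cell z `&` (fun s => h (a s) (pt z)) @^-1` Y).
  apply/seteqP; split => s /=.
    move=> hY; exists [ffun i => Num.floor (m.+1%:R * U s i 0)] => //; split.
      by move=> i _ /=; rewrite ffunE in_itv /=; exact: Num.Theory.floor_itv.
    have -> // : pt [ffun i => Num.floor (m.+1%:R * U s i 0)] = quant m (U s).
    by apply/colP => i; rewrite !mxE ffunE.
  move=> [z _ [cz hz]]; have -> // : quant m (U s) = pt z.
  apply/colP => i; rewrite !mxE; congr (_%:~R / _).
  by apply: Num.Theory.floor_def; have := cz i I; rewrite /= in_itv.
apply: countable_bigcupT_measurable => [|z]; first exact: countableP.
apply: measurableI.
  apply: fin_bigcap_measurable => [|i _]; first exact: finite_finset.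
  rewrite -[X in measurable X]setTI.
  have mf : measurable_fun setT (fun s => m.+1%:R * U s i 0).
    by apply: measurable_funM; [exact: measurable_cst|exact: mU].
  by apply: mf => //; exact: measurable_itv.
rewrite -[X in measurable X]setTI.
by apply: (measurableT_comp (mh (pt z)) ma).
Qed.

Lemma measurable_loc_lip d (S : measurableType d) n (h : 'cV[R]_n -> R) (U : S -> 'cV[R]_n) :
  loc_lip h -> mmx U -> measurable_fun setT (fun s => h (U s)).
Proof.
move=> lh mU; apply: (@measurable_caratheodory _ _ _ _ _ (fun _ : S => h) id) => //.
Qed.

Lemma loc_lip_le n (h : 'cV[R]_n -> R) C :
  (forall w w', `|h w' - h w| <= C * enorm (w' - w)) -> loc_lip h.
Proof. by move=> hC w; exists C => w' _. Qed.

Lemma mmx_lipschitz d (S : measurableType d) n p (h : 'cV[R]_n -> 'cV[R]_p) C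
    (U : S -> 'cV[R]_n) :
  (forall w w', enorm (h w' - h w) <= C * enorm (w' - w)) -> mmx U ->
  mmx (fun s => h (U s)).
Proof.
move=> hC mU i j; rewrite ord1.
apply: (@measurable_loc_lip _ _ _ (fun w => h w i 0)) => //.
apply: (@loc_lip_le _ _ C) => w w'; apply: le_trans (hC w w').
by have := enorm_coord (h w' - h w) i; rewrite !mxE.
Qed.

End MatrixMeasurability.

(** * Means, laws and independence *)

Section Integrals.
Context {R : realType}.

(** Monotonicity for nonnegative functions that may fail to be measurable,
    read off the definition of the integral as a supremum. *)
Lemma ge0_le_integral_any d (T : measurableType d) (P : {measure set T -> \bar R})
    (f h : T -> \bar R) :
  (forall t, 0 <= f t)%E -> (forall t, f t <= h t)%E ->
  (\int[P]_t f t <= \int[P]_t h t)%E.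
Proof.
move=> f0 fh; have h0 t : (0 <= h t)%E by exact: le_trans (f0 t) (fh t).
rewrite !ge0_integralE //; apply: le_ereal_sup => _ [k /= hk <-]; exists k => //= t.
by apply: le_trans (hk t) _; rewrite !patch_setT.
Qed.

Section HasMean.
Context d (T : measurableType d) (Q : probability T R).

Lemma has_meanP (X : T -> R) m : has_mean Q X m <->
  (Q.-integrable setT (EFin \o X) /\ (\int[Q]_t (X t)%:E)%E = m%:E).
Proof. by rewrite /has_mean expectation.unlock. Qed.

Lemma has_mean_measurable (X : T -> R) m : has_mean Q X m -> measurable_fun setT X.
Proof. by move=> [/measurable_int /measurable_EFinP]. Qed.

Lemma has_mean_cst (a : R) : has_mean Q (fun=> a) a.
Proof.
split; first exact: finite_measure_integrable_cst.
exact: expectation_cst.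
Qed.

Lemma has_meanD (X Y : T -> R) m p : has_mean Q X m -> has_mean Q Y p ->
  has_mean Q (fun t => X t + Y t) (m + p).
Proof.
move=> /has_meanP[iX eX] /has_meanP[iY eY]; apply/has_meanP; split.
  have -> : EFin \o (fun t => X t + Y t) = ((EFin \o X) \+ (EFin \o Y))%E by [].
  exact: integrableD.
under eq_integral do rewrite EFinD.
by rewrite (integralD _ iX iY) // eX eY.
Qed.

Lemma has_meanZ (a : R) (X : T -> R) m : has_mean Q X m ->
  has_mean Q (fun t => a * X t) (a * m).
Proof.
move=> /has_meanP[iX eX]; apply/has_meanP; split.
  exact: (integrableZl measurableT a iX).
under eq_integral do rewrite EFinM.
by rewrite (integralZl _ iX) // eX.
Qed.

Lemma has_mean_sum n (X : 'I_n -> T -> R) (m : 'I_n -> R) :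
  (forall i, has_mean Q (X i) (m i)) ->
  has_mean Q (fun t => \sum_i X i t) (\sum_i m i).
Proof.
elim: n X m => [|n IH] X m h.
  rewrite big_ord0; have -> : (fun t => \sum_i X i t) = (fun=> 0) :> (T -> R).
    by apply/funext => t; rewrite big_ord0.
  exact: has_mean_cst.
rewrite big_ord_recl.
have -> : (fun t => \sum_i X i t) =
    (fun t => X ord0 t + \sum_(i < n) X (lift ord0 i) t) :> (T -> R).
  by apply/funext => t; rewrite big_ord_recl.
by apply: has_meanD => //; apply: IH.
Qed.

Lemma has_mean_mx_mmx m n (X : T -> 'M[R]_(m, n)) A : has_mean_mx Q X A -> mmx X.
Proof. by move=> h i j; exact: has_mean_measurable (h i j). Qed.

Lemma has_mean_mx_cst m n (A : 'M[R]_(m, n)) : has_mean_mx Q (fun=> A) A.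
Proof. by move=> i j; exact: has_mean_cst. Qed.

Lemma has_mean_mxD m n (X Y : T -> 'M[R]_(m, n)) A B : has_mean_mx Q X A ->
  has_mean_mx Q Y B -> has_mean_mx Q (fun t => X t + Y t) (A + B).
Proof.
move=> hX hY i j; rewrite mxE; under eq_fun do rewrite mxE.
exact: has_meanD.
Qed.

Lemma has_mean_mxZ m n a (X : T -> 'M[R]_(m, n)) A : has_mean_mx Q X A ->
  has_mean_mx Q (fun t => a *: X t) (a *: A).
Proof.
move=> hX i j; rewrite mxE; under eq_fun do rewrite mxE.
exact: has_meanZ.
Qed.

Lemma has_mean_mxB m n (X Y : T -> 'M[R]_(m, n)) A B : has_mean_mx Q X A ->
  has_mean_mx Q Y B -> has_mean_mx Q (fun t => X t - Y t) (A - B).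
Proof.
move=> hX hY; rewrite -[- B]scaleN1r.
under eq_fun do rewrite -[- Y _]scaleN1r.
exact: has_mean_mxD (has_mean_mxZ _ hY).
Qed.

Lemma has_mean_mxMr m n p (X : T -> 'M[R]_(m, n)) A (B : 'M[R]_(n, p)) :
  has_mean_mx Q X A -> has_mean_mx Q (fun t => X t *m B) (A *m B).
Proof.
move=> hX i j; rewrite mxE; under eq_fun do rewrite mxE.
apply: has_mean_sum => k; rewrite mulrC.
by under eq_fun do rewrite mulrC; exact: has_meanZ.
Qed.

Lemma has_mean_mx_usubmx m n p (X : T -> 'M[R]_(m + n, p)) A :
  has_mean_mx Q X A -> has_mean_mx Q (fun t => usubmx (X t)) (usubmx A).
Proof. by move=> hX i j; rewrite mxE; under eq_fun do rewrite mxE; exact: hX. Qed.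

Lemma has_mean_mx_dsubmx m n p (X : T -> 'M[R]_(m + n, p)) A :
  has_mean_mx Q X A -> has_mean_mx Q (fun t => dsubmx (X t)) (dsubmx A).
Proof. by move=> hX i j; rewrite mxE; under eq_fun do rewrite mxE; exact: hX. Qed.

Lemma has_mean_mx_ursubmx m n p q (X : T -> 'M[R]_(m + n, p + q)) A :
  has_mean_mx Q X A -> has_mean_mx Q (fun t => ursubmx (X t)) (ursubmx A).
Proof. by move=> hX i j; rewrite 2!mxE; under eq_fun do rewrite 2!mxE; exact: hX. Qed.

Lemma has_mean_mx_drsubmx m n p q (X : T -> 'M[R]_(m + n, p + q)) A :
  has_mean_mx Q X A -> has_mean_mx Q (fun t => drsubmx (X t)) (drsubmx A).
Proof. by move=> hX i j; rewrite 2!mxE; under eq_fun do rewrite 2!mxE; exact: hX. Qed.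

Lemma has_mean_mx_col m n p (X : T -> 'M[R]_(m, p)) (Y : T -> 'M[R]_(n, p)) A B :
  has_mean_mx Q X A -> has_mean_mx Q Y B ->
  has_mean_mx Q (fun t => col_mx (X t) (Y t)) (col_mx A B).
Proof.
move=> hX hY i j; case: (split_ordP i) => k ->.
  by rewrite col_mxEu; under eq_fun do rewrite col_mxEu; exact: hX.
by rewrite col_mxEd; under eq_fun do rewrite col_mxEd; exact: hY.
Qed.

(** The cross term of a centred perturbation integrates to zero. *)
Lemma second_moment_shift n (a : 'cV[R]_n) (X : T -> 'cV[R]_n) : has_mean_mx Q X 0 ->
  (\int[Q]_t (enorm (a + X t) ^+ 2)%:E <=
   (enorm a ^+ 2)%:E + \int[Q]_t (enorm (X t) ^+ 2)%:E)%E.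
Proof.
move=> hX; have mX := has_mean_mx_mmx hX.
have [->|fin] := eqVneq (\int[Q]_t (enorm (X t) ^+ 2)%:E)%E +oo%E.
  by rewrite addey // leey.
pose Y t := enorm (X t) ^+ 2.
have iY : Q.-integrable setT (EFin \o Y).
  apply/integrableP; split; first exact/measurable_EFinP/measurable_enorm2.
  rewrite ltey; apply: contra fin => /eqP <-; apply/eqP/eq_integral => t _.
  by rewrite /= ger0_norm ?sqr_ge0.
have hL : has_mean Q (fun t => enorm a ^+ 2 + 2 * dotv a (X t)) (enorm a ^+ 2).
  rewrite -[X in has_mean _ _ X]addr0; apply: has_meanD; first exact: has_mean_cst.
  rewrite -(mulr0 2); apply: has_meanZ.
  have -> : 0 = \sum_(i < n) a i 0 * 0 :> R.
    by rewrite big1 // => i _; rewrite mulr0.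
  under eq_fun do rewrite dotvE; apply: has_mean_sum => i; apply: has_meanZ.
  by have := hX i 0; rewrite mxE.
have [iL eL] := (has_meanP _ _).1 hL.
rewrite -eL -(integralD _ iL iY) //.
apply: ge0_le_integral_any => t; first by rewrite lee_fin sqr_ge0.
by rewrite /= -EFinD lee_fin enormD_sqr /Y lexx.
Qed.

End HasMean.

Section ImageLaw.
Context d d' (T : measurableType d) (T' : measurableType d').
Variables (Q : probability T R) (Q' : probability T' R) (phi : T -> T').
Hypotheses (mphi : measurable_fun setT phi).
Hypothesis law : forall B, measurable B -> Q (phi @^-1` B) = Q' B.

Lemma ge0_integral_law (f : T' -> \bar R) : measurable_fun setT f ->
  (forall t, 0 <= f t)%E -> (\int[Q]_t f (phi t) = \int[Q']_t f t)%E.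
Proof.
move=> mf f0; have := @ge0_integral_pushforward _ _ _ _ _ _ mphi Q setT f measurableT mf.
rewrite preimage_setT => <- //; apply: eq_measure_integral => A mA _; exact: law.
Qed.

Lemma has_mean_law (X : T' -> R) m : has_mean Q' X m -> has_mean Q (X \o phi) m.
Proof.
move=> hX; have mX := has_mean_measurable hX; move/has_meanP: hX => [iX eX].
have mXE : measurable_fun setT (EFin \o X) by exact/measurable_EFinP.
have i1 : Q.-integrable setT (EFin \o (X \o phi)).
  apply/integrableP; split; first exact: (measurableT_comp mXE mphi).
  move/integrableP: iX => [_]; rewrite -(@ge0_integral_law (fun t => `|(X t)%:E|%E)) //.
  exact: measurableT_comp.
apply/has_meanP; split => //.
have := @integral_pushforward _ _ _ _ _ _ mphi Q setT (EFin \o X) mXE.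
rewrite preimage_setT => /(_ i1 measurableT) <-; rewrite -eX.
by apply: eq_measure_integral => A mA _; exact: law.
Qed.

Lemma has_mean_mx_law m n (X : T' -> 'M[R]_(m, n)) A :
  has_mean_mx Q' X A -> has_mean_mx Q (X \o phi) A.
Proof. by move=> hX i j; exact: has_mean_law (hX i j). Qed.

End ImageLaw.

Lemma image_measure_exists d d' (W : measurableType d) (T : measurableType d')
    (m : {measure set W -> \bar R}) (tau : W -> T) : measurable_fun setT tau ->
  exists m' : {measure set T -> \bar R}, forall C, m' C = m (tau @^-1` C).
Proof.
move=> mtau.
by unshelve refine (ex_intro _ (pushforward m tau : {measure set T -> \bar R}) _).
Qed.

Section Independence.
Context d (W : measurableType d) (P : probability W R).

(** Both sides are finite measures of the event, so that agreement on a
    pi-system extends to the sigma-algebra it generates. *)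
Lemma indep_extend d' (T : measurableType d') (H : set (set T)) (tau : W -> T) (A : set W) :
  measurable A -> measurable_fun setT tau ->
  @measurable _ T = <<s H >> -> setI_closed H -> H setT ->
  (forall B, H B -> P (A `&` tau @^-1` B) = (P A * P (tau @^-1` B))%E) ->
  forall B, measurable B -> P (A `&` tau @^-1` B) = (P A * P (tau @^-1` B))%E.
Proof.
move=> mA mtau mH IH HT ind B mB.
have PA0 : 0 <= fine (P A) by rewrite fine_ge0.
pose PA : {nonneg R} := NngNum PA0.
have [m1 e1] := image_measure_exists (mrestr P mA) mtau.
have [m0 e0] := image_measure_exists P mtau.
have PAE : (fine (P A))%:E = P A by rewrite fineK // fin_num_measure.
pose m2 : {measure set T -> \bar R} := mscale PA m0.
have {}e1 (C : set T) : m1 C = P (A `&` tau @^-1` C) by rewrite e1 setIC.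
have e2 (C : set T) : m2 C = (P A * P (tau @^-1` C))%E.
  by rewrite /m2 /= /mscale /= e0 PAE.
rewrite -e1 -e2; apply: (@measure_unique _ _ _ H (fun=> setT)) => //.
- by apply/seteqP; split => // x _; exists 0%N.
- by move=> C HC; rewrite e1 e2 ind.
- move=> _; rewrite e1 preimage_setT setIT; apply: le_lt_trans (probability_le1 _ mA) _.
  exact: ltry.
Qed.

Variables (G : set (set W)).
Hypotheses (Gm : G `<=` @measurable _ W) (GI : setI_closed G) (GT : G setT).

Let S := g_sigma_algebraType G.

Lemma sub_id_measurable : measurable_fun setT (id : W -> S).
Proof.
apply: (@measurability _ _ W S setT id G) => // _ [A GA <-].
by rewrite setTI; exact: Gm.
Qed.

Context d' (T : measurableType d') (tau : W -> T).
Hypothesis mtau : measurable_fun setT tau.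
Hypothesis ind : forall A B, G A -> measurable B ->
  P (A `&` tau @^-1` B) = (P A * P (tau @^-1` B))%E.

Let idF : {mfun W >-> S} := HB.pack (id : W -> S)
  (isMeasurableFun.Build _ _ _ _ _ sub_id_measurable).
Let tauF : {mfun W >-> T} := HB.pack tau (isMeasurableFun.Build _ _ _ _ _ mtau).

Definition law_of : probability T R := distribution P tauF.

Lemma joint_measurable :
  @measurable_fun _ _ W (S * T)%type setT (fun w => (w : S, tau w)).
Proof. exact: (@measurable_fun_pair _ _ _ W S T (id : W -> S) tau sub_id_measurable mtau). Qed.

(** Independence makes the law of [(w, tau w)] the product of the law of the past
    and the law of [tau]; Tonelli's theorem then integrates the sample first. *)
Lemma fresh_le (h : S * T -> \bar R) (phi : S -> \bar R) :
  measurable_fun setT h -> (forall x, 0 <= h x)%E ->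
  measurable_fun setT phi ->
  (forall s, \int[law_of]_t h (s, t) <= phi s)%E ->
  (\int[P]_w h (w, tau w) <= \int[P]_w phi w)%E.
Proof.
move=> mh h0 mphi hphi.
pose m1 := distribution P idF.
have phi0 s : (0 <= phi s)%E.
  by apply: le_trans (hphi s); apply: integral_ge0 => t _; exact: h0.
pose jF : {mfun W >-> (S * T)%type} :=
  HB.pack (fun w => (w : S, tau w)) (isMeasurableFun.Build _ _ _ _ _ joint_measurable).
have prodE A : measurable A -> (m1 \x law_of)%E A = distribution P jF A.
  apply: product_measure_unique => B C mB mC.
  have mC' : measurable (tau @^-1` C) by rewrite -[X in measurable X]setTI; exact: mtau.
  transitivity (P (tau @^-1` C `&` (id : W -> S) @^-1` B)).
    by congr (P _); apply/seteqP; split => w /= [].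
  transitivity (P (tau @^-1` C) * P ((id : W -> S) @^-1` B))%E; last exact: muleC.
  apply: (@indep_extend _ S G) => //; first exact: sub_id_measurable.
  by move=> A' GA; rewrite setIC ind // muleC.
have -> : (\int[P]_w phi w = \int[m1]_s phi s)%E.
  by rewrite [RHS](@ge0_integral_pushforward _ _ _ _ _ _ sub_id_measurable).
have -> : (\int[P]_w h (w, tau w) = \int[m1 \x law_of]_x h x)%E.
  rewrite (eq_measure_integral (distribution P jF)); last by move=> A mA _; exact: prodE.
  by rewrite [RHS](@ge0_integral_pushforward _ _ _ _ _ _ joint_measurable).
rewrite fubini_tonelli1 //.
by apply: ge0_le_integral_any => s; [apply: integral_ge0 => t _|exact: hphi].
Qed.

End Independence.
End Integrals.

#[local] Opaque opnorm.

(** * Noise of the recursive momentum *)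

Section Stacking.
Context {R : realType} {dx dy : nat}.
Implicit Types u v : triple R dx dy.

(** Stacking the three components turns statements about three means and second
    moments into statements about one vector. *)
Definition tvec u := col_mx (tx u) (col_mx (ty u) (tz u)).

Lemma tdist2E u v : tdist2 u v = enorm (tvec u - tvec v) ^+ 2.
Proof.
by rewrite /tvec opp_col_mx add_col_mx enorm_col_mx opp_col_mx add_col_mx enorm_col_mx addrA.
Qed.

Definition momentum3 (rho : R) (D Dp v : triple R dx dy) :=
  Triple (momentum rho (tx D) (tx Dp) (tx v)) (momentum rho (ty D) (ty Dp) (ty v))
         (momentum rho (tz D) (tz Dp) (tz v)).

Lemma momentum_tvec rho D Dp v :
  tvec (momentum3 rho D Dp v) = momentum rho (tvec D) (tvec Dp) (tvec v).
Proof. by rewrite /tvec /momentum !(scale_col_mx, opp_col_mx, add_col_mx). Qed.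

(** The error recursion: [e] and [ep] stand for the exact directions at the
    current and the previous point, so the last summand is a difference of pure
    noise terms. *)
Lemma momentum_split n rho (d dp v e ep : 'cV[R]_n) :
  momentum rho d dp v - e =
  (1 - rho) *: (v - ep) + ((d - e) - (1 - rho) *: (dp - ep)).
Proof.
apply/colP => i; rewrite /momentum !mxE.
move: (d i 0) (dp i 0) (v i 0) (e i 0) (ep i 0) => a b c x y; ring.
Qed.

(** The first summand is small because of [rho], the second because the two
    noise terms belong to the same sample at nearby points. *)
Lemma damped_split n rho (a b : 'cV[R]_n) :
  a - (1 - rho) *: b = rho *: a + (1 - rho) *: (a - b).
Proof. apply/colP => i; rewrite !mxE; ring. Qed.

(** The off-diagonal and diagonal Hessian blocks applied to [z] are the two halves
    of one vector [A (0, z)], so the full operator norm enters only once. *)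
Lemma direction_noise_split m n (a : 'cV[R]_(m + n)) (A : 'M[R]_(m + n)) (z b : 'cV[R]_n) :
  enorm (col_mx (usubmx a - ursubmx A *m z) (col_mx b (drsubmx A *m z - dsubmx a))) ^+ 2
  <= 2 * enorm a ^+ 2 + enorm b ^+ 2 + 2 * enorm (A *m col_mx 0 z) ^+ 2.
Proof.
rewrite ursubmx_mul drsubmx_mul 2!enorm_col_mx.
set p := A *m _.
have h1 := enormB_sqr_le (usubmx a) (usubmx p).
have h2 := enormB_sqr_le (dsubmx p) (dsubmx a).
have ea : enorm a ^+ 2 = enorm (usubmx a) ^+ 2 + enorm (dsubmx a) ^+ 2.
  by rewrite -enorm_col_mx vsubmxK.
have ep : enorm p ^+ 2 = enorm (usubmx p) ^+ 2 + enorm (dsubmx p) ^+ 2.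
  by rewrite -enorm_col_mx vsubmxK.
rewrite ea ep; move: h1 h2; clear; lra.
Qed.

Lemma direction_stack_diff m n (a b p q : 'cV[R]_(m + n)) (A B : 'M[R]_(m + n))
    (z : 'cV[R]_n) :
  col_mx (usubmx a - ursubmx A *m z) (col_mx (dsubmx p) (drsubmx A *m z - dsubmx a))
  - col_mx (usubmx b - ursubmx B *m z) (col_mx (dsubmx q) (drsubmx B *m z - dsubmx b))
  = col_mx (usubmx (a - b) - ursubmx (A - B) *m z)
      (col_mx (dsubmx (p - q)) (drsubmx (A - B) *m z - dsubmx (a - b))).
Proof.
have eu : ursubmx (A - B) *m z = ursubmx A *m z - ursubmx B *m z.
  by rewrite (ursubmx_mul (A - B)) (ursubmx_mul A) (ursubmx_mul B) mulmxBl usubmxB.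
have ed : drsubmx (A - B) *m z = drsubmx A *m z - drsubmx B *m z.
  by rewrite (drsubmx_mul (A - B)) (drsubmx_mul A) (drsubmx_mul B) mulmxBl dsubmxB.
rewrite eu ed usubmxB 2!dsubmxB opp_col_mx add_col_mx opp_col_mx add_col_mx.
by congr (col_mx _ (col_mx _ _)); exact: subrBB.
Qed.

Lemma tvec_diff_diff (A B A' B' : triple R dx dy) :
  enorm ((tvec A - tvec B) - (tvec A' - tvec B')) ^+ 2
  <= 2 * tdist2 A A' + 2 * tdist2 B B'.
Proof. by rewrite subrBB 2!tdist2E enormB_sqr_le. Qed.

Lemma triple_bound (D D' : triple R dx dy) (X : R) :
  [/\ enorm (tx D - tx D') ^+ 2 <= X, enorm (ty D - ty D') ^+ 2 <= X &
      enorm (tz D - tz D') ^+ 2 <= X] -> tdist2 D D' <= 3 * X.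
Proof. rewrite /tdist2 => -[]; lra. Qed.

Lemma double_triple_bound (a b c m : R) : a <= 3 * (2 * m * c) ->
  b <= 3 * (2 * m * c) -> 2 * a + 2 * b <= 24 * m * c.
Proof. move=> *; lra. Qed.

Lemma momentum_scalar_bound (rho a c d m : R) : 0 <= rho -> rho <= 1 -> 0 <= c ->
  c <= 24 * m * d ->
  2 * (rho ^+ 2 * a) + 2 * ((1 - rho) ^+ 2 * c) <= 2 * rho ^+ 2 * a + 48 * m * d.
Proof.
move=> rho0 rho1 c0 h; have k : (1 - rho) ^+ 2 * c <= c.
  by rewrite ler_piMl // expr_le1 // ?subr_ge0 // lerBlDr lerDl.
lra.
Qed.

End Stacking.

Section Noise.
Context {R : realType} {dx dy : nat} {d1 d2 : measure_display}.
Context {T1 : measurableType d1} {T2 : measurableType d2}.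
Variables (P1 : probability T1 R) (P2 : probability T2 R) (Q : probability (T1 * T2)%type R).
Variables (F : T1 -> 'cV[R]_(dx + dy) -> R) (G : T2 -> 'cV[R]_(dx + dy) -> R).
Variables (f g : 'cV[R]_(dx + dy) -> R) (L r sf sg1 sg2 : R).
Hypotheses (L0 : 0 <= L) (r0 : 0 <= r).
Hypotheses (Q1 : forall B, measurable B -> Q (fst @^-1` B) = P1 B).
Hypotheses (Q2 : forall B, measurable B -> Q (snd @^-1` B) = P2 B).
Hypotheses (smg : smooth2 g) (smG : forall t, smooth2 (G t)).
Hypotheses (glf : grad_lipschitz L f) (glg : grad_lipschitz L g) (hlg : hess_lipschitz L g).
Hypotheses (glF : forall s, grad_lipschitz L (F s)) (glG : forall t, grad_lipschitz L (G t)).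
Hypothesis hlG : forall t, hess_lipschitz L (G t).
Hypothesis meanF : forall w, has_mean_mx P1 (fun s => grad (F s) w) (grad f w).
Hypothesis meanG : forall w, has_mean_mx P2 (fun t => grad (G t) w) (grad g w).
Hypothesis meanH : forall w, has_mean_mx P2 (fun t => hess (G t) w) (hess g w).
Hypothesis varF : forall w,
  ('E_P1[fun s => (enorm (grad (F s) w - grad f w) ^+ 2)%R] <= (sf ^+ 2)%:E)%E.
Hypothesis varG : forall w,
  ('E_P2[fun t => (enorm (grad (G t) w - grad g w) ^+ 2)%R] <= (sg1 ^+ 2)%:E)%E.
Hypothesis varH : forall w,
  ('E_P2[fun t => (opnorm (hess (G t) w - hess g w) ^+ 2)%R] <= (sg2 ^+ 2)%:E)%E.
Implicit Types u v : triple R dx dy.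

Let M := L * (1 + r).

Definition noise (t : T1 * T2) u :=
  tvec (direction (F t.1) (G t.2) u) - tvec (direction f g u).

Definition noise_var := 2 * sf ^+ 2 + sg1 ^+ 2 + 2 * (r ^+ 2 * sg2 ^+ 2).

Lemma noise_mean u : has_mean_mx Q (fun t => noise t u) 0.
Proof.
rewrite -(subrr (tvec (direction f g u))); apply: has_mean_mxB; last exact: has_mean_mx_cst.
set w := col_mx (tx u) (ty u).
have mF := has_mean_mx_law measurable_fst Q1 (meanF w).
have mG := has_mean_mx_law measurable_snd Q2 (meanG w).
have mH := has_mean_mx_law measurable_snd Q2 (meanH w).
apply: has_mean_mx_col.
  apply: has_mean_mxB; first exact: has_mean_mx_usubmx mF.
  exact: has_mean_mxMr (has_mean_mx_ursubmx mH).
apply: has_mean_mx_col; first exact: has_mean_mx_dsubmx mG.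
apply: has_mean_mxB; last exact: has_mean_mx_dsubmx mF.
exact: has_mean_mxMr (has_mean_mx_drsubmx mH).
Qed.

Lemma noise_pointwise t u w : w = col_mx (tx u) (ty u) ->
  (enorm (noise t u) ^+ 2 <= 2 * enorm (grad (F t.1) w - grad f w) ^+ 2
    + enorm (grad (G t.2) w - grad g w) ^+ 2
    + 2 * enorm ((hess (G t.2) w - hess g w) *m col_mx 0 (tz u)) ^+ 2)%R.
Proof.
move=> wE; have h := direction_noise_split (grad (F t.1) w - grad f w)
  (hess (G t.2) w - hess g w) (tz u) (dsubmx (grad (G t.2) w - grad g w)).
have -> : noise t u = col_mx
   (usubmx (grad (F t.1) w - grad f w) - ursubmx (hess (G t.2) w - hess g w) *m tz u)
   (col_mx (dsubmx (grad (G t.2) w - grad g w))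
     (drsubmx (hess (G t.2) w - hess g w) *m tz u - dsubmx (grad (F t.1) w - grad f w))).
  rewrite wE; exact: direction_stack_diff.
apply: le_trans h _; rewrite lerD2r lerD2l; apply: sqr_le2; first exact: enorm_ge0.
exact: enorm_dsubmx.
Qed.

(** For [r = 0] the bound is zero and no scaling is possible; otherwise the factor
    [r^2] is moved to the side of the measurable function [X], and monotonicity
    compares the integral of [X / r^2] with that of the squared operator norm. *)
Lemma hess_noise_integral (w : 'cV[R]_(dx + dy)) (z : 'cV[R]_dy) : enorm z <= r ->
  (\int[P2]_t (enorm ((hess (G t) w - hess g w) *m col_mx 0 z) ^+ 2)%:E
    <= (r ^+ 2 * sg2 ^+ 2)%:E)%E.
Proof.
move=> zr; pose X t := enorm ((hess (G t) w - hess g w) *m col_mx 0 z) ^+ 2.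
have mX : measurable_fun setT (EFin \o X).
  apply/measurable_EFinP/measurable_enorm2.
  apply: mmxM; last exact: mmx_cst.
  exact: mmxB (has_mean_mx_mmx (meanH w)) (mmx_cst _).
have bX t : X t <= r ^+ 2 * opnorm (hess (G t) w - hess g w) ^+ 2.
  rewrite -exprMn; apply: sqr_le2; first exact: enorm_ge0.
  by apply: le_trans (opnorm_mul _ _) _; rewrite enorm_col0 mulrC ler_wpM2r ?opnorm_ge0.
have [rE|rn] := eqVneq r 0.
  rewrite rE expr0n mul0r; apply: (@le_trans _ _ (\int[P2]_t 0)%E).
    apply: ge0_le_integral_any => t; first by rewrite lee_fin sqr_ge0.
    by rewrite lee_fin; have := bX t; rewrite rE expr0n mul0r.
  by rewrite integral0.
have r2 : 0 < r ^+ 2 by rewrite exprn_gt0 // lt_neqAle eq_sym rn.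
have -> : (\int[P2]_t (X t)%:E = (r ^+ 2)%:E * \int[P2]_t ((r ^+ 2)^-1 * X t)%:E)%E.
  under [in RHS]eq_integral do rewrite EFinM.
  rewrite ge0_integralZl_EFin //; last 2 first.
  - by move=> t _; rewrite lee_fin sqr_ge0.
  - by rewrite invr_ge0 ltW.
  by rewrite muleA -EFinM mulfV ?gt_eqF // mul1e.
rewrite [X in (_ <= X)%E]EFinM; apply: lee_wpmul2l; first by rewrite lee_fin ltW.
apply: le_trans (varH w); rewrite expectation.unlock.
apply: ge0_le_integral_any => t.
  by rewrite lee_fin mulr_ge0 ?sqr_ge0 // invr_ge0 ltW.
by rewrite lee_fin ler_pdivrMl.
Qed.

Lemma noise_second_moment u : enorm (tz u) <= r ->
  (\int[Q]_t (enorm (noise t u) ^+ 2)%:E <= noise_var%:E)%E.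
Proof.
move=> zr; pose w := col_mx (tx u) (ty u).
pose A s := enorm (grad (F s) w - grad f w) ^+ 2.
pose B t := enorm (grad (G t) w - grad g w) ^+ 2.
pose C t := enorm ((hess (G t) w - hess g w) *m col_mx 0 (tz u)) ^+ 2.
have mA : measurable_fun setT (EFin \o A).
  apply/measurable_EFinP/measurable_enorm2.
  exact: mmxB (has_mean_mx_mmx (meanF w)) (mmx_cst _).
have mB : measurable_fun setT (EFin \o B).
  apply/measurable_EFinP/measurable_enorm2.
  exact: mmxB (has_mean_mx_mmx (meanG w)) (mmx_cst _).
have mC : measurable_fun setT (EFin \o C).
  apply/measurable_EFinP/measurable_enorm2.
  apply: mmxM; last exact: mmx_cst.
  exact: mmxB (has_mean_mx_mmx (meanH w)) (mmx_cst _).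
have A0 s : (0 <= (A s)%:E)%E by rewrite lee_fin sqr_ge0.
have B0 t : (0 <= (B t)%:E)%E by rewrite lee_fin sqr_ge0.
have C0 t : (0 <= (C t)%:E)%E by rewrite lee_fin sqr_ge0.
have iA : (\int[Q]_t (A t.1)%:E <= (sf ^+ 2)%:E)%E.
  rewrite (ge0_integral_law measurable_fst Q1 mA A0).
  by have := varF w; rewrite expectation.unlock.
have iB : (\int[Q]_t (B t.2)%:E <= (sg1 ^+ 2)%:E)%E.
  rewrite (ge0_integral_law measurable_snd Q2 mB B0).
  by have := varG w; rewrite expectation.unlock.
have iC : (\int[Q]_t (C t.2)%:E <= (r ^+ 2 * sg2 ^+ 2)%:E)%E.
  rewrite (ge0_integral_law measurable_snd Q2 mC C0).
  exact: hess_noise_integral.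
have mA' : measurable_fun setT (fun t : T1 * T2 => (A t.1)%:E).
  exact: (measurableT_comp mA measurable_fst).
have mB' : measurable_fun setT (fun t : T1 * T2 => (B t.2)%:E).
  exact: (measurableT_comp mB measurable_snd).
have mC' : measurable_fun setT (fun t : T1 * T2 => (C t.2)%:E).
  exact: (measurableT_comp mC measurable_snd).
have m2A := measurable_funeM 2%:E mA'.
have m2C := measurable_funeM 2%:E mC'.
apply: (@le_trans _ _ (\int[Q]_t (2%:E * (A t.1)%:E + ((B t.2)%:E + 2%:E * (C t.2)%:E)))%E).
  apply: ge0_le_integral_any => t; first by rewrite lee_fin sqr_ge0.
  rewrite -!EFinM -!EFinD lee_fin addrA; exact: (noise_pointwise t (erefl w)).
have pA (t : T1 * T2) : setT t -> (0 <= 2%:E * (A t.1)%:E)%E by move=> _; exact: mule_ge0.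
have pB (t : T1 * T2) : setT t -> (0 <= (B t.2)%:E)%E by [].
have pC (t : T1 * T2) : setT t -> (0 <= 2%:E * (C t.2)%:E)%E by move=> _; exact: mule_ge0.
have pBC (t : T1 * T2) : setT t -> (0 <= (B t.2)%:E + 2%:E * (C t.2)%:E)%E.
  by move=> tT; apply: adde_ge0; [exact: pB|exact: pC].
rewrite (@ge0_integralD _ _ _ Q setT measurableT _ _ pA m2A pBC (emeasurable_funD mB' m2C)).
rewrite (@ge0_integralD _ _ _ Q setT measurableT _ _ pB mB' pC m2C).
have qA (t : T1 * T2) : setT t -> (0 <= (A t.1)%:E)%E by [].
have qC (t : T1 * T2) : setT t -> (0 <= (C t.2)%:E)%E by [].
rewrite (@ge0_integralZl_EFin _ _ _ Q setT measurableT _ qA mA' 2 (ler0n _ 2)).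
rewrite (@ge0_integralZl_EFin _ _ _ Q setT measurableT _ qC mC' 2 (ler0n _ 2)).
rewrite /noise_var -(addrA (2 * sf ^+ 2)) [X in (_ <= X)%E]EFinD; apply: leeD.
  by rewrite [X in (_ <= X)%E]EFinM; apply: lee_wpmul2l.
rewrite [X in (_ <= X)%E]EFinD; apply: leeD; first exact: iB.
by rewrite [X in (_ <= X)%E]EFinM; apply: lee_wpmul2l.
Qed.

(** The sampled and the mean direction share one Lipschitz constant, hence so does
    their difference up to a factor. *)
Lemma noise_lipschitz t u u' : enorm (tz u') <= r ->
  enorm (noise t u - noise t u') ^+ 2 <= 24 * M ^+ 2 * tdist2 u u'.
Proof.
move=> zr; apply: le_trans (tvec_diff_diff _ _ _ _) _.
have h1 := triple_bound
  (direction_lipschitz L0 r0 (smG t.2) (glF t.1) (glG t.2) (hlG t.2) u zr).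
have h2 := triple_bound (direction_lipschitz L0 r0 smg glf glg hlg u zr).
exact: double_triple_bound h1 h2.
Qed.

Lemma momentum_noise (rho : R) t u up : 0 <= rho -> rho <= 1 -> enorm (tz up) <= r ->
  enorm (noise t u - (1 - rho) *: noise t up) ^+ 2 <=
  2 * rho ^+ 2 * enorm (noise t u) ^+ 2 + 48 * M ^+ 2 * tdist2 u up.
Proof.
move=> rho0 rho1 zr.
have -> : noise t u - (1 - rho) *: noise t up =
    rho *: noise t u + (1 - rho) *: (noise t u - noise t up).
  exact: damped_split.
apply: le_trans (enormD_sqr_le _ _) _; rewrite 2!enormZ (exprMn _ `|rho|) (exprMn _ `|1 - rho|) !real_normK ?num_real //.
exact: momentum_scalar_bound rho0 rho1 (sqr_ge0 _) (noise_lipschitz t u zr).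
Qed.

(** Conditionally on the past, the recursive momentum damps the old error and
    adds a centred perturbation of controlled second moment. *)
Lemma noise_step (A q rho : R) u up vp : 0 <= A -> 0 <= q -> 0 <= rho -> rho <= 1 ->
  enorm (tz u) <= r -> enorm (tz up) <= r ->
  (\int[Q]_t (A + q * tdist2 (momentum3 rho (direction (F t.1) (G t.2) u)
       (direction (F t.1) (G t.2) up) vp) (direction f g u))%:E <=
   (A + q * ((1 - rho) ^+ 2 * tdist2 vp (direction f g up)
      + 48 * M ^+ 2 * tdist2 u up + 2 * rho ^+ 2 * noise_var))%:E)%E.
Proof.
move=> A0 q0 rho0 rho1 zu zup.
pose a := (1 - rho) *: (tvec vp - tvec (direction f g up)).
pose n t := noise t u - (1 - rho) *: noise t up.
have hn : has_mean_mx Q n 0.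
  rewrite -(subr0 0) -{2}(scaler0 _ (1 - rho)).
  exact: has_mean_mxB (noise_mean u) (has_mean_mxZ _ (noise_mean up)).
have E t : tdist2 (momentum3 rho (direction (F t.1) (G t.2) u)
    (direction (F t.1) (G t.2) up) vp) (direction f g u) = enorm (a + n t) ^+ 2.
  by rewrite tdist2E momentum_tvec (momentum_split _ _ _ _ _ (tvec (direction f g up))).
have mN v : measurable_fun setT (fun t => (enorm (noise t v) ^+ 2)%:E).
  apply/measurable_EFinP/measurable_enorm2.
  exact: has_mean_mx_mmx (noise_mean v).
have man : measurable_fun setT (fun t => (enorm (a + n t) ^+ 2)%:E).
  apply/measurable_EFinP/measurable_enorm2.
  exact: mmxD (mmx_cst _) (has_mean_mx_mmx hn).
under eq_integral do rewrite E EFinD EFinM.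
have p1 t : setT t -> (0 <= (enorm (a + n t) ^+ 2)%:E)%E by rewrite lee_fin sqr_ge0.
have p2 t : setT t -> (0 <= q%:E * (enorm (a + n t) ^+ 2)%:E)%E.
  by move=> tT; apply: mule_ge0; [rewrite lee_fin|exact: p1].
have pA (t : T1 * T2) : setT t -> (0 <= A%:E)%E by rewrite lee_fin.
rewrite (@ge0_integralD _ _ _ Q setT measurableT _ _ pA (measurable_cst _) p2
  (measurable_funeM q%:E man)).
rewrite (@ge0_integralZl_EFin _ _ _ Q setT measurableT _ p1 man q q0).
rewrite integral_cst // [X in (A%:E * X)%E]probability_setT mule1 EFinD EFinM.
apply: leeD => //; apply: lee_wpmul2l => //.
apply: le_trans (second_moment_shift a hn) _.
have -> : enorm a ^+ 2 = (1 - rho) ^+ 2 * tdist2 vp (direction f g up).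
  by rewrite enormZ exprMn real_normK ?num_real // tdist2E.
rewrite -addrA EFinD; apply: leeD => //.
apply: (@le_trans _ _ (\int[Q]_t ((48 * M ^+ 2 * tdist2 u up)%:E
    + (2 * rho ^+ 2)%:E * (enorm (noise t u) ^+ 2)%:E))%E).
  apply: ge0_le_integral_any => t; first by rewrite lee_fin sqr_ge0.
  by rewrite -EFinM -EFinD lee_fin addrC momentum_noise.
have c0 : 0 <= 48 * M ^+ 2 * tdist2 u up by rewrite mulr_ge0 ?tdist2_ge0 // mulr_ge0 // sqr_ge0.
have e0 : 0 <= 2 * rho ^+ 2 by rewrite mulr_ge0 // sqr_ge0.
have p3 t : setT t -> (0 <= (enorm (noise t u) ^+ 2)%:E)%E by rewrite lee_fin sqr_ge0.
have p4 t : setT t -> (0 <= (2 * rho ^+ 2)%:E * (enorm (noise t u) ^+ 2)%:E)%E.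
  by move=> tT; apply: mule_ge0; [rewrite lee_fin|exact: p3].
have p5 (t : T1 * T2) : setT t -> (0 <= (48 * M ^+ 2 * tdist2 u up)%:E)%E by rewrite lee_fin.
rewrite (@ge0_integralD _ _ _ Q setT measurableT _ _ p5 (measurable_cst _) p4
  (measurable_funeM _ (mN u))).
rewrite (@ge0_integralZl_EFin _ _ _ Q setT measurableT _ p3 (mN u) _ e0).
rewrite integral_cst // [X in (_ * X)%E]probability_setT mule1 EFinD; apply: leeD => //.
by rewrite [X in (_ <= X)%E]EFinM; apply: lee_wpmul2l => //; exact: noise_second_moment.
Qed.

End Noise.

(** * The past of the iteration *)

Section Past.
Context {R : realType} {d d1 d2 : measure_display}.
Context {W : measurableType d} {T1 : measurableType d1} {T2 : measurableType d2}.
Variables (P : probability W R) (xi : nat -> {mfun W >-> T1}) (zeta : nat -> {mfun W >-> T2}).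
Hypothesis ind : independent_samples P xi zeta.

Definition cylinder (A : nat -> set T1) (B : nat -> set T2) (k : nat) : set W :=
  \bigcap_(j in `I_k) ((xi j @^-1` A j) `&` (zeta j @^-1` B j)).

(** A pi-system generating the sigma-algebra of the first [k] pairs of samples. *)
Definition past (k : nat) : set (set W) :=
  [set C | exists A B, [/\ forall j, measurable (A j), forall j, measurable (B j)
                        & C = cylinder A B k]].

Lemma cylinderS A B k :
  cylinder A B k.+1 = cylinder A B k `&` ((xi k @^-1` A k) `&` (zeta k @^-1` B k)).
Proof.
apply/seteqP; split => w /= h.
  by split; [move=> j /= jk; apply: h => /=; exact: ltnW|apply: h => /=].
case: h => h hk j /=; rewrite ltnS leq_eqVlt => /orP[/eqP ->//|jk]; exact: h.
Qed.

Lemma eq_cylinder A B A' B' k : (forall j, (j < k)%N -> A j = A' j /\ B j = B' j) ->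
  cylinder A B k = cylinder A' B' k.
Proof.
move=> e; apply: eq_bigcapr => j /= jk; by have [-> ->] := e j jk.
Qed.

Lemma cylinder_setT k : cylinder (fun=> setT) (fun=> setT) k = setT.
Proof. by apply/seteqP; split => w // _ j _. Qed.

Lemma past_setT k : past k setT.
Proof.
exists (fun=> setT), (fun=> setT); split; try by move=> j; exact: measurableT.
by rewrite cylinder_setT.
Qed.

Lemma past_setI k : setI_closed (past k).
Proof.
move=> _ _ [A [B [mA mB ->]]] [A' [B' [mA' mB' ->]]].
exists (fun j => A j `&` A' j), (fun j => B j `&` B' j); split.
- by move=> j; exact: measurableI.
- by move=> j; exact: measurableI.
apply/seteqP; split => w /=.
  by move=> [h h'] j jk; have [h1 h2] := h j jk; have [h3 h4] := h' j jk.
by move=> h; split => j jk; have [[h1 h2] [h3 h4]] := h j jk.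
Qed.

Lemma measurable_preim d' (T : measurableType d') (x : {mfun W >-> T}) (A : set T) :
  measurable A -> measurable (x @^-1` A).
Proof. by move=> mA; rewrite -[X in measurable X]setTI; exact: measurable_funPT. Qed.

Lemma past_measurable k : past k `<=` @measurable _ W.
Proof.
move=> _ [A [B [mA mB ->]]]; apply: fin_bigcap_measurable => [|j _].
  exact: finite_II.
by apply: measurableI; exact: measurable_preim.
Qed.

(** Replacing the events from index [k] on turns a cylinder of length [k] into one
    of length [k + 1] with a prescribed last event. *)
Let prolong T (A : nat -> set T) (B : set T) k j := if (j < k)%N then A j else B.

Lemma prolong_measurable d' (T : measurableType d') (A : nat -> set T) B k :
  (forall j, measurable (A j)) -> measurable B -> forall j, measurable (prolong A B k j).
Proof. by move=> mA mB j; rewrite /prolong; case: ifP. Qed.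

Lemma cylinder_prolong A B C D k : cylinder (prolong A C k) (prolong B D k) k.+1 =
  cylinder A B k `&` ((xi k @^-1` C) `&` (zeta k @^-1` D)).
Proof.
rewrite cylinderS {3 4}/prolong ltnn; congr (_ `&` _).
by apply: eq_cylinder => j jk; rewrite /prolong jk.
Qed.

Lemma past_succ k : past k `<=` past k.+1.
Proof.
move=> _ [A [B [mA mB ->]]]; exists (prolong A setT k), (prolong B setT k).
split; try exact: prolong_measurable.
by rewrite cylinder_prolong !preimage_setT !setIT.
Qed.

Definition pastType k := g_sigma_algebraType (past k).

Lemma past_id_measurable k : @measurable_fun _ _ (pastType k.+1) (pastType k) setT id.
Proof.
apply: (@measurability _ _ (pastType k.+1) (pastType k) setT id (past k)) => // _ [A hA <-].
by rewrite setTI; apply: sub_sigma_algebra; exact: past_succ.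
Qed.

Lemma past_xi_measurable k : @measurable_fun _ _ (pastType k.+1) T1 setT (xi k).
Proof.
move=> _ C mC; rewrite setTI; apply: sub_sigma_algebra.
exists (prolong (fun=> setT) C k), (prolong (fun=> setT) setT k).
split; try exact: prolong_measurable.
by rewrite cylinder_prolong cylinder_setT setTI preimage_setT setIT.
Qed.

Lemma past_zeta_measurable k : @measurable_fun _ _ (pastType k.+1) T2 setT (zeta k).
Proof.
move=> _ C mC; rewrite setTI; apply: sub_sigma_algebra.
exists (prolong (fun=> setT) setT k), (prolong (fun=> setT) C k).
split; try exact: prolong_measurable.
by rewrite cylinder_prolong cylinder_setT setTI preimage_setT setTI.
Qed.

Definition sample k w := (xi k w, zeta k w).

Lemma sample_measurable k : measurable_fun setT (sample k).
Proof. by apply: measurable_fun_pair; exact: measurable_funPT. Qed.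

Lemma sample_past_rect k A C D : past k A -> measurable C -> measurable D ->
  P (A `&` sample k @^-1` (C `*` D)) = (P A * (P (xi k @^-1` C) * P (zeta k @^-1` D)))%E.
Proof.
move=> [A1 [B1 [mA mB ->]]] mC mD.
have -> : sample k @^-1` (C `*` D) = (xi k @^-1` C) `&` (zeta k @^-1` D) by [].
rewrite -cylinder_prolong /cylinder !ind //; try exact: prolong_measurable.
rewrite big_ord_recr /= {3 4}/prolong ltnn; congr (_ * _)%E.
by apply: eq_bigr => j _; rewrite /prolong ltn_ord.
Qed.

(** Mutual independence gives the product rule for rectangles of the fresh pair; it
    extends to all events of the pair while the past event is kept fixed. *)
Lemma sample_independent k A B : past k A -> measurable B ->
  P (A `&` sample k @^-1` B) = (P A * P (sample k @^-1` B))%E.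
Proof.
move=> hA mB; apply: (@indep_extend _ _ _ _ _ _ [set C `*` D | C in measurable & D in measurable]).
- exact: past_measurable hA.
- exact: sample_measurable.
- exact: measurable_prod_measurableType.
- move=> _ _ [C mC [D mD <-]] [C' mC' [D' mD' <-]].
  exists (C `&` C'); first exact: measurableI.
  exists (D `&` D'); first exact: measurableI.
  by rewrite setXI.
- by exists setT => //; exists setT => //; rewrite setXTT.
- move=> _ [C mC [D mD <-]]; rewrite sample_past_rect //; congr (_ * _)%E.
  have := sample_past_rect (past_setT k) mC mD.
  by rewrite setTI probability_setT mul1e.
- exact: mB.
Qed.

Definition sample_law k : probability (T1 * T2)%type R := law_of P (sample_measurable k).

Lemma sample_law_fst k B : measurable B -> sample_law k (fst @^-1` B) = P (xi k @^-1` B).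
Proof. by []. Qed.

Lemma sample_law_snd k B : measurable B -> sample_law k (snd @^-1` B) = P (zeta k @^-1` B).
Proof. by []. Qed.

Lemma fresh_sample_le k (h : pastType k * (T1 * T2) -> \bar R) (phi : pastType k -> \bar R) :
  measurable_fun setT h -> (forall x, 0 <= h x)%E -> measurable_fun setT phi ->
  (forall s, \int[sample_law k]_t h (s, t) <= phi s)%E ->
  (\int[P]_w h (w, sample k w) <= \int[P]_w phi w)%E.
Proof.
apply: (@fresh_le _ _ _ P (past k) _ _ _ _ _ (sample k) (sample_measurable k)).
- exact: past_measurable.
- exact: past_setI.
- exact: past_setT.
- exact: sample_independent.
Qed.

End Past.

(** * Measurability of the iterates *)

Section TripleMeasurability.
Context {R : realType} {dx dy : nat}.

Definition mtriple d (S : measurableType d) (U : S -> triple R dx dy) :=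
  [/\ mmx (fun s => tx (U s)), mmx (fun s => ty (U s)) & mmx (fun s => tz (U s))].

Lemma mtriple_comp d d' (S : measurableType d) (S' : measurableType d') (phi : S' -> S)
    (U : S -> triple R dx dy) : measurable_fun setT phi -> mtriple U ->
  mtriple (fun s => U (phi s)).
Proof. by move=> mphi [h1 h2 h3]; split; [move: h1|move: h2|move: h3] => h; exact: mmx_comp mphi h. Qed.

Context {d : measure_display} {S : measurableType d}.

Lemma mtriple_cst (u : triple R dx dy) : mtriple (fun _ : S => u).
Proof. by split; exact: mmx_cst. Qed.

Lemma mmx_tvec (U : S -> triple R dx dy) : mtriple U -> mmx (fun s => tvec (U s)).
Proof. by move=> [h1 h2 h3]; apply: mmx_col => //; exact: mmx_col. Qed.

Lemma measurable_tdist2 (U V : S -> triple R dx dy) : mtriple U -> mtriple V ->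
  measurable_fun setT (fun s => tdist2 (U s) (V s)).
Proof.
move=> mU mV; under eq_fun do rewrite tdist2E.
by apply: measurable_enorm2; apply: mmxB; exact: mmx_tvec.
Qed.

Lemma mtriple_momentum rho (D Dp V : S -> triple R dx dy) : mtriple D -> mtriple Dp ->
  mtriple V -> mtriple (fun s => momentum3 rho (D s) (Dp s) (V s)).
Proof.
have H n (A B C : S -> 'cV[R]_n) : mmx A -> mmx B -> mmx C ->
    mmx (fun s => momentum rho (A s) (B s) (C s)).
  by move=> mA mB mC; apply: mmxD; apply: mmxZ => //; apply: mmxD => //; exact: mmxB.
by move=> [a1 a2 a3] [b1 b2 b3] [c1 c2 c3]; split; exact: H.
Qed.

Lemma mtriple_update r al be ga (U V : S -> triple R dx dy) : 0 <= r ->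
  mtriple U -> mtriple V -> mtriple (fun s => update r al be ga (U s) (V s)).
Proof.
move=> r0 [a1 a2 a3] [b1 b2 b3]; split; try by apply: mmxB => //; exact: mmxZ.
apply: (@mmx_lipschitz _ _ _ _ _ _ 1); last by apply: mmxB => //; exact: mmxZ.
by move=> w w'; rewrite mul1r; exact: eproj_nonexpansive.
Qed.

Section Direction.
Context {d1 d2 : measure_display} {T1 : measurableType d1} {T2 : measurableType d2}.
Variables (F : T1 -> 'cV[R]_(dx + dy) -> R) (G : T2 -> 'cV[R]_(dx + dy) -> R) (L : R).
Hypotheses (glF : forall s, grad_lipschitz L (F s)) (glG : forall t, grad_lipschitz L (G t)).
Hypothesis hlG : forall t, hess_lipschitz L (G t).
Hypotheses (mF : forall w, mmx (fun s => grad (F s) w)).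
Hypotheses (mG : forall w, mmx (fun t => grad (G t) w)).
Hypotheses (mH : forall w, mmx (fun t => hess (G t) w)).

Lemma mmx_grad_caratheodory d' (T : measurableType d') (K : T -> 'cV[R]_(dx + dy) -> R)
    (a : S -> T) (U : S -> 'cV[R]_(dx + dy)) :
  (forall t, grad_lipschitz L (K t)) -> (forall w, mmx (fun t => grad (K t) w)) ->
  measurable_fun setT a -> mmx U -> mmx (fun s => grad (K (a s)) (U s)).
Proof.
move=> gl mK ma mU i j; rewrite ord1.
apply: (@measurable_caratheodory _ _ _ _ _ _ (fun t w => grad (K t) w i 0)) => //.
  by move=> w; exact: mK.
move=> t; apply: (@loc_lip_le _ _ _ L) => w w'; apply: le_trans (gl t w' w).
by have := enorm_coord (grad (K t) w' - grad (K t) w) i; rewrite !mxE.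
Qed.

Lemma mmx_hess_caratheodory (b : S -> T2) (U : S -> 'cV[R]_(dx + dy)) :
  measurable_fun setT b -> mmx U -> mmx (fun s => hess (G (b s)) (U s)).
Proof.
move=> mb mU i j.
apply: (@measurable_caratheodory _ _ _ _ _ _ (fun t w => hess (G t) w i j)) => //.
  by move=> w; exact: mH.
move=> t; apply: (@loc_lip_le _ _ _ L) => w w'; apply: le_trans (hlG t w' w).
exact: entry_diff_le.
Qed.

Lemma mtriple_direction (a : S -> T1) (b : S -> T2) (U : S -> triple R dx dy) :
  measurable_fun setT a -> measurable_fun setT b -> mtriple U ->
  mtriple (fun s => direction (F (a s)) (G (b s)) (U s)).
Proof.
move=> ma mb [h1 h2 h3].
have mW : mmx (fun s => col_mx (tx (U s)) (ty (U s))) by exact: mmx_col.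
have gF := mmx_grad_caratheodory glF mF ma mW.
have gG := mmx_grad_caratheodory glG mG mb mW.
have hG := mmx_hess_caratheodory mb mW.
split => /=.
- apply: mmxB; first exact: mmx_usubmx gF.
  exact: mmxM (mmx_ursubmx hG) h3.
- exact: mmx_dsubmx gG.
- apply: mmxB; last exact: mmx_dsubmx gF.
  exact: mmxM (mmx_drsubmx hG) h3.
Qed.

End Direction.
End TripleMeasurability.

(** * The potential in expectation *)

Lemma fresh_regroup (R : realFieldType) (A q X Y p s : R) :
  A + q * (X + Y + 2 * p * s) <= A + q * (X + Y) + 2 * q * p * s.
Proof. by rewrite le_eqVlt; apply/orP; left; apply/eqP; ring. Qed.

Lemma noise_floor_eq (R : realFieldType) (lam c s a : R) : a != 0 ->
  2 * (lam / a) * (c * a ^+ 2) ^+ 2 * s = 2 * lam * c ^+ 2 * s * a ^+ 3.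
Proof. by move=> a0; field. Qed.

Section Run.
Context {R : realType} {dx dy : nat} {d d1 d2 : measure_display}.
Context {W : measurableType d} {T1 : measurableType d1} {T2 : measurableType d2}.
Variables (P : probability W R) (P1 : probability T1 R) (P2 : probability T2 R).
Variables (xi : nat -> {mfun W >-> T1}) (zeta : nat -> {mfun W >-> T2}).
Variables (F : T1 -> 'cV[R]_(dx + dy) -> R) (G : T2 -> 'cV[R]_(dx + dy) -> R).
Variables (f g : 'cV[R]_(dx + dy) -> R) (L mu r Hinf sf sg1 sg2 : R).
Variables (alpha beta gamma rhox rhoy rhoz rho : nat -> R).
Variables (uprev0 u0 vprev0 : triple R dx dy).
Hypothesis ind : independent_samples P xi zeta.
Hypothesis lawxi : forall k A, measurable A -> P (xi k @^-1` A) = P1 A.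
Hypothesis lawzeta : forall k B, measurable B -> P (zeta k @^-1` B) = P2 B.
Hypotheses (L0 : 0 <= L) (mu0 : 0 < mu) (r0 : 0 <= r).
Hypotheses (smf : smooth1 f) (smg : smooth2 g) (smG : forall t, smooth2 (G t)).
Hypotheses (glf : grad_lipschitz L f) (glg : grad_lipschitz L g).
Hypothesis hlg : hess_lipschitz L g.
Hypothesis sc : forall x, strongly_convex mu (fun y => g (col_mx x y)).
Hypothesis fb : forall x, enorm (dsubmx (grad f (col_mx x (ystar g x)))) <= mu * r.
Hypotheses (glF : forall s, grad_lipschitz L (F s)) (glG : forall t, grad_lipschitz L (G t)).
Hypothesis hlG : forall t, hess_lipschitz L (G t).
Hypothesis meanF : forall w, has_mean_mx P1 (fun s => grad (F s) w) (grad f w).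
Hypothesis meanG : forall w, has_mean_mx P2 (fun t => grad (G t) w) (grad g w).
Hypothesis meanH : forall w, has_mean_mx P2 (fun t => hess (G t) w) (hess g w).
Hypothesis varF : forall w,
  ('E_P1[fun s => (enorm (grad (F s) w - grad f w) ^+ 2)%R] <= (sf ^+ 2)%:E)%E.
Hypothesis varG : forall w,
  ('E_P2[fun t => (enorm (grad (G t) w - grad g w) ^+ 2)%R] <= (sg1 ^+ 2)%:E)%E.
Hypothesis varH : forall w,
  ('E_P2[fun t => (opnorm (hess (G t) w - hess g w) ^+ 2)%R] <= (sg2 ^+ 2)%:E)%E.
Hypothesis Hlb : forall x, Hinf <= hyper f g x.
Hypotheses (rhoxE : forall k, rhox k = rho k) (rhoyE : forall k, rhoy k = rho k).
Hypothesis rhozE : forall k, rhoz k = rho k.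
Hypotheses (zup0 : enorm (tz uprev0) <= r) (zu0 : enorm (tz u0) <= r).

Let M := L * (1 + r).
Let state k w := srmba F G r alpha beta gamma rhox rhoy rhoz uprev0 u0 vprev0
  (fun j => xi j w) (fun j => zeta j w) k.

Definition prev_point k w := (state k w).1.1.
Definition point k w := (state k w).1.2.
Definition prev_direction k w := (state k w).2.

Lemma prev_pointS k w : prev_point k.+1 w = point k w.
Proof. by rewrite /prev_point /point /state /=; case: srmba => [[a b] c]. Qed.

Lemma prev_directionS k w : prev_direction k.+1 w =
  momentum3 (rho k) (direction (F (xi k w)) (G (zeta k w)) (point k w))
    (direction (F (xi k w)) (G (zeta k w)) (prev_point k w)) (prev_direction k w).
Proof.
rewrite /prev_point /point /prev_direction /state /=.
by case: srmba => [[a b] c] /=; rewrite rhoxE rhoyE rhozE.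
Qed.

Lemma pointS k w : point k.+1 w =
  update r (alpha k) (beta k) (gamma k) (point k w) (prev_direction k.+1 w).
Proof. by rewrite /point /prev_direction /state /=; case: srmba => [[a b] c]. Qed.

Lemma point_ball k w : enorm (tz (point k w)) <= r /\ enorm (tz (prev_point k w)) <= r.
Proof.
elim: k => [//|k [h1 h2]]; rewrite prev_pointS pointS; split => //.
exact: (eproj_in _ r0).
Qed.

(** The state at time [k] depends only on the samples drawn before step [k]. *)
Lemma state_measurable k : let S := pastType xi zeta k in
  [/\ mtriple (S := S) (prev_point k), mtriple (S := S) (point k) &
      mtriple (S := S) (prev_direction k)].
Proof.
elim: k => [|k [h1 h2 h3]] S; first by split; exact: mtriple_cst.
have mid := @past_id_measurable _ _ _ _ _ _ xi zeta k.
have {}h1 := mtriple_comp mid h1; have {}h2 := mtriple_comp mid h2.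
have {}h3 := mtriple_comp mid h3.
have mx := @past_xi_measurable _ _ _ _ _ _ xi zeta k; have mz := @past_zeta_measurable _ _ _ _ _ _ xi zeta k.
have mF w := has_mean_mx_mmx (meanF w); have mG w := has_mean_mx_mmx (meanG w).
have mH w := has_mean_mx_mmx (meanH w).
have D2 := mtriple_direction glF glG hlG mF mG mH mx mz h2.
have D1 := mtriple_direction glF glG hlG mF mG mH mx mz h1.
have mv : mtriple (S := S) (prev_direction k.+1).
  have -> : prev_direction k.+1 = (fun w => momentum3 (rho k)
    (direction (F (xi k w)) (G (zeta k w)) (point k w))
    (direction (F (xi k w)) (G (zeta k w)) (prev_point k w)) (prev_direction k w)).
    by apply/funext => w; exact: prev_directionS.
  refine (mtriple_momentum (rho k) D2 D1 h3).
split => //.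
  by have -> : prev_point k.+1 = point k by apply/funext => w; exact: prev_pointS.
have -> : point k.+1 = (fun w => update r (alpha k) (beta k) (gamma k)
    (point k w) (prev_direction k.+1 w)) by apply/funext => w; exact: pointS.
exact: mtriple_update.
Qed.

Section Observables.
Context {d' : measure_display} {S : measurableType d'}.

Lemma mtriple_mean_direction (U : S -> triple R dx dy) : mtriple U ->
  mtriple (fun s => direction f g (U s)).
Proof.
move=> mU; apply: (@mtriple_direction _ _ _ _ _ _ _ S S (fun=> f) (fun=> g) L _ _ _ _ _ _ id id) => //.
- by move=> w; exact: mmx_cst.
- by move=> w; exact: mmx_cst.
- by move=> w; exact: mmx_cst.
Qed.

(** The linear and quadratic parts of [hyper_taylor]; the global growth of [hyper]
    is quadratic, which is why only a local Lipschitz condition is available. *)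
Lemma hyper_loc_lip : loc_lip (hyper f g).
Proof.
move=> x; exists (enorm (hgrad f g x) + hconst L mu r) => x' x1.
have := hyper_taylor L0 mu0 r0 smf smg glf glg hlg sc fb x (x' - x).
rewrite [x + _]addrC subrK; have := dotv_norm (hgrad f g x) (x' - x).
have C0 : 0 <= hconst L mu r.
  by rewrite /hconst mulr_ge0 ?sqr_ge0 // mulr_ge0 // addr_ge0.
have h : hconst L mu r * enorm (x' - x) ^+ 2 <= hconst L mu r * enorm (x' - x).
  by rewrite ler_wpM2l // expr2 ler_piMr ?enorm_ge0.
move=> h1 h2; rewrite mulrDl.
set D := hyper f g x' - hyper f g x in h2 *; set p := dotv _ _ in h1 h2.
have -> : D = p + (D - p) by rewrite addrC subrK.
apply: le_trans (ler_normD _ _) _; apply: lerD => //; exact: le_trans h2 h.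
Qed.

Lemma mtriple_solution (U : S -> triple R dx dy) : mtriple U ->
  mtriple (fun s => solution f g (U s)).
Proof.
move=> [h1 h2 h3]; split => //=.
  exact: mmx_lipschitz (ystar_lip L0 mu0 smg glg sc) h1.
exact: mmx_lipschitz (zstar_lip L0 mu0 r0 smg glf glg hlg sc fb) h1.
Qed.

Lemma measurable_gap (U : S -> triple R dx dy) : mtriple U ->
  measurable_fun setT (fun s => gap Hinf f g (U s)).
Proof.
move=> mU; have [s1 s2 s3] := mtriple_solution mU; have [h1 h2 h3] := mU.
apply: measurable_funD; last by apply: measurable_enorm2; exact: mmxB.
apply: measurable_funD; last by apply: measurable_enorm2; exact: mmxB.
apply: measurable_funB; last exact: measurable_cst.
exact: measurable_loc_lip hyper_loc_lip h1.
Qed.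

Lemma measurable_hgrad2 (U : S -> triple R dx dy) : mtriple U ->
  measurable_fun setT (fun s => enorm (hgrad f g (tx (U s))) ^+ 2).
Proof.
move=> mU; apply: measurable_enorm2.
by have [] := mtriple_mean_direction (mtriple_solution mU).
Qed.

End Observables.

Lemma gap_ge0 u : 0 <= gap Hinf f g u.
Proof.
rewrite /gap; apply: addr_ge0; last exact: sqr_ge0.
by apply: addr_ge0; [rewrite subr_ge0|exact: sqr_ge0].
Qed.

(** The potential at time [k] weighs the error of the direction that was used
    to leave the previous point. *)
Definition potential (q : R) k w :=
  gap Hinf f g (prev_point k w)
  + q * tdist2 (prev_direction k w) (direction f g (prev_point k w)).

Let sigma2 := noise_var r sf sg1 sg2.

(** Bounds the conditional mean of the next potential, up to the noise of the
    fresh sample. *)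
Definition damped (q : R) k w :=
  gap Hinf f g (point k w) + q * ((1 - rho k) ^+ 2
    * tdist2 (prev_direction k w) (direction f g (prev_point k w))
    + 48 * M ^+ 2 * tdist2 (point k w) (prev_point k w)).

Lemma potential_measurable q k : measurable_fun (setT : set W) (potential q k).
Proof.
have [h1 h2 h3] := state_measurable k.
have mid := sub_id_measurable (@past_measurable _ _ _ _ _ _ xi zeta k).
have {}h1 := mtriple_comp mid h1; have {}h3 := mtriple_comp mid h3.
apply: measurable_funD; first exact: measurable_gap.
apply: measurable_funM; first exact: measurable_cst.
by apply: measurable_tdist2 => //; exact: mtriple_mean_direction.
Qed.

Lemma noise_var_ge0 : 0 <= sigma2.
Proof.
rewrite /sigma2 /noise_var; apply: addr_ge0; last first.
  by apply: mulr_ge0 => //; apply: mulr_ge0; exact: sqr_ge0.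
by apply: addr_ge0; [apply: mulr_ge0 => //|]; exact: sqr_ge0.
Qed.

(** The state is a function of the past and the sample of step [k] is independent
    of it, so the conditional estimate [noise_step] integrates. *)
Lemma potential_fresh q k : 0 <= q -> 0 <= rho k -> rho k <= 1 ->
  (\int[P]_w (potential q k.+1 w)%:E <=
   \int[P]_w (damped q k w + 2 * q * (rho k) ^+ 2 * sigma2)%:E)%E.
Proof.
move=> q0 rk0 rk1; have [h1 h2 h3] := state_measurable k.
pose S := pastType xi zeta k.
pose nextv (x : S * (T1 * T2)) := momentum3 (rho k)
   (direction (F x.2.1) (G x.2.2) (point k x.1))
   (direction (F x.2.1) (G x.2.2) (prev_point k x.1)) (prev_direction k x.1).
pose h (x : S * (T1 * T2)) := gap Hinf f g (point k x.1)
   + q * tdist2 (nextv x) (direction f g (point k x.1)).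
pose phi (s : S) := damped q k s + 2 * q * (rho k) ^+ 2 * sigma2.
have Eh : (\int[P]_w (potential q k.+1 w)%:E =
    \int[P]_w (EFin \o h) (w, sample xi zeta k w))%E.
  apply: eq_integral => w _; rewrite /= /h /potential prev_pointS prev_directionS.
  by [].
rewrite Eh.
apply: (@fresh_sample_le _ _ _ _ _ _ _ P xi zeta ind k (EFin \o h) (EFin \o phi)).
- apply/measurable_EFinP.
  have mst : measurable_fun setT (fst : S * (T1 * T2) -> S) by exact: measurable_fst.
  have mt : measurable_fun setT (snd : S * (T1 * T2) -> T1 * T2) by exact: measurable_snd.
  have m1 : measurable_fun setT (fun x : S * (T1 * T2) => x.2.1).
    exact: (measurableT_comp measurable_fst mt).
  have m2 : measurable_fun setT (fun x : S * (T1 * T2) => x.2.2).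
    exact: (measurableT_comp measurable_snd mt).
  have g1 := mtriple_comp mst h1; have g2 := mtriple_comp mst h2.
  have g3 := mtriple_comp mst h3.
  have mF w := has_mean_mx_mmx (meanF w); have mG w := has_mean_mx_mmx (meanG w).
  have mH w := has_mean_mx_mmx (meanH w).
  apply: measurable_funD; first exact: measurable_gap.
  apply: measurable_funM; first exact: measurable_cst.
  apply: measurable_tdist2; last exact: mtriple_mean_direction.
  have D2 := mtriple_direction glF glG hlG mF mG mH m1 m2 g2.
  have D1 := mtriple_direction glF glG hlG mF mG mH m1 m2 g1.
  have mv := mtriple_momentum (rho k) D2 D1 g3; refine mv.
- move=> x; rewrite /h /= lee_fin; apply: addr_ge0; first exact: gap_ge0.
  by apply: mulr_ge0; [exact: q0|exact: tdist2_ge0].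
- have mD := mtriple_mean_direction h1.
  have mS := measurable_tdist2 h3 mD; have mU := measurable_tdist2 h2 h1.
  apply/measurable_EFinP; apply: measurable_funD; last exact: measurable_cst.
  apply: measurable_funD; first exact: measurable_gap.
  apply: measurable_funM; first exact: measurable_cst.
  apply: measurable_funD; apply: measurable_funM; try exact: measurable_cst.
    by refine mS.
  by refine mU.
- move=> s; have [z1 z2] := point_ball k s.
  have Q1 B : measurable B -> sample_law P xi zeta k (fst @^-1` B) = P1 B.
    by move=> mB; apply: etrans (sample_law_fst P xi zeta k mB) _; exact: lawxi.
  have Q2 B : measurable B -> sample_law P xi zeta k (snd @^-1` B) = P2 B.
    by move=> mB; apply: etrans (sample_law_snd P xi zeta k mB) _; exact: lawzeta.
  have := noise_step L0 r0 Q1 Q2 smg smG glf glg hlg glF glG hlG meanF meanG meanH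
    varF varG varH (prev_direction k s) (gap_ge0 (point k s)) q0 rk0 rk1 z1 z2.
  move=> /le_trans; apply; rewrite lee_fin /phi /damped -/M -/sigma2.
  exact: fresh_regroup.
Qed.

Lemma damped_measurable q k : measurable_fun (setT : set W) (damped q k).
Proof.
have [h1 h2 h3] := state_measurable k.
have mid := sub_id_measurable (@past_measurable _ _ _ _ _ _ xi zeta k).
have {}h1 := mtriple_comp mid h1; have {}h2 := mtriple_comp mid h2.
have {}h3 := mtriple_comp mid h3.
have mS := measurable_tdist2 h3 (mtriple_mean_direction h1).
have mU := measurable_tdist2 h2 h1.
apply: measurable_funD; first exact: measurable_gap.
apply: measurable_funM; first exact: measurable_cst.
apply: measurable_funD; apply: measurable_funM; try exact: measurable_cst.
  by refine mS.
by refine mU.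
Qed.

Definition hgrad2 k w := enorm (hgrad f g (tx (point k w))) ^+ 2.

Lemma hgrad2_measurable k : measurable_fun (setT : set W) (hgrad2 k).
Proof.
have [_ h2 _] := state_measurable k.
have mid := sub_id_measurable (@past_measurable _ _ _ _ _ _ xi zeta k).
exact: measurable_hgrad2 (mtriple_comp mid h2).
Qed.

Lemma potential_ge0 q k w : 0 <= q -> 0 <= potential q k w.
Proof.
move=> q0; apply: addr_ge0; first exact: gap_ge0.
by apply: mulr_ge0 => //; exact: tdist2_ge0.
Qed.

Lemma damped_ge0 q k w : 0 <= q -> 0 <= damped q k w.
Proof.
move=> q0; apply: addr_ge0; first exact: gap_ge0.
apply: mulr_ge0 => //; apply: addr_ge0; apply: mulr_ge0; try exact: tdist2_ge0.
  exact: sqr_ge0.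
by apply: mulr_ge0 => //; exact: sqr_ge0.
Qed.

Section Schedule.
Variables cb cg lam c : R.
Hypothesis adm : admissible M mu ((L / mu) ^+ 2) ((zlip L mu r) ^+ 2) cb cg lam c.
Hypotheses (alpha_gt0 : forall k, 0 < alpha k).
Hypotheses (alpha_le : forall j k, (j <= k)%N -> alpha k <= alpha j).
Hypotheses (betaE : forall k, beta k = cb * alpha k) (gammaE : forall k, gamma k = cg * alpha k).
Hypotheses (rhoE : forall k, rho k = c * alpha k ^+ 2) (rho_le1 : forall k, rho k <= 1).
Hypothesis alpha_hconst : forall k, alpha k * hconst L mu r <= 4^-1.
Hypotheses (beta_mu : forall k, cb * alpha k * mu <= 1)
           (beta_L : forall k, cb * alpha k * L ^+ 2 <= mu).
Hypotheses (gamma_mu : forall k, cg * alpha k * mu <= 1)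
           (gamma_L : forall k, cg * alpha k * L ^+ 2 <= mu).
Hypothesis weight_double : forall k, lam / alpha k.+1 <= 2 * lam / alpha k.
Hypothesis weight_damped : forall k, lam / alpha k.+1 * (1 - rho k.+1) ^+ 2
  <= lam / alpha k - lam * ((c - 1) / 2) * alpha k.
Hypothesis alpha_cube : forall k, alpha k ^+ 3 <= k.+1%:R^-1.

Let D := 2 * lam * c ^+ 2 * sigma2.

Lemma rho_ge0 k : 0 <= rho k.
Proof.
by rewrite rhoE; apply: mulr_ge0; [exact: ltW (lt_trans ltr01 (adm_c_gt1 adm))|exact: sqr_ge0].
Qed.

Lemma weight_ge0 k : 0 <= lam / alpha k.
Proof. by apply: divr_ge0; [exact: ltW (adm_lam_gt0 adm)|exact: ltW]. Qed.

Lemma D_ge0 : 0 <= D.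
Proof.
apply: mulr_ge0; last exact: noise_var_ge0.
apply: mulr_ge0; last exact: sqr_ge0.
by apply: mulr_ge0 => //; exact: ltW (adm_lam_gt0 adm).
Qed.

(** [potential_step] read between two consecutive states of the iteration. *)
Lemma pathwise_step j w :
  damped (lam / alpha j.+1) j.+1 w + alpha j / 2 * hgrad2 j w
    <= potential (lam / alpha j) j.+1 w.
Proof.
have [z1 _] := point_ball j w.
rewrite /damped /potential /hgrad2 prev_pointS pointS betaE gammaE.
exact: (potential_step Hinf L0 mu0 r0 smf smg glf glg hlg sc fb
  (prev_direction j.+1 w) adm (alpha_gt0 j) (alpha_hconst j) (beta_mu j) (beta_L j)
  (gamma_mu j) (gamma_L j) (weight_double j) (weight_damped j) z1).
Qed.

(** The noise injected at one step is of order [alpha^3], hence summable up to a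
    logarithm. *)
Lemma noise_floor j : 2 * (lam / alpha j.+1) * (rho j.+1) ^+ 2 * sigma2 <= D * j.+1%:R^-1.
Proof.
have -> : 2 * (lam / alpha j.+1) * (rho j.+1) ^+ 2 * sigma2 = D * alpha j.+1 ^+ 3.
  rewrite rhoE; apply: noise_floor_eq; exact: lt0r_neq0.
apply: ler_wpM2l; first exact: D_ge0.
apply: le_trans (alpha_cube _) _.
by rewrite lef_pV2 ?posrE ?ltr0n // ler_nat.
Qed.

Lemma expected_step j :
  (\int[P]_w (potential (lam / alpha j.+1) j.+2 w)%:E
     + (alpha j / 2)%:E * \int[P]_w (hgrad2 j w)%:E <=
   \int[P]_w (potential (lam / alpha j) j.+1 w)%:E + (D * j.+1%:R^-1)%:E)%E.
Proof.
have a2 : 0 <= alpha j / 2 by apply: divr_ge0 => //; exact: ltW.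
set e := 2 * (lam / alpha j.+1) * (rho j.+1) ^+ 2 * sigma2.
have e0 : 0 <= e.
  apply: mulr_ge0; last exact: noise_var_ge0.
  apply: mulr_ge0; last exact: sqr_ge0.
  by apply: mulr_ge0 => //; exact: weight_ge0.
have fresh := @potential_fresh _ j.+1 (weight_ge0 j.+1) (rho_ge0 _) (rho_le1 _).
apply: le_trans (leeD fresh (lexx _)) _.
have mH : measurable_fun setT (fun w => (hgrad2 j w)%:E).
  by apply/measurable_EFinP; exact: hgrad2_measurable.
have mP q k : measurable_fun setT (fun w => (potential q k w)%:E).
  by apply/measurable_EFinP; exact: potential_measurable.
have mD : measurable_fun setT (fun w => (damped (lam / alpha j.+1) j.+1 w + e)%:E).
  apply/measurable_EFinP; apply: measurable_funD; first exact: damped_measurable.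
  exact: measurable_cst.
have pH w : setT w -> (0 <= (hgrad2 j w)%:E)%E by move=> _; rewrite lee_fin; exact: sqr_ge0.
have paH w : setT w -> (0 <= (alpha j / 2)%:E * (hgrad2 j w)%:E)%E.
  by move=> wT; apply: mule_ge0; [rewrite lee_fin|exact: pH].
have pD w : setT w -> (0 <= (damped (lam / alpha j.+1) j.+1 w + e)%:E)%E.
  move=> _; rewrite lee_fin; apply: addr_ge0 => //; apply: damped_ge0; exact: weight_ge0.
have pP w : setT w -> (0 <= (potential (lam / alpha j) j.+1 w)%:E)%E.
  by move=> _; rewrite lee_fin; apply: potential_ge0; exact: weight_ge0.
have pe (w : W) : setT w -> (0 <= e%:E)%E by rewrite lee_fin.
rewrite -(@ge0_integralZl_EFin _ _ _ P setT measurableT _ pH mH _ a2).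
rewrite -(@ge0_integralD _ _ _ P setT measurableT _ _ pD mD paH (measurable_funeM _ mH)).
apply: (@le_trans _ _ (\int[P]_w ((potential (lam / alpha j) j.+1 w)%:E + e%:E))%E).
  apply: ge0_le_integral_any => w; first by apply: adde_ge0; [exact: pD|exact: paH].
  rewrite -EFinM -!EFinD lee_fin -addrA [e + _]addrC addrA lerD2r.
  exact: pathwise_step.
rewrite (@ge0_integralD _ _ _ P setT measurableT _ _ pP (mP _ _) pe (measurable_cst _)).
rewrite integral_cst // [X in (_ * X)%E]probability_setT mule1.
by apply: leeD => //; rewrite lee_fin; exact: noise_floor.
Qed.

Let X0 := gap Hinf f g u0 + (lam / alpha 0) * ((1 - rho 0) ^+ 2
    * tdist2 vprev0 (direction f g uprev0) + 48 * M ^+ 2 * tdist2 u0 uprev0)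
  + 2 * (lam / alpha 0) * (rho 0) ^+ 2 * sigma2.

Lemma expected_start : (\int[P]_w (potential (lam / alpha 0) 1 w)%:E <= X0%:E)%E.
Proof.
apply: le_trans (@potential_fresh _ 0 (weight_ge0 0) (rho_ge0 _) (rho_le1 _)) _.
have -> : (\int[P]_w (damped (lam / alpha 0) 0 w +
    2 * (lam / alpha 0) * rho 0 ^+ 2 * sigma2)%:E = \int[P]_w (cst X0%:E) w)%E by [].
by rewrite integral_cst // [X in (_ * X)%E]probability_setT mule1.
Qed.

Lemma expected_telescope n :
  (\int[P]_w (potential (lam / alpha n) n.+1 w)%:E
    + \sum_(0 <= j < n) (alpha j / 2)%:E * \int[P]_w (hgrad2 j w)%:E <=
   X0%:E + \sum_(0 <= j < n) (D * j.+1%:R^-1)%:E)%E.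
Proof.
elim: n => [|n IH]; first by rewrite !big_geq // !adde0; exact: expected_start.
rewrite !big_nat_recr //= [X in (_ + X <= _)%E]addeC addeA.
apply: le_trans (leeD (expected_step n) (lexx _)) _.
by rewrite addeAC [X in (_ <= X)%E]addeA; apply: leeD.
Qed.

(** The steps decrease, so the smallest one can be taken out of the telescoped
    sum. *)
Lemma stationarity_bound K :
  (\sum_(0 <= j < K.+1) \int[P]_w (hgrad2 j w)%:E <=
   (2 / alpha K.+1 * (X0 + D * (1 + ln K.+1%:R)))%:E)%E.
Proof.
have aK := alpha_gt0 K.+1.
have a2 : 0 < alpha K.+1 / 2 by apply: divr_gt0.
have I0 j : (0 <= \int[P]_w (hgrad2 j w)%:E)%E.
  by apply: integral_ge0 => w _; rewrite lee_fin; exact: sqr_ge0.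
have S0 : (0 <= \sum_(0 <= j < K.+1) \int[P]_w (hgrad2 j w)%:E)%E by apply: sume_ge0.
have h : ((alpha K.+1 / 2)%:E * (\sum_(0 <= j < K.+1) \int[P]_w (hgrad2 j w)%:E) <=
    (X0 + D * (1 + ln K.+1%:R))%:E)%E.
  rewrite ge0_sume_distrr //.
  apply: (@le_trans _ _ (\sum_(0 <= j < K.+1) (alpha j / 2)%:E * \int[P]_w (hgrad2 j w)%:E)%E).
    rewrite !big_nat; apply: lee_sum => j /andP[_ jK]; apply: lee_wpmul2r => //.
    by rewrite lee_fin ler_pM2r ?invr_gt0 //; apply: alpha_le; exact: ltnW.
  have p0 : (0 <= \int[P]_w (potential (lam / alpha K.+1) K.+2 w)%:E)%E.
    by apply: integral_ge0 => w _; rewrite lee_fin; apply: potential_ge0; exact: weight_ge0.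
  apply: le_trans (leeDr _ p0) _; apply: le_trans (expected_telescope _) _.
  rewrite [X in (_ <= X)%E]EFinD; apply: leeD => //; rewrite sumEFin lee_fin -mulr_sumr.
  by apply: ler_wpM2l; [exact: D_ge0|exact: harmonic_le_ln].
have -> : (2 / alpha K.+1 = (alpha K.+1 / 2)^-1)%R by rewrite invf_div.
rewrite [X in (_ <= X)%E]EFinM lee_pdivlMl //; exact: h.
Qed.

End Schedule.
End Run.

(** * Initial data and the cubic schedule *)

Section InitialData.
Context {R : realType} {dx dy : nat}.

Lemma nine_terms (a b1 b2 c1 c2 c3 e1 e2 e3 : R) :
  0 <= a -> 0 <= b1 -> 0 <= b2 -> 0 <= c1 -> 0 <= c2 -> 0 <= c3 ->
  0 <= e1 -> 0 <= e2 -> 0 <= e3 ->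
  let s := a + b1 + b2 + c1 + c2 + c3 + e1 + e2 + e3 in
  [/\ 0 <= s, a + b1 ^+ 2 + b2 ^+ 2 <= s + 2 * s ^+ 2,
      c1 ^+ 2 + c2 ^+ 2 + c3 ^+ 2 <= 3 * s ^+ 2 &
      e1 ^+ 2 + e2 ^+ 2 + e3 ^+ 2 <= 3 * s ^+ 2].
Proof.
move=> a0 b10 b20 c10 c20 c30 e10 e20 e30 s.
have le2 (x : R) : 0 <= x -> x <= s -> x ^+ 2 <= s ^+ 2 by exact: sqr_le2.
have sE : s = a + b1 + b2 + c1 + c2 + c3 + e1 + e2 + e3 by [].
clearbody s.
have := le2 b1 b10 ltac:(lra); have := le2 b2 b20 ltac:(lra).
have := le2 c1 c10 ltac:(lra); have := le2 c2 c20 ltac:(lra).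
have := le2 c3 c30 ltac:(lra); have := le2 e1 e10 ltac:(lra).
have := le2 e2 e20 ltac:(lra); have := le2 e3 e30 ltac:(lra).
clear le2 => *; split; lra.
Qed.

Lemma init_size_bounds (f g : 'cV[R]_(dx + dy) -> R) (uprev0 u0 vprev0 : triple R dx dy) :
  has_lbound (range (hyper f g)) ->
  let s := init_size f g uprev0 u0 vprev0 in
  [/\ 0 <= s, gap (inf (range (hyper f g))) f g u0 <= s + 2 * s ^+ 2,
      tdist2 u0 uprev0 <= 3 * s ^+ 2 &
      tdist2 vprev0 (direction f g uprev0) <= 3 * s ^+ 2].
Proof.
move=> lb s; apply: nine_terms; try exact: enorm_ge0.
by rewrite subr_ge0; apply: ge_inf => //; exists (tx u0).
Qed.

(** A bound for the initial value of the potential that depends on the data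
    only through their size [s]. *)
Definition start_bound (w m2 v s : R) :=
  s + 2 * s ^+ 2 + w * (3 * s ^+ 2 + 144 * m2 * s ^+ 2 + 2 * v).

Lemma start_bound_ge0 (w m2 v s : R) : 0 <= w -> 0 <= m2 -> 0 <= v -> 0 <= s ->
  0 <= start_bound w m2 v s.
Proof.
move=> w0 m0 v0 s0; have s2 : 0 <= s ^+ 2 := sqr_ge0 s.
apply: addr_ge0; first by apply: addr_ge0 => //; exact: mulr_ge0.
apply: mulr_ge0 => //; apply: addr_ge0; last exact: mulr_ge0.
by apply: addr_ge0; apply: mulr_ge0 => //; exact: mulr_ge0.
Qed.

(** The first step is already averaged over a fresh sample, which is why the
    initial bound contains a noise term. *)
Lemma start_le (w m2 v s G t e rho : R) : 0 <= w -> 0 <= m2 -> 0 <= v ->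
  0 <= t -> 0 <= rho -> rho <= 1 ->
  G <= s + 2 * s ^+ 2 -> t <= 3 * s ^+ 2 -> e <= 3 * s ^+ 2 ->
  G + w * ((1 - rho) ^+ 2 * t + 48 * m2 * e) + 2 * w * rho ^+ 2 * v
    <= start_bound w m2 v s.
Proof.
move=> w0 m0 v0 t0 r0 r1 hG ht he.
have h1 : (1 - rho) ^+ 2 * t <= 3 * s ^+ 2.
  apply: le_trans ht; rewrite ler_piMl // expr_le1 // ?subr_ge0 //.
  by rewrite lerBlDr lerDl.
have h2 : m2 * e <= m2 * (3 * s ^+ 2) by exact: ler_wpM2l.
have h3 : rho ^+ 2 * v <= v by rewrite ler_piMl // expr_le1.
have h4 : (1 - rho) ^+ 2 * t + 48 * (m2 * e) + 2 * (rho ^+ 2 * v) <=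
    3 * s ^+ 2 + 144 * (m2 * s ^+ 2) + 2 * v by lra.
have := ler_wpM2l w0 h4; rewrite /start_bound; lra.
Qed.

End InitialData.

Section Schedule.
Context {R : realType}.

Lemma inv_mul_le (a E X Y : R) : 0 < E -> E <= a -> 0 <= Y -> X <= Y * E -> a^-1 * X <= Y.
Proof.
move=> E0 Ea Y0 XY; rewrite ler_pdivrMl ?(lt_le_trans E0) // mulrC.
by apply: le_trans XY _; apply: ler_wpM2l.
Qed.

Lemma inv_sqr_mul_le (a E c : R) : 1 <= E -> E <= a -> c <= E -> c * (a^-1) ^+ 2 <= 1.
Proof.
move=> E1 Ea cE; have a0 : 0 < a by lra.
rewrite exprVn ler_pdivrMr ?exprn_gt0 // mul1r; nra.
Qed.

(** Every smallness condition on a step is of the form [step * x <= y]; it holds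
    once [1 / step] is at least this number. *)
Definition inverse_step (h cb cg c l mu : R) :=
  1 + 4 * h + cb * (l / mu + mu) + cg * (l / mu + mu) + c.

Lemma inverse_step_bounds (h cb cg c l mu : R) :
  0 <= h -> 0 < cb -> 0 < cg -> 0 < c -> 0 <= l -> 0 < mu ->
  [/\ 1 <= inverse_step h cb cg c l mu, h <= 4^-1 * inverse_step h cb cg c l mu &
      c <= inverse_step h cb cg c l mu] /\
  [/\ cb * mu <= 1 * inverse_step h cb cg c l mu, cb * l <= mu * inverse_step h cb cg c l mu,
      cg * mu <= 1 * inverse_step h cb cg c l mu & cg * l <= mu * inverse_step h cb cg c l mu].
Proof.
move=> h0 b0 g0 c0 l0 mu0; rewrite /inverse_step.
have := divr_ge0 l0 (ltW mu0); have : mu * (l / mu) = l by rewrite mulrC divfK ?gt_eqF.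
set q := l / mu => ql q0.
have := mulr_ge0 (ltW b0) q0; have := mulr_ge0 (ltW g0) q0.
have := mulr_ge0 (ltW b0) (ltW mu0); have := mulr_ge0 (ltW g0) (ltW mu0).
move=> p1 p2 p3 p4.
have p5 := mulr_ge0 (ltW mu0) h0; have p6 := mulr_ge0 (ltW mu0) (ltW c0).
have p7 := mulr_ge0 (ltW mu0) p1; have p8 := mulr_ge0 (ltW mu0) p2.
have p9 := mulr_ge0 (ltW mu0) p3; have pA := mulr_ge0 (ltW mu0) p4.
have e1 : cb * l = mu * (cb * q) by rewrite -ql; ring.
have e2 : cg * l = mu * (cg * q) by rewrite -ql; ring.
by split; split; rewrite ?e1 ?e2; lra.
Qed.

(** The final bookkeeping: the averaged sum carries the factor
    [1 / (K alpha_K)], of order [K^(-2/3)]. *)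
Lemma average_rate (eta X Y S : R) (K : nat) : (3 <= K)%N -> 0 <= eta -> 0 <= X -> 0 <= Y ->
  S <= 2 * cbrt (eta + K%:R) * (X + Y * (1 + ln K%:R)) ->
  K%:R^-1 * S <=
  2 * (1 + eta) * (X / ln 2 + Y * ((ln 2)^-1 + 2)) * (ln (K.-1)%:R / K%:R `^ (2 / 3)).
Proof.
move=> K3 eta0 X0 Y0 hS; have K0 : (0 < K)%N by apply: leq_trans K3.
have h1 := rate_bound eta0 K0; have h2 := log_absorb K3 X0 Y0.
set Z := X / ln 2 + _ in h2 *.
have q0 : 0 <= K%:R^-1 * cbrt (eta + K%:R) by rewrite mulr_ge0 ?cbrt_ge0 // invr_ge0.
have lnK : 0 <= ln (K%:R : R) by rewrite ln_ge0 // ler1n.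
have s0 : 0 <= X + Y * (1 + ln K%:R) by rewrite addr_ge0 // mulr_ge0 // addr_ge0.
have := ler_pM q0 s0 h1 h2; set T := X + _ in hS s0 *.
move=> hp; apply: le_trans (_ : 2 * (K%:R^-1 * cbrt (eta + K%:R) * T) <= _).
  have -> : 2 * (K%:R^-1 * cbrt (eta + K%:R) * T) = K%:R^-1 * (2 * cbrt (eta + K%:R) * T) by ring.
  by apply: ler_wpM2l hS; rewrite invr_ge0.
apply: le_trans (ler_wpM2l (ler0n _ 2) hp) _.
by rewrite le_eqVlt; apply/orP; left; apply/eqP; ring.
Qed.

End Schedule.

Lemma grad_lipschitzW (R : realType) n (L L' : R) (h : 'cV[R]_n -> R) :
  L <= L' -> grad_lipschitz L h -> grad_lipschitz L' h.
Proof.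
by move=> LL lip w w'; apply: le_trans (lip w w') _; apply: ler_wpM2r => //; exact: enorm_ge0.
Qed.

Lemma hess_lipschitzW (R : realType) n (L L' : R) (h : 'cV[R]_n -> R) :
  L <= L' -> hess_lipschitz L h -> hess_lipschitz L' h.
Proof.
by move=> LL lip w w'; apply: le_trans (lip w w') _; apply: ler_wpM2r => //; exact: enorm_ge0.
Qed.

Section CubicSchedule.
Context {R : realType}.
Variable E : R.
Hypothesis E1 : 1 <= E.

(** The reciprocal of the step size; the schedule starts at [E], so that a large
    [E] makes every step small. *)
Definition invstep k : R := cbrt (E ^+ 3 + k%:R).

Let E0 : 0 <= E. Proof. exact: le_trans ler01 E1. Qed.
Let arg_ge0 k : 0 <= E ^+ 3 + k%:R.
Proof. by rewrite addr_ge0 // exprn_ge0. Qed.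

Lemma invstep_cube k : invstep k ^+ 3 = E ^+ 3 + k%:R.
Proof. exact: cbrt_cube. Qed.

Lemma invstep_ge k : E <= invstep k.
Proof. by apply: cbrt_ge => //; rewrite lerDl. Qed.

Lemma invstep_ge1 k : 1 <= invstep k. Proof. exact: le_trans E1 (invstep_ge k). Qed.

Lemma invstep_gt0 k : 0 < invstep k. Proof. exact: lt_le_trans ltr01 (invstep_ge1 k). Qed.

Lemma invstep0 : invstep 0 = E.
Proof.
apply/eqP; rewrite eq_le invstep_ge andbT.
by apply: cbrt_le => //; rewrite addr0.
Qed.

Lemma invstep_le j k : (j <= k)%N -> (invstep k)^-1 <= (invstep j)^-1.
Proof.
move=> jk; rewrite lef_pV2 ?posrE ?invstep_gt0 //.
by apply: cbrt_ge; [exact: cbrt_ge0|rewrite invstep_cube lerD2l ler_nat].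
Qed.

Lemma step_cube_le k : (invstep k)^-1 ^+ 3 <= k.+1%:R^-1.
Proof.
rewrite exprVn invstep_cube lef_pV2 ?posrE ?ltr0n //; last first.
  by rewrite ltr_pwDl // exprn_gt0 // (lt_le_trans ltr01).
by rewrite -natr1 addrC lerD2r exprn_ege1.
Qed.

Lemma invstep_weights lam c k : 0 < lam -> 1 < c -> c <= E ->
  lam / (invstep k.+1)^-1 <= 2 * lam / (invstep k)^-1 /\
  lam / (invstep k.+1)^-1 * (1 - c * (invstep k.+1)^-1 ^+ 2) ^+ 2
    <= lam / (invstep k)^-1 - lam * ((c - 1) / 2) * (invstep k)^-1.
Proof.
move=> lam0 c1 cE; apply: step_weights => //; try exact: invstep_ge1.
  by rewrite !invstep_cube -natr1 addrA.
exact: inv_sqr_mul_le E1 (invstep_ge _) cE.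
Qed.

End CubicSchedule.

(** * The convergence rate *)

Theorem theorem3p11 (R : realType) (Lf Cf L1g L2g mu sf sg1 sg2 : R) :
  0 <= Lf -> 0 <= Cf -> 0 <= L1g -> 0 <= L2g -> 0 < mu ->
  0 < sf -> 0 < sg1 -> 0 < sg2 ->
  exists eta cbeta cgamma cx cy cz : R,
  [/\ 0 < eta, 0 < cbeta & 0 < cgamma] /\ [/\ 0 < cx, 0 < cy & 0 < cz] /\
  exists (C : R -> R) (K0 : R -> nat),
  forall (dx dy : nat)
    (dO d1 d2 : measure_display) (Omega : measurableType dO)
    (T1 : measurableType d1) (T2 : measurableType d2)
    (P : probability Omega R) (P1 : probability T1 R) (P2 : probability T2 R)
    (F : T1 -> 'cV[R]_(dx + dy) -> R) (G : T2 -> 'cV[R]_(dx + dy) -> R)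
    (f g : 'cV[R]_(dx + dy) -> R)
    (xi : nat -> {mfun Omega >-> T1}) (zeta : nat -> {mfun Omega >-> T2})
    (alpha beta gamma rhox rhoy rhoz : nat -> R)
    (uprev0 u0 vprev0 : triple R dx dy),
  smooth1 f -> smooth2 g ->
  (forall s, smooth1 (F s)) -> (forall t, smooth2 (G t)) ->
  (forall w, has_mean P1 (F^~ w) (f w)) ->
  (forall w, has_mean P2 (G^~ w) (g w)) ->
  (forall w, has_mean_mx P1 (fun s => grad (F s) w) (grad f w)) ->
  (forall w, has_mean_mx P2 (fun t => grad (G t) w) (grad g w)) ->
  (forall w, has_mean_mx P2 (fun t => hess (G t) w) (hess g w)) ->
  grad_lipschitz Lf f ->
  (forall x, enorm (dsubmx (grad f (col_mx x (ystar g x)))) <= Cf) ->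
  grad_lipschitz L1g g -> hess_lipschitz L2g g ->
  (forall x, strongly_convex mu (fun y => g (col_mx x y))) ->
  (forall w, ('E_P1[fun s => (enorm (grad (F s) w - grad f w) ^+ 2)%R]
               <= (sf ^+ 2)%:E)%E) ->
  (forall w, ('E_P2[fun t => (enorm (grad (G t) w - grad g w) ^+ 2)%R]
               <= (sg1 ^+ 2)%:E)%E) ->
  (forall w, ('E_P2[fun t => (opnorm (hess (G t) w - hess g w) ^+ 2)%R]
               <= (sg2 ^+ 2)%:E)%E) ->
  (forall s, grad_lipschitz Lf (F s)) ->
  (forall t, grad_lipschitz L1g (G t)) ->
  (forall t, hess_lipschitz L2g (G t)) ->
  has_lbound (range (hyper f g)) ->
  (forall k A, measurable A -> P (xi k @^-1` A) = P1 A) ->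
  (forall k B, measurable B -> P (zeta k @^-1` B) = P2 B) ->
  independent_samples P xi zeta ->
  eball (Cf / mu) (tz uprev0) -> eball (Cf / mu) (tz u0) ->
  (forall k, alpha k = ((eta + k%:R) `^ (3^-1))^-1) ->
  (forall k, beta k = cbeta * alpha k) ->
  (forall k, gamma k = cgamma * alpha k) ->
  (forall k, rhox k = cx * alpha k ^+ 2) ->
  (forall k, rhoy k = cy * alpha k ^+ 2) ->
  (forall k, rhoz k = cz * alpha k ^+ 2) ->
  let delta := init_size f g uprev0 u0 vprev0 in
  let x k omega :=
    srmba_x F G (Cf / mu) alpha beta gamma rhox rhoy rhoz uprev0 u0 vprev0
      (fun j => xi j omega) (fun j => zeta j omega) k in
  forall K : nat, (1 < K)%N -> (K0 delta <= K)%N ->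
  ((K%:R^-1)%:E *
     \sum_(0 <= k < K)
        'E_P[fun omega => (enorm (grad (hyper f g) (x k omega)) ^+ 2)%R]
   <= (C delta * (ln (K.-1)%:R / K%:R `^ (2 / 3)))%:E)%E.
Proof.
move=> Lf0 Cf0 L1g0 L2g0 mu0 sf0 sg10 sg20.
(* One Lipschitz constant serves all functions; the summand 1 keeps it positive. *)
pose L := 1 + Lf + L1g + L2g; pose r := Cf / mu; pose M := L * (1 + r).
have r0 : 0 <= r by rewrite divr_ge0 // ltW.
have LfL : Lf <= L by rewrite /L; lra.
have L1L : L1g <= L by rewrite /L; lra.
have L2L : L2g <= L by rewrite /L; lra.
have Lpos : 0 < L by rewrite /L; lra.
have M0 : 0 < M by rewrite mulr_gt0 // ltr_pwDl.
have L0 := ltW Lpos.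
have [cb [cg [lam [c adm]]]] :=
  @admissible_exists R M mu ((L / mu) ^+ 2) ((zlip L mu r) ^+ 2) M0 mu0 (sqr_ge0 _) (sqr_ge0 _).
have cb0 := adm_cb_gt0 adm; have cg0 := adm_cg_gt0 adm.
have lam0 := adm_lam_gt0 adm; have c1 := adm_c_gt1 adm.
have c0 : 0 < c := lt_trans ltr01 c1.
have h0 : 0 <= hconst L mu r.
  by rewrite /hconst mulr_ge0 ?sqr_ge0 // mulr_ge0 // addr_ge0.
(* [E] is the smallest reciprocal step, so [eta = E^3]. *)
pose E := inverse_step (hconst L mu r) cb cg c (L ^+ 2) mu.
have [[E1 hE cE] [bmE bLE gmE gLE]] :=
  @inverse_step_bounds R (hconst L mu r) cb cg c (L ^+ 2) mu h0 cb0 cg0 c0 (sqr_ge0 L) mu0.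
rewrite -/E in E1 hE cE bmE bLE gmE gLE.
have E0 : 0 < E := lt_le_trans ltr01 E1.
pose v := noise_var r sf sg1 sg2; have v0 : 0 <= v := noise_var_ge0 r sf sg1 sg2.
pose D := 2 * lam * c ^+ 2 * v.
have D0 : 0 <= D.
  by apply: mulr_ge0 v0; apply: mulr_ge0 (sqr_ge0 _); apply: mulr_ge0 (ltW lam0).
exists (E ^+ 3), cb, cg, c, c, c; split; first by split=> //; exact: exprn_gt0.
split; first by [].
exists (fun s => 2 * (1 + E ^+ 3) *
  (start_bound (lam * E) (M ^+ 2) v s / ln 2 + D * ((ln 2)^-1 + 2))), (fun=> 3%N).
move=> dx dy dO d1 d2 Omega T1 T2 P P1 P2 F G f g xi zeta alpha beta gamma rhox rhoy rhoz.
move=> uprev0 u0 vprev0 smf smg _ smG _ _ meanF meanG meanH glf fb glg hlg sc varF varG varH.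
move=> glF glG hlG lb lawxi lawzeta ind zup0 zu0 alphaE betaE gammaE rhoxE rhoyE rhozE delta x.
have {}glf := grad_lipschitzW LfL glf; have {}glg := grad_lipschitzW L1L glg.
have {}hlg := hess_lipschitzW L2L hlg.
have {}glF s := grad_lipschitzW LfL (glF s); have {}glG t := grad_lipschitzW L1L (glG t).
have {}hlG t := hess_lipschitzW L2L (hlG t).
have {}fb y : enorm (dsubmx (grad f (col_mx y (ystar g y)))) <= mu * r.
  by rewrite /r mulrC divfK ?gt_eqF.
have Hlb y : inf (range (hyper f g)) <= hyper f g y by apply: ge_inf => //; exists y.
have aE k : alpha k = (invstep E k)^-1 := alphaE k.
have a0 k : 0 < alpha k by rewrite aE invr_gt0; exact: invstep_gt0.
have ale j k : (j <= k)%N -> alpha k <= alpha j by move=> jk; rewrite !aE; exact: invstep_le.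
have small X Y k : 0 <= Y -> X <= Y * E -> alpha k * X <= Y.
  by move=> Y0 XY; rewrite aE; exact: inv_mul_le E0 (invstep_ge E1 k) Y0 XY.
have smallb b X Y k : 0 <= Y -> b * X <= Y * E -> b * alpha k * X <= Y.
  by move=> Y0 XY; rewrite mulrAC mulrC; exact: small.
have rle k : rhox k <= 1.
  by rewrite rhoxE aE; exact: inv_sqr_mul_le E1 (invstep_ge E1 k) cE.
have w2 k : lam / alpha k.+1 <= 2 * lam / alpha k.
  by rewrite !aE; have [] := invstep_weights E1 k lam0 c1 cE.
have wd k : lam / alpha k.+1 * (1 - rhox k.+1) ^+ 2
    <= lam / alpha k - lam * ((c - 1) / 2) * alpha k.
  by rewrite rhoxE !aE; have [] := invstep_weights E1 k lam0 c1 cE.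
have acube k : alpha k ^+ 3 <= k.+1%:R^-1 by rewrite aE; exact: step_cube_le.
have rxE k : rhox k = rhox k by [].
have ryE k : rhoy k = rhox k by rewrite rhoyE rhoxE.
have rzE k : rhoz k = rhox k by rewrite rhozE rhoxE.
have ah k : alpha k * hconst L mu r <= 4^-1 by apply: small.
have bm k : cb * alpha k * mu <= 1 by exact: smallb.
have bL k : cb * alpha k * L ^+ 2 <= mu by apply: smallb => //; exact: ltW.
have gm k : cg * alpha k * mu <= 1 by exact: smallb.
have gL k : cg * alpha k * L ^+ 2 <= mu by apply: smallb => //; exact: ltW.
have [d0 dg dt de] := init_size_bounds uprev0 u0 vprev0 lb.
rewrite -/delta in d0 dg dt de.
case=> [//|K] _ K3.
have bound := @stationarity_bound R dx dy dO d1 d2 Omega T1 T2 P P1 P2 xi zeta F G f g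
  L mu r (inf (range (hyper f g))) sf sg1 sg2 alpha beta gamma rhox rhoy rhoz rhox
  uprev0 u0 vprev0 ind lawxi lawzeta L0 mu0 r0 smf smg smG glf glg hlg sc fb glF glG hlG
  meanF meanG meanH varF varG varH Hlb rxE ryE rzE zup0 zu0 cb cg lam c adm a0 ale
  betaE gammaE rhoxE rle ah bm bL gm gL w2 wd acube K.
rewrite -/v -/D -/M in bound.
have wE : lam / alpha 0 = lam * E by rewrite aE invrK invstep0.
have r00 : 0 <= rhox 0 by rewrite rhoxE mulr_ge0 ?sqr_ge0 // ltW.
have wE0 : 0 <= lam * E by rewrite mulr_ge0 // ltW.
have start := start_le wE0 (sqr_ge0 M) v0 (tdist2_ge0 _ _) r00 (rle 0) dg de dt.
rewrite wE in bound.
have sumE : (\sum_(0 <= k < K.+1)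
    'E_P[fun omega => (enorm (grad (hyper f g) (x k omega)) ^+ 2)%R] =
  \sum_(0 <= k < K.+1) \int[P]_w (hgrad2 xi zeta F G f g r alpha beta gamma rhox rhoy rhoz
    uprev0 u0 vprev0 k w)%:E)%E.
  apply: eq_bigr => k _; rewrite expectation.unlock; apply: eq_integral => w _.
  by rewrite (grad_hyper L0 mu0 r0 smf smg glf glg hlg sc fb).
rewrite sumE.
have X0 := start_bound_ge0 wE0 (sqr_ge0 M) v0 d0.
have eta0 : 0 <= E ^+ 3 by rewrite exprn_ge0 // ltW.
have lnK : 0 <= ln (K.+1%:R : R) by rewrite ln_ge0 // ler1n.
apply: (@le_trans _ _ ((K.+1%:R^-1)%:E * (2 * cbrt (E ^+ 3 + K.+1%:R) *
   (start_bound (lam * E) (M ^+ 2) v delta + D * (1 + ln K.+1%:R)))%:E)%E).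
  apply: lee_wpmul2l; first by rewrite lee_fin invr_ge0.
  apply: le_trans bound _; rewrite lee_fin aE invrK.
  apply: ler_wpM2l; first by rewrite mulr_ge0 // cbrt_ge0.
  by rewrite lerD2r.
rewrite -EFinM lee_fin.
exact: average_rate K3 eta0 X0 D0 (lexx _).
Qed.
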